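(* Let $\beta,\eta>0$. The reproducing kernel of the Hilbert space $A^{2,\beta,\eta}_{slice}$ is given, for $p,q\in\mathbb{B}$, by $$K_{\beta,\eta}(p,q)=\frac{\Gamma(\beta+\eta)}{\pi\,\Gamma(\eta)\Gamma(\beta)}\;{_2F_1}^*\left(\begin{array}{c}1,\ \eta+\beta\\ \beta\end{array}\bigg|\,[p,\overline{q}]\right).$$
   Context: $\mathbb{H}$ denotes the quaternions, $\mathbb{B}$ the open unit ball of $\mathbb{H}$, $\mathbb{S}=\{q\in\mathbb{H}: q^2=-1\}$, and for $I\in\mathbb{S}$, $\mathbb{C}_I=\mathbb{R}+I\mathbb{R}$, $\mathbb{B}_I=\mathbb{B}\cap\mathbb{C}_I$. A (real differentiable) function $f:\mathbb{B}\to\mathbb{H}$ is (left) slice regular, $f\in\mathcal{SR}(\mathbb{B})$, if $\frac12\left(\frac{\partial}{\partial x}+I\frac{\partial}{\partial y}\right)f|_{\mathbb{C}_I}(x+Iy)=0$ for every $I\in\mathbb{S}$; such functions are exactly the convergent power series $\sum_{n\ge0}q^nc_n$ on $\mathbb{B}$ with $c_n\in\mathbb{H}$. Let $\omega_{\beta,\eta}(t)=t^{\beta-1}(1-t)^{\eta-1}$ on $(0,1)$. For a fixed $I\in\mathbb{S}$, $A^{2,\beta,\eta}_{slice}$ is the space of all $f\in\mathcal{SR}(\mathbb{B})$ whose restriction to $\mathbb{B}_I$ is in $L^2(\mathbb{B}_I,\omega_{\beta,\eta}(|q|^2)\,dx\,dy)$, with inner product $$\langle f,g\rangle=\int_{\mathbb{B}_I}\overline{f(x+Iy)}\,g(x+Iy)\,\omega_{\beta,\eta}(x^2+y^2)\,dx\,dy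 .$$ Equivalently, it is the space of series $\sum_n q^nc_n$ with $\sum_n\gamma_n^{\beta,\eta}|c_n|^2<\infty$, where $\gamma_n^{\beta,\eta}=\frac{\Gamma(\eta)\Gamma(\beta+n)}{\Gamma(\beta+\eta+n)}$. A reproducing kernel $K$ means: $K(\cdot,q)\in A^{2,\beta,\eta}_{slice}$ and $f(q)=\langle K(\cdot,q),f\rangle$ for all $f\in A^{2,\beta,\eta}_{slice}$ and $q\in\mathbb{B}$. The quaternionic Gauss hypergeometric function is, for $p,q\in\mathbb{B}$ and real $a,b,c$, $${_2F_1}^*\left(\begin{array}{c}a,\ b\\ c\end{array}\bigg|\,[p,q]\right)=\sum_{k=0}^\infty\frac{(a)_k(b)_k}{(c)_k}\frac{p^kq^k}{k!},$$ with $(a)_k=a(a+1)\cdots(a+k-1)$, $(a)_0=1$. *)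

(* Defs.v *)
From HB Require Import structures.
From mathcomp Require Import all_boot all_order all_algebra.
From mathcomp Require Import all_classical all_reals all_analysis.
From mathcomp Require Import ring.

Set Implicit Arguments.
Unset Strict Implicit.
Unset Printing Implicit Defensive.

Import Order.TTheory GRing.Theory Num.Theory.
Import numFieldNormedType.Exports.

Local Open Scope classical_set_scope.
Local Open Scope ring_scope.

(* The quaternion a + b i + c j + d k is the row vector (a, b, c, d). The type
   inherits the real normed-module structure of 'rV[R]_4: `|q| is therefore the
   sup norm (with the usual topology, which is all that limits and derivatives
   use), NOT the quaternionic modulus, which is [qabs] below. *)
Definition quat (R : realType) : Type := 'rV[R]_4.

HB.instance Definition _ (R : realType) :=
  NormedModule.copy (quat R) 'rV[R]_4.

Section QuatRing.
Variable R : realType.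
Implicit Types p q r : quat R.

Definition mkquat (a b c d : R) : quat R :=
  \row_(i < 4) [:: a; b; c; d]`_i.

(* Numerals in ['I_4] are residues modulo 4. *)
Definition qone : quat R := mkquat 1 0 0 0.

Definition qmul p q : quat R :=
  mkquat
    (p 0 0 * q 0 0 - p 0 1 * q 0 1 - p 0 2 * q 0 2 - p 0 3 * q 0 3)
    (p 0 0 * q 0 1 + p 0 1 * q 0 0 + p 0 2 * q 0 3 - p 0 3 * q 0 2)
    (p 0 0 * q 0 2 - p 0 1 * q 0 3 + p 0 2 * q 0 0 + p 0 3 * q 0 1)
    (p 0 0 * q 0 3 + p 0 1 * q 0 2 - p 0 2 * q 0 1 + p 0 3 * q 0 0).

Lemma quatP p q :
  [/\ p 0 0 = q 0 0, p 0 1 = q 0 1, p 0 2 = q 0 2 & p 0 3 = q 0 3] -> p = q.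
Proof.
case=> e0 e1 e2 e3; apply/rowP => i.
by case: i => -[|[|[|[|//]]]] Hi;
  [move: e0 | move: e1 | move: e2 | move: e3];
  congr (p _ _ = q _ _); apply/val_inj.
Qed.

Lemma mkquatE a b c d :
  (mkquat a b c d 0 0 = a) * (mkquat a b c d 0 1 = b) *
  (mkquat a b c d 0 2 = c) * (mkquat a b c d 0 3 = d).
Proof. by rewrite /mkquat !mxE. Qed.

Lemma qmulA : associative qmul.
Proof. by move=> p q r; apply: quatP; rewrite /qmul !mkquatE; split; ring. Qed.

Lemma qmul1l : left_id qone qmul.
Proof. by move=> p; apply: quatP; rewrite /qmul /qone !mkquatE; split; ring. Qed.

Lemma qmul1r : right_id qone qmul.
Proof. by move=> p; apply: quatP; rewrite /qmul /qone !mkquatE; split; ring. Qed.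

Lemma qmulDl : left_distributive qmul +%R.
Proof.
move=> p q r; apply: quatP; rewrite /qmul !mxE /=; split; ring.
Qed.

Lemma qmulDr : right_distributive qmul +%R.
Proof.
move=> p q r; apply: quatP; rewrite /qmul !mxE /=; split; ring.
Qed.

Lemma qone_neq0 : qone != 0.
Proof.
apply/eqP => /rowP /(_ 0); rewrite /qone mkquatE mxE => /eqP.
by rewrite oner_eq0.
Qed.

End QuatRing.

HB.instance Definition _ (R : realType) :=
  GRing.Zmodule_isNzRing.Build (quat R)
    (@qmulA R) (@qmul1l R) (@qmul1r R) (@qmulDl R) (@qmulDr R) (@qone_neq0 R).

Lemma quat_scaleAl (R : realType) (a : R) (p q : quat R) :
  a *: (p * q) = (a *: p) * q.
Proof. by apply: quatP; rewrite ![_ * _]/(qmul _ _) /qmul !mxE /=; split; ring. Qed.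

Lemma quat_scaleAr (R : realType) (a : R) (p q : quat R) :
  a *: (p * q) = p * (a *: q).
Proof. by apply: quatP; rewrite ![_ * _]/(qmul _ _) /qmul !mxE /=; split; ring. Qed.

HB.instance Definition _ (R : realType) :=
  GRing.Lmodule_isLalgebra.Build R (quat R) (@quat_scaleAl R).
HB.instance Definition _ (R : realType) :=
  GRing.Lalgebra_isAlgebra.Build R (quat R) (@quat_scaleAr R).

Section SliceRegular.
Variable R : realType.
Implicit Types (p q I : quat R) (f g : quat R -> quat R).

Definition qconj q : quat R := mkquat (q 0 0) (- q 0 1) (- q 0 2) (- q 0 3).

Definition qabs q : R := Num.sqrt (\sum_(i < 4) q 0 i ^+ 2).

Definition qball : set (quat R) := [set q | qabs q < 1].

Definition qsphere : set (quat R) := [set q | q ^+ 2 = -1].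

Definition slice_pt I (x y : R) : quat R := x%:A + y *: I.

(* [differentiable] is real (Frechet) differentiability on the 4-dimensional
   space; it guarantees that the two partial derivatives below exist. Only the
   values of f on the open ball matter. *)
Definition slice_regular f : Prop :=
  (forall q, qball q -> differentiable f q) /\
  (forall I, qsphere I -> forall x y : R, qball (slice_pt I x y) ->
     2^-1 *: (derive1 (fun s : R => f (slice_pt I s y)) x
              + I * derive1 (fun t : R => f (slice_pt I x t)) y) = 0).

End SliceRegular.

Section BergmanSpace.
Variable R : realType.
Implicit Types (p q I : quat R) (f g : quat R -> quat R) (beta eta : R).

Local Notation plane := (measurableTypeR R * measurableTypeR R)%type.

Definition area : {measure set plane -> \bar R} :=
  (@lebesgue_measure R \x @lebesgue_measure R)%E.

(* The part of the unit ball lying in R + R I, in the coordinates (x, y) of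
   x + y I. *)
Definition slice_ball I : set plane :=
  [set z | qball (slice_pt I z.1 z.2)].

(* Componentwise Lebesgue integral. *)
Definition qintegral (D : set plane) (F : plane -> quat R) : quat R :=
  \row_(i < 4) (\int[area]_(z in D) F z 0 i)%R.

Definition omega beta eta (t : R) : R :=
  t `^ (beta - 1) * (1 - t) `^ (eta - 1).

Definition slice_weight beta eta (z : plane) : R :=
  omega beta eta (z.1 ^+ 2 + z.2 ^+ 2).

Definition slice_L2 I beta eta f : Prop :=
  (forall i : 'I_4,
     measurable_fun (slice_ball I)
       (fun z : plane => f (slice_pt I z.1 z.2) 0 i : R)) /\
  (\int[area]_(z in slice_ball I)
     (qabs (f (slice_pt I z.1 z.2)) ^+ 2 * slice_weight beta eta z)%:E
   < +oo)%E.

Definition A2slice I beta eta : set (quat R -> quat R) :=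
  [set f | slice_regular f /\ slice_L2 I beta eta f].

(* Conjugate-linear in the first argument; the values do not commute. *)
Definition slice_inner I beta eta f g : quat R :=
  qintegral (slice_ball I) (fun z =>
    slice_weight beta eta z *:
      (qconj (f (slice_pt I z.1 z.2)) * g (slice_pt I z.1 z.2))).

Definition reproducing_kernel I beta eta (K : quat R -> quat R -> quat R) :=
  forall q, qball q ->
    A2slice I beta eta (K ^~ q) /\
    (forall f, A2slice I beta eta f ->
       f q = slice_inner I beta eta (K ^~ q) f).

End BergmanSpace.

Section Kernel.
Variable R : realType.
Implicit Types (p q : quat R) (a b c : R).

Definition Gamma (x : R) : R :=
  (\int[@lebesgue_measure R]_(t in `]0, +oo[) (t `^ (x - 1) * expR (- t)))%R.

Definition pochhammer a (k : nat) : R := \prod_(i < k) (a + i%:R).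

(* For p, q in the unit ball and c > 0 the series converges. *)
Definition hyp2F1_star a b c p q : quat R :=
  limn (series (fun k : nat =>
    (pochhammer a k * pochhammer b k / (pochhammer c k * k`!%:R))
      *: (p ^+ k * q ^+ k))).

Definition bergman_kernel (beta eta : R) p q : quat R :=
  (Gamma (beta + eta) / (pi * Gamma eta * Gamma beta))
    *: hyp2F1_star 1 (eta + beta) beta p (qconj q).

End Kernel.

(* Main.v *)
(* On the slice disc the monomials z^n are orthogonal for the radial weight:
   rotating the disc by pi / (2 (n - k)) multiplies conj(z^k) z^n by I, so its
   integral vanishes. In polar coordinates the integral of |z|^(2k) against the
   weight is pi times a Beta integral, i.e. pi gamma_k. A slice regular
   function satisfies the Cauchy formula on each slice (proved from
   differentiability alone, by Goursat's bisection in polar coordinates), hence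
   expands as a power series sum q^n c_n with coefficients on the right;
   integrating over smaller discs, where the series converges uniformly, and
   passing to the limit, pairing f with z^k gives pi gamma_k c_k. The
   coefficients of the kernel are exactly 1 / (pi gamma_k), and the kernel series
   converges uniformly in p, so pairing f with it gives sum q^k c_k = f(q).
   Uniqueness: two reproducing kernels reproduce each other, up to conjugation. *)
Require Import Defs.
From HB Require Import structures.
From mathcomp Require Import all_boot all_order all_algebra.
From mathcomp Require Import all_classical all_reals all_analysis.
From mathcomp Require Import measurable_realfun ring lra.

Set Implicit Arguments.
Unset Strict Implicit.
Unset Printing Implicit Defensive.

Import Order.TTheory GRing.Theory Num.Theory.
Import numFieldNormedType.Exports.

Local Open Scope classical_set_scope.
Local Open Scope ring_scope.

(** The integral lives on one slice, yet f must be reproduced at every q of the ball. The bridge is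
    that the coefficients c_n do not depend on the slice: all slices share the real axis, and the
    values of f near 0 on it determine the c_n. Differentiability gives no continuity of the partial
    derivatives, so Green's formula is out of reach. The polar coordinates used for Goursat are
    centred at the point w where f is evaluated and stretched to reach a circle centred at 0. In
    them the angular part of dz / (z - w) does not depend on the radius, so the circle shrinks to w
    with no singularity to control. The constant pi comes from the Gaussian integral: by scaling,
    the image of the area under |z|^2 is a multiple of Lebesgue measure on the half-line, and
    exp(-|z|^2) identifies the multiple. The relation between Beta and Gamma is proved in the
    extended reals by Tonelli, finiteness being settled afterwards. Integrals are coordinatewise,
    which costs a factor 2 in the triangle inequality; every estimate below tolerates it. *)

(** * Algebra of quaternions: modulus, conjugation, slices, inverse *)

Section QuaternionAlgebra.
Variable R : realType.
Implicit Types (p q h I J : quat R) (a : R).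

Lemma qmulE p q : p * q = qmul p q.
Proof. by []. Qed.

Lemma qmul_coord p q :
  ((p * q) 0 0 =
     p 0 0 * q 0 0 - p 0 1 * q 0 1 - p 0 2 * q 0 2 - p 0 3 * q 0 3) *
  ((p * q) 0 1 =
     p 0 0 * q 0 1 + p 0 1 * q 0 0 + p 0 2 * q 0 3 - p 0 3 * q 0 2) *
  ((p * q) 0 2 =
     p 0 0 * q 0 2 - p 0 1 * q 0 3 + p 0 2 * q 0 0 + p 0 3 * q 0 1) *
  ((p * q) 0 3 =
     p 0 0 * q 0 3 + p 0 1 * q 0 2 - p 0 2 * q 0 1 + p 0 3 * q 0 0).
Proof. by rewrite qmulE /qmul !mkquatE. Qed.

Lemma qone_coord :
  ((1 : quat R) 0 0 = 1) * ((1 : quat R) 0 1 = 0) *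
  ((1 : quat R) 0 2 = 0) * ((1 : quat R) 0 3 = 0).
Proof. by rewrite [1]/(qone R) /qone !mkquatE. Qed.

Lemma qadd_coord p q i : (p + q) 0 i = p 0 i + q 0 i.
Proof. by rewrite mxE. Qed.

Lemma qopp_coord p i : (- p) 0 i = - p 0 i.
Proof. by rewrite mxE. Qed.

Lemma qscale_coord a p i : (a *: p) 0 i = a * p 0 i.
Proof. by rewrite mxE. Qed.

Lemma qzero_coord i : (0 : quat R) 0 i = 0.
Proof. by rewrite mxE. Qed.

Definition qcoordE :=
  (qmul_coord, qone_coord, qadd_coord, qopp_coord, qscale_coord, qzero_coord).

Lemma qconj_coord q :
  (qconj q 0 0 = q 0 0) * (qconj q 0 1 = - q 0 1) *
  (qconj q 0 2 = - q 0 2) * (qconj q 0 3 = - q 0 3).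
Proof. by rewrite /qconj !mkquatE. Qed.

(** Produces the four cases as numerals, the form in which the coordinate rules are stated. *)
Lemma ord4P (P : 'I_4 -> Prop) : P 0 -> P 1 -> P 2 -> P 3 -> forall i, P i.
Proof.
move=> P0 P1 P2 P3 [[|[|[|[|//]]]]] Hi;
  [move: P0 | move: P1 | move: P2 | move: P3];
  by congr (P _); apply/val_inj.
Qed.

Lemma qabs_ge0 q : 0 <= qabs q.
Proof. exact: sqrtr_ge0. Qed.

Lemma sqr_qabs q :
  qabs q ^+ 2 = q 0 0 ^+ 2 + q 0 1 ^+ 2 + q 0 2 ^+ 2 + q 0 3 ^+ 2.
Proof.
rewrite /qabs sqr_sqrtr ?sumr_ge0// => [|i _]; last exact: sqr_ge0.
rewrite !big_ord_recr big_ord0 /= add0r.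
by congr (_ + _ + _ + _); congr (q 0 _ ^+ 2); apply/val_inj.
Qed.

Lemma qabs_le q a : 0 <= a ->
  (qabs q <= a) = (q 0 0 ^+ 2 + q 0 1 ^+ 2 + q 0 2 ^+ 2 + q 0 3 ^+ 2 <= a ^+ 2).
Proof. by move=> a0; rewrite -sqr_qabs ler_sqr ?nnegrE// qabs_ge0. Qed.

Lemma qabs_eq q a : 0 <= a -> qabs q ^+ 2 = a ^+ 2 -> qabs q = a.
Proof. by move=> a0 /eqP; rewrite eqrXn2// ?qabs_ge0// => /eqP. Qed.

(** After squaring, this is Euler's four-square identity. *)
Lemma qabsM p q : qabs (p * q) = qabs p * qabs q.
Proof.
apply: qabs_eq; first by rewrite mulr_ge0// qabs_ge0.
by rewrite exprMn !sqr_qabs !qcoordE; ring.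
Qed.

Lemma qabs1 : qabs (1 : quat R) = 1.
Proof. by apply: qabs_eq => //; rewrite sqr_qabs !qcoordE; ring. Qed.

Lemma qabsX q n : qabs (q ^+ n) = qabs q ^+ n.
Proof. by elim: n => [|n IH]; rewrite ?expr0 ?qabs1// !exprS qabsM IH. Qed.

Lemma qabsN q : qabs (- q) = qabs q.
Proof. by apply: qabs_eq; rewrite ?qabs_ge0// !sqr_qabs !qcoordE; ring. Qed.

Lemma qabsZ a q : qabs (a *: q) = `|a| * qabs q.
Proof.
apply: qabs_eq; first by rewrite mulr_ge0// qabs_ge0.
by rewrite exprMn real_normK ?num_real// !sqr_qabs !qcoordE; ring.
Qed.

Lemma qabs0 : qabs (0 : quat R) = 0.
Proof. by rewrite -(scale0r 0) qabsZ normr0 mul0r. Qed.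

Lemma qabs_conj q : qabs (qconj q) = qabs q.
Proof. by apply: qabs_eq; rewrite ?qabs_ge0// !sqr_qabs !qconj_coord; ring. Qed.

Lemma coord_le_qabs q i : `|q 0 i| <= qabs q.
Proof.
rewrite -(ler_sqr (x := `|_|)) ?nnegrE ?qabs_ge0// real_normK ?num_real// sqr_qabs.
have h (j : 'I_4) : 0 <= q 0 j ^+ 2 by exact: sqr_ge0.
by move: i; apply: ord4P; have := h 0; have := h 1; have := h 2; have := h 3; lra.
Qed.

(** Cauchy-Schwarz in dimension 4: the sum is the real coordinate of [p * qconj q], hence at most
    its modulus, which is multiplicative. *)
Lemma qabs_conjM p q : `|p 0 0 * q 0 0 + p 0 1 * q 0 1 + p 0 2 * q 0 2 +
  p 0 3 * q 0 3| <= qabs p * qabs q.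
Proof.
rewrite -(qabs_conj q) -qabsM.
apply: le_trans (coord_le_qabs _ 0); rewrite !qcoordE !qconj_coord.
by rewrite !mulrN !opprK.
Qed.

Lemma qabsD p q : qabs (p + q) <= qabs p + qabs q.
Proof.
rewrite qabs_le ?addr_ge0 ?qabs_ge0// sqrrD !sqr_qabs !qcoordE.
by have := qabs_conjM p q; have := ler_norm (p 0 0 * q 0 0 + p 0 1 * q 0 1 +
  p 0 2 * q 0 2 + p 0 3 * q 0 3); lra.
Qed.

Lemma qabsB p q : qabs (p - q) <= qabs p + qabs q.
Proof. by rewrite -(qabsN q) qabsD. Qed.

Lemma qabs_distC p q : qabs (p - q) = qabs (q - p).
Proof. by rewrite -qabsN opprB. Qed.

Lemma qabs_sum (n : nat) (F : nat -> quat R) :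
  qabs (\sum_(0 <= k < n) F k) <= \sum_(0 <= k < n) qabs (F k).
Proof.
elim: n => [|n IH]; first by rewrite !big_geq// qabs0.
by rewrite !big_nat_recr//=; apply: le_trans (qabsD _ _) _; rewrite lerD2r.
Qed.

Lemma qabs_eq0 q : qabs q = 0 -> q = 0.
Proof.
move=> q0; apply/rowP => i; rewrite mxE; apply/eqP.
by rewrite -normr_le0 -q0; exact: coord_le_qabs.
Qed.

Lemma norm_le_qabs q : `|q| <= qabs q.
Proof.
rewrite -[`|q|]/(mx_norm q) mx_normrE; apply: bigmax_le; first exact: qabs_ge0.
by move=> [i j] _ /=; rewrite (ord1 i); exact: coord_le_qabs.
Qed.

Lemma coord_le_norm q i : `|q 0 i| <= `|q|.
Proof.
rewrite -[`|q|]/(mx_norm q) mx_normrE.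
exact: (le_bigmax _ (fun ij : 'I_1 * 'I_4 => `|q ij.1 ij.2|) (0, i)).
Qed.

(** The 2 is the square root of the number of coordinates. *)
Lemma qabs_le_coord q a : 0 <= a -> (forall i, `|q 0 i| <= a) -> qabs q <= 2 * a.
Proof.
move=> a0 h; rewrite qabs_le ?mulr_ge0//.
have h2 i : q 0 i ^+ 2 <= a ^+ 2.
  by rewrite -(real_normK (num_real (q 0 i))) ler_sqr ?nnegrE.
by have := h2 0; have := h2 1; have := h2 2; have := h2 3; lra.
Qed.

Lemma qabs_le_norm q : qabs q <= 2 * `|q|.
Proof. by apply: qabs_le_coord => // i; exact: coord_le_norm. Qed.

Lemma qconjM p q : qconj (p * q) = qconj q * qconj p.
Proof. by apply: quatP; rewrite !(qcoordE, qconj_coord); split; ring. Qed.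

Lemma qconjD p q : qconj (p + q) = qconj p + qconj q.
Proof. by apply: quatP; rewrite !(qcoordE, qconj_coord); split; ring. Qed.

Lemma qconjZ a q : qconj (a *: q) = a *: qconj q.
Proof. by apply: quatP; rewrite !(qcoordE, qconj_coord); split; ring. Qed.

Lemma qconj0 : qconj (0 : quat R) = 0.
Proof. by rewrite -(scale0r 0) qconjZ !scale0r. Qed.

Lemma qconj1 : qconj (1 : quat R) = 1.
Proof. by apply: quatP; rewrite !(qcoordE, qconj_coord); split; ring. Qed.

Lemma qconjK q : qconj (qconj q) = q.
Proof. by apply: quatP; rewrite !(qcoordE, qconj_coord); split; ring. Qed.

Lemma qconjX q n : qconj (q ^+ n) = qconj q ^+ n.
Proof. by elim: n => [|n IH]; rewrite ?expr0 ?qconj1// exprS qconjM IH exprSr. Qed.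

Lemma qconj_sum (n : nat) (F : nat -> quat R) :
  qconj (\sum_(0 <= k < n) F k) = \sum_(0 <= k < n) qconj (F k).
Proof.
elim: n => [|n IH]; first by rewrite !big_geq// qconj0.
by rewrite !big_nat_recr//= qconjD IH.
Qed.

Lemma qconjMl q : qconj q * q = (qabs q ^+ 2)%:A.
Proof.
by apply: quatP; rewrite sqr_qabs !(qcoordE, qconj_coord); split; ring.
Qed.

Lemma qconjMr q : q * qconj q = (qabs q ^+ 2)%:A.
Proof.
by apply: quatP; rewrite sqr_qabs !(qcoordE, qconj_coord); split; ring.
Qed.

Lemma quat_mulf_eq0 p q : p * q = 0 -> p != 0 -> q = 0.
Proof.
move=> pq /eqP p0; apply: qabs_eq0.
have /eqP : qabs p * qabs q = 0 by rewrite -qabsM pq qabs0.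
by rewrite mulf_eq0 => /orP[/eqP/qabs_eq0//|/eqP].
Qed.

(** The imaginary coordinates of [I ^+ 2] are [2 * I 0 0 * I 0 j]. A nonzero real part would
    therefore make I real, with square -1. *)
Lemma qsphere_coord I : qsphere I ->
  I 0 0 = 0 /\ I 0 1 ^+ 2 + I 0 2 ^+ 2 + I 0 3 ^+ 2 = 1.
Proof.
rewrite /qsphere/= expr2 => e.
have /(_ 0) e0 := fun i => congr1 (fun q : quat R => q 0 i) e.
have /(_ 1) e1 := fun i => congr1 (fun q : quat R => q 0 i) e.
have /(_ 2) e2 := fun i => congr1 (fun q : quat R => q 0 i) e.
have /(_ 3) e3 := fun i => congr1 (fun q : quat R => q 0 i) e.
move: e0 e1 e2 e3; rewrite !qcoordE => e0 e1 e2 e3.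
have I0 : I 0 0 = 0.
  have [//|n0] := eqVneq (I 0 0) 0.
  have z x : I 0 0 * x = 0 -> x = 0.
    by move=> /eqP; rewrite mulf_eq0 (negbTE n0) => /eqP.
  have i1 : I 0 1 = 0 by apply: z; lra.
  have i2 : I 0 2 = 0 by apply: z; lra.
  have i3 : I 0 3 = 0 by apply: z; lra.
  by move: e0; rewrite i1 i2 i3; have := sqr_ge0 (I 0 0); rewrite expr2; lra.
by split => //; move: e0; rewrite I0 !expr2; lra.
Qed.

Lemma qconj_qsphere I : qsphere I -> qconj I = - I.
Proof.
move=> /qsphere_coord[I0 _]; apply: quatP.
by rewrite !(qcoordE, qconj_coord) I0 oppr0.
Qed.

Lemma sqr_qabs_slice I x y : qsphere I ->
  qabs (slice_pt I x y) ^+ 2 = x ^+ 2 + y ^+ 2.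
Proof.
move=> /qsphere_coord[I0 I1]; rewrite sqr_qabs /slice_pt !qcoordE I0.
transitivity (x ^+ 2 + y ^+ 2 * (I 0 1 ^+ 2 + I 0 2 ^+ 2 + I 0 3 ^+ 2)).
  by ring.
by rewrite I1 mulr1.
Qed.

(** An equality of propositions, so that it rewrites inside the description of a set. *)
Lemma qball_slice I x y : qsphere I ->
  qball (slice_pt I x y) = (x ^+ 2 + y ^+ 2 < 1) :> Prop.
Proof.
move=> hI; rewrite -(sqr_qabs_slice x y hI) /qball/= expr_lt1//.
exact: qabs_ge0.
Qed.

Lemma slice_ptM I x y x' y' : qsphere I ->
  slice_pt I x y * slice_pt I x' y' =
  slice_pt I (x * x' - y * y') (x * y' + y * x').
Proof.
move=> /qsphere_coord[I0 I1]; rewrite /slice_pt; apply: quatP.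
rewrite !qcoordE I0; split; try ring.
transitivity (x * x' - y * y' * (I 0 1 ^+ 2 + I 0 2 ^+ 2 + I 0 3 ^+ 2)).
  by ring.
by rewrite I1; ring.
Qed.

Lemma slice_ptC I x y x' y' : qsphere I ->
  slice_pt I x y * slice_pt I x' y' = slice_pt I x' y' * slice_pt I x y.
Proof.
by move=> hI; rewrite !slice_ptM//; congr (slice_pt I _ _); ring.
Qed.

Lemma qconj_slice I x y : qsphere I ->
  qconj (slice_pt I x y) = slice_pt I x (- y).
Proof.
move=> hI; rewrite /slice_pt qconjD !qconjZ qconj1 qconj_qsphere//.
by rewrite scalerN scaleNr.
Qed.

Lemma quat_slice q : exists I x y, qsphere I /\ q = slice_pt I x y.
Proof.
pose n : R := Num.sqrt (q 0 1 ^+ 2 + q 0 2 ^+ 2 + q 0 3 ^+ 2).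
have n2 : n ^+ 2 = q 0 1 ^+ 2 + q 0 2 ^+ 2 + q 0 3 ^+ 2.
  by rewrite sqr_sqrtr// !addr_ge0 ?sqr_ge0.
have sphere (b c d : R) : b ^+ 2 + c ^+ 2 + d ^+ 2 = 1 ->
    qsphere (mkquat 0 b c d).
  move=> e; apply: quatP; rewrite !(qcoordE, expr2) !mkquatE.
  by move: e; rewrite !expr2 => e; split; lra.
have [n0|n0] := eqVneq n 0.
  (* A real quaternion lies on every slice, so any imaginary unit serves. *)
  exists (mkquat 0 1 0 0), (q 0 0), 0; split.
    by apply: sphere; rewrite expr0n/= expr1n !addr0.
  have q0 (i : 'I_4) : q 0 i ^+ 2 <= 0 -> q 0 i = 0.
    by move=> h; apply/eqP; rewrite -sqrf_eq0 eq_le h sqr_ge0.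
  have h (i : 'I_4) : 0 <= q 0 i ^+ 2 by exact: sqr_ge0.
  move: n2; rewrite n0 expr0n/= => n2.
  have := h 1; have := h 2; have := h 3 => h3 h2 h1.
  rewrite /slice_pt scale0r addr0; apply: quatP; rewrite !qcoordE mulr1 mulr0.
  by split=> //; apply: q0; lra.
exists (n^-1 *: mkquat 0 (q 0 1) (q 0 2) (q 0 3)), (q 0 0), n; split.
  have -> : n^-1 *: mkquat 0 (q 0 1) (q 0 2) (q 0 3) =
      mkquat 0 (n^-1 * q 0 1) (n^-1 * q 0 2) (n^-1 * q 0 3).
    by apply: quatP; rewrite !qcoordE !mkquatE mulr0.
  apply: sphere; rewrite !exprMn -!mulrDr -n2 -exprMn mulVf// expr1n//.
apply: quatP; rewrite /slice_pt scalerA divff// scale1r !qcoordE !mkquatE.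
by rewrite !mulr0 mulr1 addr0 !add0r.
Qed.

Definition qinv q : quat R := (qabs q ^+ 2)^-1 *: qconj q.

Lemma qabs_neq0 q : q != 0 -> qabs q != 0.
Proof. by move=> q0; apply: contraNneq q0 => /qabs_eq0 ->. Qed.

Lemma qmulV q : q != 0 -> q * qinv q = 1.
Proof.
move=> /qabs_neq0 q0; rewrite -scalerAr qconjMr scalerA mulVf ?scale1r//.
by rewrite expf_neq0.
Qed.

Lemma qmulVl q : q != 0 -> qinv q * q = 1.
Proof.
move=> /qabs_neq0 q0; rewrite -scalerAl qconjMl scalerA mulVf ?scale1r//.
by rewrite expf_neq0.
Qed.

(** Also true at [q = 0], where both sides are 0 by the convention [0^-1 = 0]. *)
Lemma qabsV q : qabs (qinv q) = (qabs q)^-1.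
Proof.
rewrite /qinv qabsZ qabs_conj ger0_norm ?invr_ge0 ?sqr_ge0//.
have [->|q0] := eqVneq (qabs q) 0; first by rewrite mulr0 invr0.
by rewrite expr2 invfM -mulrA mulVf ?mulr1.
Qed.

End QuaternionAlgebra.

(** * Limits of quaternion-valued maps *)

Section QuaternionTopology.
Variable R : realType.
Implicit Types (p q : quat R).

Lemma quat_cvgP T (F : set_system T) {FF : Filter F} (f : T -> quat R) q :
  f x @[x --> F] --> q <-> forall i, f x 0 i @[x --> F] --> q 0 i.
Proof.
split=> [fq i|fq].
  apply/cvgrPdist_lt => e e0; move/cvgrPdist_lt : fq => /(_ _ e0).
  apply: filterS => x; apply: le_lt_trans.
  by rewrite -qopp_coord -qadd_coord coord_le_norm.
apply/cvgrPdist_lt => e e0.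
have /filter_forall : forall i, \near F, `|q 0 i - f F 0 i| < e.
  by move=> i; move/cvgrPdist_lt : (fq i); exact.
apply: filterS => x h; rewrite -[`|_|]/(mx_norm _) mx_normrE.
by apply: bigmax_lt => // -[i j] _ /=; rewrite (ord1 i) qadd_coord qopp_coord.
Qed.

Lemma quat_cvgM T (F : set_system T) {FF : Filter F} (f g : T -> quat R) p q :
  f x @[x --> F] --> p -> g x @[x --> F] --> q ->
  (f x * g x : quat R) @[x --> F] --> p * q.
Proof.
move=> /quat_cvgP fp /quat_cvgP gq; apply/quat_cvgP.
have h i j : f x 0 i * g x 0 j @[x --> F] --> p 0 i * q 0 j.
  exact: cvgM (fp i) (gq j).
apply: ord4P; rewrite qcoordE; under eq_fun do rewrite qcoordE.
- exact: cvgB (cvgB (cvgB (h 0 0) (h 1 1)) (h 2 2)) (h 3 3).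
- exact: cvgB (cvgD (cvgD (h 0 1) (h 1 0)) (h 2 3)) (h 3 2).
- exact: cvgD (cvgD (cvgB (h 0 2) (h 1 3)) (h 2 0)) (h 3 1).
- exact: cvgD (cvgB (cvgD (h 0 3) (h 1 2)) (h 2 1)) (h 3 0).
Qed.

Lemma quat_cvgB T (F : set_system T) {FF : Filter F} (f g : T -> quat R) p q :
  f x @[x --> F] --> p -> g x @[x --> F] --> q ->
  (f x - g x : quat R) @[x --> F] --> p - q.
Proof.
move=> /quat_cvgP fp /quat_cvgP gq; apply/quat_cvgP => i.
rewrite qadd_coord qopp_coord; under eq_fun do rewrite qadd_coord qopp_coord.
exact: cvgB (fp i) (gq i).
Qed.

Lemma quat_cvg_conj T (F : set_system T) {FF : Filter F} (f : T -> quat R) p :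
  f x @[x --> F] --> p -> qconj (f x) @[x --> F] --> qconj p.
Proof.
move=> /quat_cvgP fp; apply/quat_cvgP; apply: ord4P; rewrite qconj_coord;
  under eq_fun do rewrite qconj_coord; [exact: fp| | |]; exact: cvgN (fp _).
Qed.

Lemma quat_cvg_qabs T (F : set_system T) {FF : Filter F} (f : T -> quat R) q :
  f x @[x --> F] --> q <->
  forall e, 0 < e -> \forall x \near F, qabs (f x - q) < e.
Proof.
split=> [/cvgrPdist_lt fq e e0|fq]; last first.
  apply/cvgrPdist_lt => e e0; apply: filterS (fq _ e0) => x.
  by apply: le_lt_trans; rewrite distrC norm_le_qabs.
have e2 : 0 < e / 2 by rewrite divr_gt0.
apply: filterS (fq _ e2) => x h; apply: le_lt_trans (qabs_le_norm _) _.
by rewrite distrC -ltr_pdivlMl// mulrC.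
Qed.

Lemma quat_squeeze (u : nat -> quat R) q (v : nat -> R) :
  (forall n, qabs (u n - q) <= v n) -> v @ \oo --> 0 -> u @ \oo --> q.
Proof.
move=> uv /cvgr0Pnorm_lt v0; apply/quat_cvg_qabs => e e0.
apply: filterS (v0 _ e0) => n; apply: le_lt_trans.
by apply: le_trans (uv n) _; exact: ler_norm.
Qed.

Lemma qabs_cvg T (F : set_system T) {FF : Filter F} (f : T -> quat R) q :
  f x @[x --> F] --> q -> qabs (f x) @[x --> F] --> qabs q.
Proof.
move=> /quat_cvg_qabs fq; apply/cvgrPdist_lt => e /fq.
apply: filterS => x; apply: le_lt_trans.
rewrite distrC ler_norml lerBrDr -[X in X <= _]addrC -lerBrDr opprK.
have h1 := qabsD (f x - q) q; have h2 := qabsD (q - f x) (f x).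
rewrite !subrK in h1 h2; rewrite (qabs_distC q) in h2.
by rewrite addrC; apply/andP; split; lra.
Qed.

Lemma qabs_lim_le (u : nat -> quat R) q a :
  u @ \oo --> q -> (forall n, qabs (u n) <= a) -> qabs q <= a.
Proof.
by move=> uq ua; apply: (cvgr_to_le (qabs_cvg uq)); apply: nearW.
Qed.

End QuaternionTopology.

(** * The unit circle of a slice *)

Section Cis.
Variables (R : realType) (I : quat R).
Hypothesis hI : qsphere I.
Implicit Types t : R.

Definition cis t : quat R := slice_pt I (cos t) (sin t).

Lemma cisD s t : cis (s + t) = cis s * cis t.
Proof. by rewrite /cis slice_ptM// cosD sinD [sin s * cos t + _]addrC. Qed.

Lemma cis0 : cis 0 = 1.
Proof. by rewrite /cis cos0 sin0 /slice_pt scale0r addr0 scale1r. Qed.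

Lemma cisN t : cis (- t) = qconj (cis t).
Proof. by rewrite /cis cosN sinN qconj_slice. Qed.

Lemma cisMn n t : cis t ^+ n = cis (n%:R * t).
Proof.
elim: n => [|n IH]; first by rewrite mul0r cis0 expr0.
by rewrite exprS IH -cisD -[n.+1]add1n natrD mulrDl mul1r.
Qed.

Lemma qabs_cis t : qabs (cis t) = 1.
Proof.
by apply: qabs_eq => //; rewrite sqr_qabs_slice// cos2Dsin2 expr1n.
Qed.

Lemma cis_pihalf : cis (pi / 2) = I.
Proof. by rewrite /cis cos_pihalf sin_pihalf /slice_pt scale0r add0r scale1r. Qed.

Lemma cis_2pi : cis (2 * pi) = 1.
Proof.
by rewrite mulr_natl /cis cos2pi sin2pi /slice_pt scale0r addr0 scale1r.
Qed.

Lemma slice_pt_cvg T (F : set_system T) {FF : Filter F} (f g : T -> R) x y :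
  f z @[z --> F] --> x -> g z @[z --> F] --> y ->
  slice_pt I (f z) (g z) @[z --> F] --> slice_pt I x y.
Proof.
move=> fx gy; apply/quat_cvgP => i; rewrite /slice_pt qadd_coord !qscale_coord.
under eq_fun do rewrite qadd_coord !qscale_coord.
by apply: cvgD; apply: cvgM => //; exact: cvg_cst.
Qed.

Lemma continuous_cis : continuous cis.
Proof.
by move=> t; apply: slice_pt_cvg; [exact: continuous_cos|exact: continuous_sin].
Qed.

End Cis.

(** * Coordinatewise integration of quaternion-valued maps *)

Section QuaternionIntegral.
Context d (T : measurableType d) (R : realType).
Variable mu : {measure set T -> \bar R}.
Implicit Types (D : set T) (F G : T -> quat R) (g : T -> R).

(** The measure is a parameter because the Cauchy formula integrates over intervals and the Bergman
    pairing over the plane; at [area] this is [qintegral] by conversion. *)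
Definition qint D F : quat R := \row_i (\int[mu]_(x in D) F x 0 i)%R.

Definition qintegrable D F :=
  forall i, mu.-integrable D (fun x => (F x 0 i)%:E).

Lemma qint_coord D F i : qint D F 0 i = (\int[mu]_(x in D) F x 0 i)%R.
Proof. by rewrite mxE. Qed.

Lemma eq_qint D F G : (forall x, D x -> F x = G x) -> qint D F = qint D G.
Proof.
move=> FG; apply/rowP => i; rewrite !qint_coord.
by apply: eq_Rintegral => x /set_mem /FG ->.
Qed.

Lemma eq_qintegrable D F G : measurable D -> (forall x, D x -> F x = G x) ->
  qintegrable D F -> qintegrable D G.
Proof.
move=> mD FG iF i; apply: eq_integrable (iF i) => // x /set_mem /FG.
by move=> ->.
Qed.

Lemma qintegrableD D F G : measurable D -> qintegrable D F ->
  qintegrable D G -> qintegrable D (fun x => F x + G x).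
Proof.
move=> mD iF iG i.
by apply: eq_integrable (integrableD mD (iF i) (iG i)) => // x _ /=; rewrite mxE.
Qed.

Lemma qintD D F G : measurable D -> qintegrable D F -> qintegrable D G ->
  qint D (fun x => F x + G x) = qint D F + qint D G.
Proof.
move=> mD iF iG; apply/rowP => i; rewrite qadd_coord !qint_coord.
rewrite -(RintegralD mD (iF i) (iG i)).
by apply: eq_Rintegral => x _; rewrite qadd_coord.
Qed.

Section Linear.
Variable L : quat R -> quat R.
Hypotheses (LD : forall p q, L (p + q) = L p + L q)
  (LZ : forall a p, L (a *: p) = a *: L p).

Lemma quat_linear_coord p j : L p 0 j =
  p 0 0 * L (delta_mx 0 0) 0 j + p 0 1 * L (delta_mx 0 1) 0 j +
  p 0 2 * L (delta_mx 0 2) 0 j + p 0 3 * L (delta_mx 0 3) 0 j.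
Proof.
have {1}-> : p = p 0 0 *: (delta_mx 0 0 : quat R) +
    p 0 1 *: (delta_mx 0 1 : quat R) + p 0 2 *: (delta_mx 0 2 : quat R) +
    p 0 3 *: (delta_mx 0 3 : quat R).
  apply/rowP; apply: ord4P; rewrite !mxE/=;
  by rewrite !(mulr0, mulr1, addr0, add0r).
by rewrite !LD !LZ !qadd_coord !qscale_coord.
Qed.

(** Multiplication by a constant on either side, real scaling, negation and conjugation are all
    real-linear. Treating an arbitrary real-linear [L] through its matrix handles them together and
    keeps the two sides of a product apart. *)
Lemma qintegrable_linear D F : measurable D -> qintegrable D F ->
  qintegrable D (fun x => L (F x)).
Proof.
move=> mD iF j.
have h i := integrableZl mD (L (delta_mx 0 i) 0 j) (iF i).
apply: eq_integrable (integrableD mD (integrableD mD (integrableD mD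
  (h 0) (h 1)) (h 2)) (h 3)) => // x _ /=.
by rewrite (quat_linear_coord (F x)) -!EFinM -!EFinD; congr EFin; ring.
Qed.

Lemma qint_linear D F : measurable D -> qintegrable D F ->
  qint D (fun x => L (F x)) = L (qint D F).
Proof.
move=> mD iF; apply/rowP => j.
have h i : mu.-integrable D (EFin \o (fun x => F x 0 i * L (delta_mx 0 i) 0 j)).
  apply: eq_integrable (integrableZl mD (L (delta_mx 0 i) 0 j) (iF i)) => //.
  by move=> x _ /=; rewrite -EFinM mulrC.
have hD f g : mu.-integrable D (EFin \o f) -> mu.-integrable D (EFin \o g) ->
    mu.-integrable D (EFin \o (fun x => f x + g x)).
  by move=> fi gi; apply: eq_integrable (integrableD mD fi gi).
rewrite (quat_linear_coord (qint D F)) !qint_coord.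
rewrite -!(RintegralZr _ mD (iF _)) -(RintegralD mD (h 0) (h 1)).
rewrite -(RintegralD mD (hD _ _ (h 0) (h 1)) (h 2)).
rewrite -(RintegralD mD (hD _ _ (hD _ _ (h 0) (h 1)) (h 2)) (h 3)).
by apply: eq_Rintegral => x _; rewrite (quat_linear_coord (F x)).
Qed.

End Linear.

Lemma qintegrable_mull D F a : measurable D -> qintegrable D F ->
  qintegrable D (fun x => a * F x).
Proof.
apply: qintegrable_linear => [p q|c p]; first exact: mulrDr.
by rewrite scalerAr.
Qed.

Lemma qint_mull D F a : measurable D -> qintegrable D F ->
  qint D (fun x => a * F x) = a * qint D F.
Proof.
apply: (qint_linear (L := fun p => a * p)) => [p q|c p]; first exact: mulrDr.
by rewrite scalerAr.
Qed.

Lemma qintegrable_mulr D F a : measurable D -> qintegrable D F ->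
  qintegrable D (fun x => F x * a).
Proof.
apply: (qintegrable_linear (L := fun p => p * a)) => [p q|c p].
  exact: mulrDl.
by rewrite scalerAl.
Qed.

Lemma qint_mulr D F a : measurable D -> qintegrable D F ->
  qint D (fun x => F x * a) = qint D F * a.
Proof.
apply: (qint_linear (L := fun p => p * a)) => [p q|c p]; first exact: mulrDl.
by rewrite scalerAl.
Qed.

Lemma qintegrableZ D F (a : R) : measurable D -> qintegrable D F ->
  qintegrable D (fun x => a *: F x).
Proof.
apply: (qintegrable_linear (L := fun p => a *: p)) => [p q|c p].
  exact: scalerDr.
by rewrite !scalerA mulrC.
Qed.

Lemma qintZ D F (a : R) : measurable D -> qintegrable D F ->
  qint D (fun x => a *: F x) = a *: qint D F.
Proof.
apply: (qint_linear (L := fun p => a *: p)) => [p q|c p]; first exact: scalerDr.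
by rewrite !scalerA mulrC.
Qed.

Lemma qintegrableN D F : measurable D -> qintegrable D F ->
  qintegrable D (fun x => - F x).
Proof.
by apply: (qintegrable_linear (L := fun p => - p)) => [p q|c p];
  rewrite ?opprD ?scalerN.
Qed.

Lemma qintegrableB D F G : measurable D -> qintegrable D F ->
  qintegrable D G -> qintegrable D (fun x => F x - G x).
Proof. by move=> mD iF iG; apply: qintegrableD => //; exact: qintegrableN. Qed.

Lemma qintB D F G : measurable D -> qintegrable D F -> qintegrable D G ->
  qint D (fun x => F x - G x) = qint D F - qint D G.
Proof.
move=> mD iF iG; rewrite qintD//; last exact: qintegrableN.
congr (_ + _); apply: (qint_linear (L := fun p => - p)) => // [p q|c p].
  exact: opprD.
by rewrite scalerN.
Qed.

Lemma qint_conj D F : measurable D -> qintegrable D F ->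
  qint D (fun x => qconj (F x)) = qconj (qint D F).
Proof.
by apply: qint_linear => [p q|c p]; [exact: qconjD|exact: qconjZ].
Qed.

Lemma qintegrable_sum (n : nat) D (F : nat -> T -> quat R) : measurable D ->
  (forall k, qintegrable D (F k)) ->
  qintegrable D (fun x => \sum_(0 <= k < n) F k x).
Proof.
move=> mD iF; elim: n => [|n IH].
  apply: (@eq_qintegrable D (fun x => 0 *: F 0%N x)) => // [x _|].
    by rewrite big_geq// scale0r.
  exact: qintegrableZ.
apply: (@eq_qintegrable D (fun x => \sum_(0 <= k < n) F k x + F n x)) => //.
  by move=> x _; rewrite big_nat_recr.
exact: qintegrableD.
Qed.

Lemma qint_sum (n : nat) D (F : nat -> T -> quat R) : measurable D ->
  (forall k, qintegrable D (F k)) ->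
  qint D (fun x => \sum_(0 <= k < n) F k x) = \sum_(0 <= k < n) qint D (F k).
Proof.
move=> mD iF; elim: n => [|n IH].
  rewrite big_geq//; apply/rowP => i; rewrite qint_coord mxE.
  under eq_Rintegral do rewrite big_geq// mxE.
  by rewrite Rintegral_cst// mul0r.
rewrite big_nat_recr//= -IH -qintD//; last exact: qintegrable_sum.
by apply: eq_qint => x _; rewrite big_nat_recr.
Qed.

(** Each coordinate of the integral is at most the integral of [g]; the factor 2 is the passage from
    coordinates to the modulus. The uses below need the right order of magnitude only. *)
Lemma qabs_qint D F g : measurable D ->
  qintegrable D F -> mu.-integrable D (EFin \o g) ->
  (forall x, D x -> qabs (F x) <= g x) ->
  qabs (qint D F) <= 2 * \int[mu]_(x in D) g x.
Proof.
move=> mD iF ig Fg; apply: qabs_le_coord.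
  by apply: Rintegral_ge0 => x /Fg; apply: le_trans; exact: qabs_ge0.
move=> i; rewrite qint_coord.
apply: le_trans (le_normr_Rintegral _ _) _ => //; first exact: iF.
apply: le_Rintegral => //; first exact: integrable_norm (iF i).
by move=> x Dx; apply: le_trans (Fg x Dx); exact: coord_le_qabs.
Qed.

Lemma qintegrable_le D F g : measurable D ->
  (forall i, measurable_fun D (fun x => F x 0 i)) ->
  mu.-integrable D (EFin \o g) -> (forall x, D x -> qabs (F x) <= g x) ->
  qintegrable D F.
Proof.
move=> mD mF ig Fg i; apply: le_integrable ig => //.
  exact/measurable_EFinP.
move=> x Dx /=; rewrite lee_fin.
apply: le_trans (ler_norm _); apply: le_trans (Fg x Dx).
exact: coord_le_qabs.
Qed.

End QuaternionIntegral.

(** * Integrals over intervals and the integral of the circle map *)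

Section IntervalIntegral.
Variable R : realType.
Notation leb := (@lebesgue_measure R).
Implicit Types (F : R -> quat R) (a b c : R).

Lemma qintegrable_continuous F a b :
  (forall x, a <= x <= b -> F x @[x --> x] --> F x) ->
  qintegrable leb `[a, b] F.
Proof.
move=> cF i.
apply: (@continuous_compact_integrable R (fun x => F x 0 i)).
  exact: segment_compact.
apply: continuous_in_subspaceT => x /set_mem/=; rewrite in_itv/= => /cF.
by move/quat_cvgP; exact.
Qed.

Lemma qint_cat F a c b : a <= c -> c <= b -> qintegrable leb `[a, b] F ->
  qint leb `[a, b] F = qint leb `[a, c] F + qint leb `[c, b] F.
Proof.
move=> ac cb iF; apply/rowP => i; rewrite qadd_coord !qint_coord.
have := @Rintegral_itvB R (fun x => F x 0 i) (BLeft a) (BRight b) c (iF i).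
rewrite !bnd_simp => /(_ ac cb).
rewrite Rintegral_itv_obnd_cbnd; last first.
  apply: integrableS (iF i) => //; apply: subset_itvr.
  by rewrite bnd_simp.
by move/eqP; rewrite subr_eq addrC => /eqP.
Qed.

Lemma qabs_qint_itv F a b M : a <= b -> qintegrable leb `[a, b] F ->
  (forall x, a <= x <= b -> qabs (F x) <= M) ->
  qabs (qint leb `[a, b] F) <= 2 * M * (b - a).
Proof.
move=> ab iF FM.
have iM : leb.-integrable `[a, b] (EFin \o cst M).
  apply: continuous_compact_integrable; first exact: segment_compact.
  by apply: continuous_in_subspaceT => x _; exact: cvg_cst.
have le : qabs (qint leb `[a, b] F) <= 2 * \int[leb]_(x in `[a, b]) cst M x.
  by apply: qabs_qint => // x /=; rewrite in_itv/=; exact: FM.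
apply: (le_trans le); rewrite Rintegral_cst//= lebesgue_measure_itv/= lte_fin.
have [ab'|] := ltP a b; first by rewrite mulrA.
by move=> ba; rewrite (le_anti (introT andP (conj ab ba))) subrr/= !mulr0.
Qed.

Lemma qint_cst (q : quat R) a b : a <= b ->
  qint leb `[a, b] (cst q) = (b - a) *: q.
Proof.
move=> ab; apply/rowP => i; rewrite qint_coord /= qscale_coord.
rewrite Rintegral_cst//= lebesgue_measure_itv/= lte_fin mulrC.
have [//|ba] := ltP a b.
by rewrite (le_anti (introT andP (conj ab ba))) subrr.
Qed.

Lemma Rintegral_FTC (f G : R -> R) a b : a <= b -> continuous f ->
  (forall x : R, is_derive x (1 : R) G (f x)) -> \int[leb]_(x in `[a, b]) f x = G b - G a.
Proof.
rewrite le_eqVlt => /predU1P[->|ab] cf dG.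
  by rewrite set_itv1 Rintegral_set1 subrr.
have cG : continuous G.
  by move=> x; apply: differentiable_continuous; apply/derivable1_diffP.
rewrite /Rintegral (continuous_FTC2 (F := G))//.
- exact: continuous_subspaceT.
- split.
  + by move=> x _; exact: (@ex_derive _ _ _ _ _ _ _ (dG x)).
  + exact/cvg_at_right_filter/cG.
  + exact/cvg_at_left_filter/cG.
by move=> x _; rewrite derive1E; apply: derive_val.
Qed.

(** A primitive of [m *: cis I (m * t)] is [- I * cis I (m * t)]. The factor m stays on the left so
    that [m = 0] is no exception. *)
Lemma qint_cis (I : quat R) (m a b : R) : qsphere I -> a <= b ->
  m *: qint leb `[a, b] (fun t => cis I (m * t)) =
  - I * (cis I (m * b) - cis I (m * a)).
Proof.
move=> hI ab.
have mc : continuous (fun x : R => m * x).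
  by move=> x; apply: cvgM; [exact: cvg_cst|exact: cvg_id].
have iF : qintegrable leb `[a, b] (fun t => cis I (m * t)).
  apply: qintegrable_continuous => x _.
  by apply: (continuous_comp (mc x)); exact: continuous_cis.
rewrite -qintZ//.
have cosE : \int[leb]_(t in `[a, b]) (m * cos (m * t)) = sin (m * b) - sin (m * a).
  apply: (@Rintegral_FTC _ (fun t => sin (m * t))) => // x.
    by apply: cvgM; [exact: cvg_cst|apply: (continuous_comp (mc x));
      exact: continuous_cos].
  by apply: is_derive_eq; rewrite /GRing.scale/=; ring.
have sinE : \int[leb]_(t in `[a, b]) (m * sin (m * t)) = cos (m * a) - cos (m * b).
  have -> : cos (m * a) - cos (m * b) = - cos (m * b) - - cos (m * a) by ring.
  apply: (@Rintegral_FTC _ (fun t => - cos (m * t))) => // x.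
    by apply: cvgM; [exact: cvg_cst|apply: (continuous_comp (mc x));
      exact: continuous_sin].
  by apply: is_derive_eq; rewrite /GRing.scale/=; ring.
apply: (@etrans _ _ (slice_pt I (sin (m * b) - sin (m * a)) (cos (m * a) - cos (m * b)))).
  apply/rowP => i; rewrite qint_coord /slice_pt qadd_coord !qscale_coord.
  have ci (f : R -> R) : continuous f -> leb.-integrable `[a, b] (EFin \o f).
    move=> cf; apply: continuous_compact_integrable; first exact: segment_compact.
    by apply: continuous_in_subspaceT => x _; exact: cf.
  have cm (f : R -> R) : continuous f -> continuous (fun x => m * f (m * x)).
    move=> cf x; apply: cvgM; first exact: cvg_cst.
    by apply: (continuous_comp (mc x)); exact: cf.
  have ic := ci _ (cm _ (@continuous_cos R)).
  have js := ci _ (cm _ (@continuous_sin R)).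
  rewrite -cosE -sinE -(RintegralZr _ _ ic)// -(RintegralZr _ _ js)//.
  rewrite -RintegralD//.
  - by apply: eq_Rintegral => x _; rewrite qscale_coord /cis /slice_pt
      qadd_coord !qscale_coord; ring.
  - by apply: eq_integrable (integrableZr _ _ ic).
  - by apply: eq_integrable (integrableZr _ _ js).
rewrite /cis -[- I]add0r -{1}(scale0r (1 : quat R)) -(scaleN1r I).
rewrite -[_ + -1 *: I]/(slice_pt I 0 (-1)).
have -> : slice_pt I (cos (m * b)) (sin (m * b)) - slice_pt I (cos (m * a)) (sin (m * a)) =
  slice_pt I (cos (m * b) - cos (m * a)) (sin (m * b) - sin (m * a)).
  by apply/rowP => i; rewrite /slice_pt !(qadd_coord, qscale_coord, qopp_coord); ring.
by rewrite slice_ptM//; congr (slice_pt I _ _); ring.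
Qed.

End IntervalIntegral.

(** * Goursat's bisection for an abstract additive function of rectangles *)

Section Goursat.
Variables (R : realType) (Om : R -> R -> R -> R -> quat R) (A B C D : R).
Hypotheses (leAB : A <= B) (leCD : C <= D).
Hypothesis Om_split1 : forall a m b c d,
  A <= a -> a <= m -> m <= b -> b <= B -> C <= c -> c <= d -> d <= D ->
  Om a b c d = Om a m c d + Om m b c d.
Hypothesis Om_split2 : forall a b c m d,
  A <= a -> a <= b -> b <= B -> C <= c -> c <= m -> m <= d -> d <= D ->
  Om a b c d = Om a b c m + Om a b m d.
(** This is what differentiability at a single point yields: [del] depends on (x, y). Bisection
    replaces the missing uniformity by producing one point where everything concentrates. *)
Hypothesis Om_local : forall x y, A <= x <= B -> C <= y <= D ->
  forall e, 0 < e -> exists2 del, 0 < del & forall a b c d,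
    A <= a <= x -> x <= b <= B -> C <= c <= y -> y <= d <= D ->
    b - a < del -> d - c < del ->
    qabs (Om a b c d) <= e * ((b - a) + (d - c)) ^+ 2.

Let bad e (r : R * R * R * R) :=
  let: (a, b, c, d) := r in
  [/\ A <= a <= b, b <= B, C <= c <= d, d <= D &
      e * ((b - a) + (d - c)) ^+ 2 < qabs (Om a b c d)].

Let half (r s : R * R * R * R) :=
  let: (a, b, c, d) := r in let: (a', b', c', d') := s in
  [/\ a <= a', b' <= b, c <= c', d' <= d &
      b' - a' = (b - a) / 2 /\ d' - c' = (d - c) / 2].

(** Halving the sides divides the quadratic bound by 4. If the four quarters all met their bound,
    the sum of the four values would meet the bound of the whole rectangle. *)
Let bisect e r : bad e r -> exists2 s, bad e s & half r s.
Proof.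
case: r => [[[a b] c] d] /= [/andP[Aa ab] bB /andP[Cc cd] dD hbad].
apply/not_exists2P => hn.
pose m := (a + b) / 2; pose n := (c + d) / 2.
pose h := e * ((b - a) + (d - c)) ^+ 2 / 4.
have small a' b' c' d' : half (a, b, c, d) (a', b', c', d') ->
    qabs (Om a' b' c' d') <= h.
  move=> hh; have /= := hh => -[h1 h2 h3 h4 [h5 h6]].
  have [nb|/(_ hh)//] := hn (a', b', c', d'); rewrite leNgt; apply/negP => hlt.
  apply: nb; rewrite /bad; split; try (apply/andP; split); try lra.
  by apply: le_lt_trans hlt; rewrite h5 h6 /h -mulrDl exprMn; lra.
have s1 : qabs (Om a m c n) <= h by apply: small; rewrite /= /m /n; split; lra.
have s2 : qabs (Om m b c n) <= h by apply: small; rewrite /= /m /n; split; lra.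
have s3 : qabs (Om a m n d) <= h by apply: small; rewrite /= /m /n; split; lra.
have s4 : qabs (Om m b n d) <= h by apply: small; rewrite /= /m /n; split; lra.
move: hbad; apply/negP; rewrite -leNgt.
rewrite (@Om_split1 a m b c d)//; try by rewrite /m; lra.
rewrite (@Om_split2 a m c n d)//; try by rewrite /m /n; lra.
rewrite (@Om_split2 m b c n d)//; try by rewrite /m /n; lra.
have t1 := qabsD (Om a m c n + Om a m n d) (Om m b c n + Om m b n d).
have t2 := qabsD (Om a m c n) (Om a m n d).
have t3 := qabsD (Om m b c n) (Om m b n d).
by rewrite /h in s1 s2 s3 s4; lra.
Qed.

(* Bisection: a rectangle violating the quadratic bound has a quarter violating
   it, and the nested quarters shrink to a point where [Om_local] fails. *)
Lemma goursat_rectangle : Om A B C D = 0.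
Proof.
apply: qabs_eq0; apply/eqP; rewrite eq_le qabs_ge0 andbT leNgt; apply/negP => Om0.
have [e e0 bad0] : exists2 e, 0 < e & bad e (A, B, C, D).
  (* The [+ 1] keeps [L] positive for a degenerate rectangle and makes the violation of the bound
     strict. *)
  pose L := ((B - A) + (D - C)) ^+ 2 + 1.
  have L0 : 0 < L by rewrite ltr_wpDl// sqr_ge0.
  exists (qabs (Om A B C D) / L); first by rewrite divr_gt0.
  rewrite /bad !lexx leAB leCD; split => //.
  by rewrite mulrAC -mulrA gtr_pMr// ltr_pdivrMr// mul1r /L ltrDl.
have stepP (r : {r | bad e r}) : exists s : {r | bad e r}, half (sval r) (sval s).
  case: r => r br; have [s bs rs] := bisect br; by exists (exist _ s bs).
have [next nextP] := choice stepP.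
pose u n := iter n next (exist _ (A, B, C, D) bad0).
pose a n := (sval (u n)).1.1.1; pose b n := (sval (u n)).1.1.2.
pose c n := (sval (u n)).1.2; pose d n := (sval (u n)).2.
have uE n : sval (u n) = (a n, b n, c n, d n).
  by rewrite /a /b /c /d; case: (sval (u n)) => [[[]]].
have ubad n : bad e (a n, b n, c n, d n) by rewrite -uE; exact: proj2_sig.
have uhalf n : half (a n, b n, c n, d n) (a n.+1, b n.+1, c n.+1, d n.+1).
  by rewrite -!uE; exact: nextP.
have sz n : b n - a n = (B - A) / 2 ^+ n /\ d n - c n = (D - C) / 2 ^+ n.
  elim: n => [|n [IH1 IH2]]; first by rewrite expr0 !divr1.
  have [_ _ _ _ [-> ->]] := uhalf n; rewrite IH1 IH2 exprSr !invfM.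
  by rewrite !mulrA.
have mono m n : (m <= n)%N ->
    [/\ a m <= a n, b n <= b m, c m <= c n & d n <= d m].
  move=> mn; rewrite -(subnKC mn); elim: (n - m)%N => [|k [h1 h2 h3 h4]].
    by rewrite addn0 !lexx.
  rewrite addnS; have [k1 k2 k3 k4 _] := uhalf (m + k)%N.
  by split; [exact: le_trans k1|exact: le_trans h2|exact: le_trans k3
            |exact: le_trans h4].
have ab m n : a m <= b n.
  have [h1 h2 _ _] := mono _ _ (leq_maxl m n).
  have [h3 h4 _ _] := mono _ _ (leq_maxr m n).
  have [/andP[_ h5] _ _ _ _] := ubad (maxn m n).
  exact: le_trans h1 (le_trans h5 h4).
have cd m n : c m <= d n.
  have [_ _ h1 h2] := mono _ _ (leq_maxl m n).
  have [_ _ h3 h4] := mono _ _ (leq_maxr m n).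
  have [_ _ /andP[_ h5] _ _] := ubad (maxn m n).
  exact: le_trans h1 (le_trans h5 h4).
(* Every left end is below every right end, so the supremum of the left ends lies in all the nested
   intervals. *)
have [x xP] : exists x, forall n, a n <= x <= b n.
  exists (sup (range a)) => n; apply/andP; split.
    apply: ub_le_sup; last by exists n.
    by exists (b 0%N) => _ [k _ <-].
  by apply: ge_sup; [exists (a 0%N), 0%N|move=> _ [k _ <-]].
have [y yP] : exists y, forall n, c n <= y <= d n.
  exists (sup (range c)) => n; apply/andP; split.
    apply: ub_le_sup; last by exists n.
    by exists (d 0%N) => _ [k _ <-].
  by apply: ge_sup; [exists (c 0%N), 0%N|move=> _ [k _ <-]].
have [del del0 loc] := Om_local (xP 0%N) (yP 0%N) e0.
pose K := (B - A) + (D - C).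
have K0 : 0 <= K by rewrite addr_ge0// subr_ge0.
(* [n < 2 ^ n], so an Archimedean bound of [K / del] serves as the number of halvings. *)
have [n nP] : exists n, K / 2 ^+ n < del.
  exists (Num.Def.archi_bound (K / del)).
  have := archi_boundP (divr_ge0 K0 (ltW del0)).
  set N := Num.Def.archi_bound _ => h.
  rewrite ltr_pdivrMr ?exprn_gt0// mulrC -ltr_pdivrMr//; apply: (lt_trans h).
  by rewrite -natrX ltr_nat ltn_expl.
have [/andP[h1 h2] h3 /andP[h4 h5] h6 h7] := ubad n.
have [sz1 sz2] := sz n.
have /andP[x1 x2] := xP n; have /andP[y1 y2] := yP n.
move: h7; apply/negP; rewrite -leNgt; apply: loc; rewrite ?h1 ?h3 ?h4 ?h6 ?x1 ?x2 ?y1 ?y2//.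
- apply: le_lt_trans nP; rewrite sz1 ler_pM2r ?invr_gt0 ?exprn_gt0//.
  by rewrite /K lerDl subr_ge0.
- apply: le_lt_trans nP; rewrite sz2 ler_pM2r ?invr_gt0 ?exprn_gt0//.
  by rewrite /K lerDr subr_ge0.
Qed.

End Goursat.

(** * Commutation on a slice and first-order expansions *)

Section Slice.
Variables (R : realType) (I : quat R).
Hypothesis hI : qsphere I.
Implicit Types (p q w z : quat R).

Definition on_slice q := exists x y, q = slice_pt I x y.

Lemma on_sliceD p q : on_slice p -> on_slice q -> on_slice (p + q).
Proof.
move=> [x [y ->]] [x' [y' ->]]; exists (x + x'), (y + y').
by rewrite /slice_pt !scalerDl addrACA.
Qed.

Lemma on_sliceZ (a : R) q : on_slice q -> on_slice (a *: q).
Proof.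
move=> [x [y ->]]; exists (a * x), (a * y).
by rewrite /slice_pt scalerDr !scalerA.
Qed.

Lemma on_sliceB p q : on_slice p -> on_slice q -> on_slice (p - q).
Proof. by move=> sp sq; rewrite -scaleN1r; apply: on_sliceD => //; exact: on_sliceZ. Qed.

Lemma on_slice_conj q : on_slice q -> on_slice (qconj q).
Proof. by move=> [x [y ->]]; exists x, (- y); rewrite qconj_slice. Qed.

Lemma on_sliceC p q : on_slice p -> on_slice q -> p * q = q * p.
Proof. by move=> [x [y ->]] [x' [y' ->]]; exact: slice_ptC. Qed.

Lemma on_slice_cis t : on_slice (cis I t).
Proof. by exists (cos t), (sin t). Qed.

Lemma on_slice_real (x : R) : on_slice x%:A.
Proof. by exists x, 0; rewrite /slice_pt scale0r addr0. Qed.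

Lemma qabs_real (x : R) : qabs (x%:A : quat R) = `|x|.
Proof. by rewrite qabsZ qabs1 mulr1. Qed.

(** The increment is, up to the factor [- I], the integral of a map of modulus 1; the 2 is that of
    coordinatewise integration. *)
Lemma cis_lipschitz a b : a <= b -> qabs (cis I b - cis I a) <= 2 * (b - a).
Proof.
move=> ab; have := qint_cis 1 hI ab; rewrite scale1r !mul1r.
under eq_qint do rewrite mul1r.
move=> /(congr1 (@qabs R)); rewrite qabsM qabsN.
have -> : qabs I = 1 by rewrite -(cis_pihalf I) qabs_cis.
rewrite mul1r => <-; rewrite -[2 in leRHS]mulr1.
apply: qabs_qint_itv => // [|x _]; last by rewrite qabs_cis.
by apply: qintegrable_continuous => x _; exact: continuous_cis.
Qed.

Lemma slice_regular_continuous (f : quat R -> quat R) T (F : set_system T)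
    {FF : Filter F} (g : T -> quat R) q :
  slice_regular f -> qball q -> g x @[x --> F] --> q ->
  f (g x) @[x --> F] --> f q.
Proof.
move=> [df _] /df /differentiable_continuous cf gq.
exact: (cvg_comp _ _ gq cf).
Qed.

Lemma derive1_slice_re (f : quat R -> quat R) (x y : R) :
  differentiable f (slice_pt I x y) ->
  derive1 (fun s : R => f (slice_pt I s y)) x = 'd f (slice_pt I x y) 1.
Proof.
move=> df; rewrite -(deriveE _ df) /derive1 /derive.
apply: (congr1 (fun g : R -> quat R => lim (g @ 0^'))); apply/funext => h /=.
by rewrite {1 4}/slice_pt scalerDl -addrA.
Qed.

Lemma derive1_slice_im (f : quat R -> quat R) (x y : R) :
  differentiable f (slice_pt I x y) ->
  derive1 (fun s : R => f (slice_pt I x s)) y = 'd f (slice_pt I x y) I.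
Proof.
move=> df; rewrite -(deriveE _ df) /derive1 /derive.
apply: (congr1 (fun g : R -> quat R => lim (g @ 0^'))); apply/funext => h /=.
by rewrite {1 4}/slice_pt scalerDl addrCA.
Qed.

(* The Cauchy-Riemann equation makes the differential left [C_I]-linear on
   the slice, so a single coefficient on the right describes it. *)
Lemma slice_regular_expansion (f : quat R -> quat R) z :
  slice_regular f -> qball z -> on_slice z ->
  exists a, forall e, 0 < e -> exists2 del, 0 < del & forall h, on_slice h ->
    qabs h < del -> qabs (f (z + h) - (f z + h * a)) <= e * qabs h.
Proof.
move=> [df cr] bz [x0 [y0 zE]].
have dfz := df _ bz; exists ('d f z 1).
have dI : 'd f z I = I * 'd f z 1.
  rewrite zE in bz dfz *.
  have := cr _ hI _ _ bz; rewrite derive1_slice_re// derive1_slice_im//.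
  move=> /eqP; rewrite scaler_eq0 invr_eq0 pnatr_eq0/= => /eqP e.
  have d1 := e; move/eqP: d1; rewrite addr_eq0 => /eqP ->.
  by rewrite mulrN mulrA -expr2 (hI : I ^+ 2 = -1) mulN1r opprK.
move=> e e0.
(* Differentiability is expressed in the sup norm; half of e pays for the passage to the modulus. *)
have e2 : 0 < e / 2 by rewrite divr_gt0.
have [_ /eqaddoP /(_ _ e2)] := (diff_locallyP z f).1 dfz.
move=> /nbhs_ballP[del /= del0 hdel]; exists del => // h sh hlt.
have dh : 'd f z h = h * 'd f z 1.
  have [x [y ->]] := sh; rewrite /slice_pt linearD !linearZ dI.
  by rewrite mulrDl -!scalerAl mul1r.
have := hdel h; rewrite -ball_normE /ball_/= sub0r normrN.
move=> /(_ (le_lt_trans (norm_le_qabs _) hlt)); rewrite /shift/= !fctE -dh.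
rewrite [h + z]addrC => le1; apply: le_trans (qabs_le_norm _) _.
rewrite mulrC -ler_pdivlMr//; apply: (le_trans le1).
by rewrite mulrAC ler_pM2r ?invr_gt0// ler_pM2l// norm_le_qabs.
Qed.

End Slice.

Lemma qabs_small_eq0 (R : realType) (q : quat R) (C : R) : 0 <= C ->
  (forall e, 0 < e -> qabs q <= C * e) -> q = 0.
Proof.
move=> C0 h; apply: qabs_eq0; apply/eqP; rewrite eq_le qabs_ge0 andbT.
apply/ler_addgt0Pr => e e0; rewrite add0r.
have C1 : 0 < C + 1 by rewrite ltr_wpDl.
apply: le_trans (h (e / (C + 1)) _) _; first by rewrite divr_gt0.
by rewrite mulrCA ger_pMr// ler_pdivrMr// mul1r lerDl.
Qed.

(** * The Cauchy formula on a circle of a slice *)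

Section CauchyFormula.
Variables (R : realType) (I : quat R).
Hypothesis hI : qsphere I.
Variables (w : quat R) (rho : R).
Hypotheses (sw : on_slice I w) (w_rho : qabs w < rho) (rho1 : rho < 1).
Notation leb := (@lebesgue_measure R).
Implicit Types (f g : quat R -> quat R) (s t : R).

(** Polar coordinates centred at w: [pt s t] runs from w at [s = 0] to the circle of radius rho
    about the origin at [s = 1]. Along them dz / (z - w) equals [I * cker t] dt + [s^-1] ds, whose
    angular part is independent of s. *)
Let circ t : quat R := rho *: cis I t.
Let ray t : quat R := circ t - w.
Let cker t : quat R := circ t * qinv (ray t).
Let pt s t : quat R := w + s *: ray t.

Let rho0 : 0 < rho. Proof. exact: le_lt_trans (qabs_ge0 w) w_rho. Qed.

Let gap : 0 < rho - qabs w. Proof. by rewrite subr_gt0. Qed.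

Let qabs_circ t : qabs (circ t) = rho.
Proof. by rewrite qabsZ qabs_cis// mulr1 gtr0_norm. Qed.

Let ray_ge t : rho - qabs w <= qabs (ray t).
Proof.
rewrite lerBlDr -(qabs_circ t) -{1}(subrK w (circ t)); exact: qabsD.
Qed.

Let ray_le t : qabs (ray t) <= 2.
Proof. by apply: le_trans (qabsB _ _) _; rewrite qabs_circ; have := w_rho; have := rho1; lra. Qed.

Let ray_neq0 t : ray t != 0.
Proof.
apply: contraTneq (lt_le_trans gap (ray_ge t)) => ->.
by rewrite qabs0 ltxx.
Qed.

Let cker_ray t : cker t * ray t = circ t.
Proof. by rewrite /cker -mulrA qmulVl// mulr1. Qed.

Let qabs_cker t : qabs (cker t) <= (rho - qabs w)^-1.
Proof.
rewrite qabsM qabs_circ qabsV -[leRHS]mul1r ler_pM// ?invr_ge0 ?qabs_ge0//.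
- exact: ltW.
- exact: ltW.
- by rewrite lef_pV2 ?posrE ?ray_ge// (lt_le_trans gap (ray_ge t)).
Qed.

Let circ_cvg : continuous circ.
Proof. by move=> t; apply: cvgZ; [exact: cvg_cst|exact: continuous_cis]. Qed.

Let ray_cvg : continuous ray.
Proof. by move=> t; apply: cvgB; [exact: circ_cvg|exact: cvg_cst]. Qed.

Let cker_cvg : continuous cker.
Proof.
move=> t; apply: quat_cvgM; first exact: circ_cvg.
apply: cvgZ; last by apply: quat_cvg_conj; exact: ray_cvg.
apply: cvgV; first by rewrite expf_neq0// qabs_neq0.
by apply: cvgM; apply: qabs_cvg; exact: ray_cvg.
Qed.

Let on_ray t : on_slice I (ray t).
Proof. by apply: on_sliceB => //; apply: on_sliceZ; exact: on_slice_cis. Qed.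

Let pt_ball s t : 0 <= s <= 1 -> qball (pt s t).
Proof.
move=> /andP[s0 s1]; rewrite /qball/=.
have -> : pt s t = (1 - s) *: w + s *: circ t.
  by rewrite /pt /ray scalerBr scalerBl scale1r -addrA [- _ + _]addrC.
apply: le_lt_trans (qabsD _ _) _; rewrite (qabsZ _ w) (qabsZ s) qabs_circ.
rewrite ger0_norm ?subr_ge0// (ger0_norm s0).
have h : (1 - s) * qabs w <= (1 - s) * rho.
  by rewrite ler_wpM2l ?subr_ge0// ltW.
by apply: le_lt_trans rho1; lra.
Qed.

Let pt_slice s t : on_slice I (pt s t).
Proof. by apply: on_sliceD => //; exact: on_sliceZ. Qed.

(** The continuity that makes the sides integrable. It is kept apart from slice regularity so that
    it passes to affine maps and to remainders; arbitrary filters make it apply directly to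
    compositions. *)
Let ball_cvg f := forall T (F : set_system T) {FF : Filter F}
  (g : T -> quat R) q, qball q -> on_slice I q ->
  g x @[x --> F] --> q -> f (g x) @[x --> F] --> f q.

Let angular f s (c d : R) :=
  qint leb `[c, d] (fun t => cker t * f (pt s t)).
Let radial f t (a b : R) :=
  qint leb `[a, b] (fun s => s^-1 *: f (pt s t)).

Let ang_int f s c d : ball_cvg f -> 0 <= s <= 1 ->
  qintegrable leb `[c, d] (fun t => cker t * f (pt s t)).
Proof.
move=> cf s01; apply: qintegrable_continuous => t _.
apply: quat_cvgM; first exact: cker_cvg.
apply: cf => //; first exact: pt_ball.
apply: cvgD; first exact: cvg_cst.
by apply: cvgZ; [exact: cvg_cst|exact: ray_cvg].
Qed.

Let rad_int f t a b : ball_cvg f -> 0 < a -> b <= 1 ->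
  qintegrable leb `[a, b] (fun s => s^-1 *: f (pt s t)).
Proof.
move=> cf a0 b1; apply: qintegrable_continuous => s /andP[sa sb].
have s0 : 0 < s by exact: lt_le_trans sa.
apply: cvgZ; first by apply: cvgV; [rewrite gt_eqF|exact: cvg_id].
apply: cf => //; first by apply: pt_ball; rewrite ltW//= (le_trans sb).
apply: cvgD; first exact: cvg_cst.
by apply: cvgZ; [exact: cvg_id|exact: cvg_cst].
Qed.

(* The integral of [f(z) dz / (z - w)] over the boundary of a rectangle in the
   parameters (s, t) of [z = w + s * ray t]. *)
Let Om f (a b c d : R) : quat R :=
  (angular f b c d - angular f a c d) + I * (radial f d a b - radial f c a b).

Let OmD f g a b c d : ball_cvg f -> ball_cvg g ->
  0 < a -> a <= b -> b <= 1 -> c <= d ->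
  Om (fun z => f z + g z) a b c d = Om f a b c d + Om g a b c d.
Proof.
move=> cf cg a0 ab b1 cd.
have a01 : 0 <= a <= 1 by rewrite ltW//= (le_trans ab).
have b01 : 0 <= b <= 1 by rewrite b1 (le_trans _ ab)// ltW.
have angD s : 0 <= s <= 1 ->
    angular (fun z => f z + g z) s c d = angular f s c d + angular g s c d.
  move=> s01; rewrite /angular -qintD//; try exact: ang_int.
  by apply: eq_qint => t _; rewrite mulrDr.
have radD t : radial (fun z => f z + g z) t a b = radial f t a b + radial g t a b.
  rewrite /radial -qintD//; try exact: rad_int.
  by apply: eq_qint => s _; rewrite scalerDr.
rewrite /Om !angD// !radD.
have h (x y z u : quat R) : x + y - (z + u) = (x - z) + (y - u).
  by rewrite opprD addrACA.
by rewrite !h mulrDr addrACA.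
Qed.

(** The constant k cancels between opposite sides, since [cker] does not depend on s nor [s^-1] on
    t. For the linear term, [cker t * (pt s t - w)] is [s *: circ t], whose integral is [- I] times
    the increment of [circ]; the radial sides give the same increment times [I]. *)
Let Om_affine (k a0 : quat R) a b c d : 0 < a -> a <= b -> b <= 1 -> c <= d ->
  Om (fun z => k + (z - w) * a0) a b c d = 0.
Proof.
move=> a_0 ab b1 cd.
have ptw s t : pt s t - w = s *: ray t by rewrite /pt addrC addKr.
have caff : ball_cvg (fun z => k + (z - w) * a0).
  move=> T F FF g q _ _ gq; apply: cvgD; first exact: cvg_cst.
  apply: quat_cvgM; last exact: cvg_cst.
  by apply: cvgB => //; exact: cvg_cst.
have a01 : 0 <= a <= 1 by rewrite ltW//= (le_trans ab).
have b01 : 0 <= b <= 1 by rewrite b1 (le_trans _ ab)// ltW.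
have ic : qintegrable leb `[c, d] (cis I).
  by apply: qintegrable_continuous => t _; exact: continuous_cis.
have e1 : angular (fun z => k + (z - w) * a0) b c d -
    angular (fun z => k + (z - w) * a0) a c d =
    (b - a) *: (rho *: (- I * (cis I d - cis I c) * a0)).
  have ia := ang_int c d caff a01; have ib := ang_int c d caff b01.
  rewrite /angular -(qintB _ ib ia)//.
  have := qint_cis 1 hI cd; rewrite scale1r !mul1r => <-.
  have ic1 : qintegrable leb `[c, d] (fun t => cis I (1 * t)).
    by apply: eq_qintegrable ic => // t _; rewrite mul1r.
  have im : qintegrable leb `[c, d] (fun t => cis I (1 * t) * a0).
    exact: qintegrable_mulr.
  have imz : qintegrable leb `[c, d] (fun t => rho *: (cis I (1 * t) * a0)).
    exact: qintegrableZ.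
  rewrite -(qint_mulr a0 _ ic1)// -(qintZ rho _ im)// -(qintZ _ _ imz)//.
  apply: eq_qint => t _; rewrite !ptw -mulrBr opprD addrACA subrr add0r.
  rewrite -mulrBl -scalerBl mulrA -scalerAr cker_ray mul1r.
  by rewrite -!scalerAl.
have e2 : radial (fun z => k + (z - w) * a0) d a b -
    radial (fun z => k + (z - w) * a0) c a b =
    (b - a) *: (rho *: ((cis I d - cis I c) * a0)).
  have ic' t := rad_int t caff a_0 b1.
  rewrite /radial -(qintB _ (ic' d) (ic' c))//.
  rewrite -qint_cst//; apply: eq_qint => s /=; rewrite in_itv/= => /andP[sa _].
  rewrite !ptw -scalerBr opprD addrACA subrr add0r -mulrBl -scalerBr.
  rewrite -scalerAl scalerA mulVf ?gt_eqF ?(lt_le_trans a_0)// scale1r.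
  rewrite /ray opprB addrA subrK /circ -scalerBr -scalerAl//.
rewrite /Om e1 e2 -!scalerAr mulrA -!scalerDr mulNr mulNr addNr.
by rewrite !scaler0.
Qed.

(** Each side contributes at most twice its length times the supremum of its integrand, and opposite
    sides share their bound, whence 4. The radius is at least [e], which bounds [s^-1]; cross terms
    are added to reach the half-perimeter. *)
Let Om_bound f M a b c d : ball_cvg f -> 0 < a -> a <= b -> b <= 1 -> c <= d ->
  (forall s t, a <= s <= b -> c <= t <= d -> qabs (f (pt s t)) <= M) ->
  forall e, 0 < e <= a ->
  qabs (Om f a b c d) <=
    4 * ((rho - qabs w)^-1 + e^-1) * M * ((b - a) + (d - c)).
Proof.
move=> cf a0 ab b1 cd fM e /andP[e0 ea].
have a01 : 0 <= a <= 1 by rewrite ltW//= (le_trans ab).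
have b01 : 0 <= b <= 1 by rewrite b1 (le_trans _ ab)// ltW.
have M0 : 0 <= M by apply: le_trans (fM a c _ _); rewrite ?qabs_ge0 ?lexx.
set V := (rho - qabs w)^-1.
have V0 : 0 <= V by rewrite invr_ge0 ltW.
have angB s : a <= s <= b -> qabs (angular f s c d) <= 2 * (V * M) * (d - c).
  move=> /andP[sa sb].
  have s01 : 0 <= s <= 1 by rewrite (le_trans _ sa)/= ?(le_trans sb)// ltW.
  apply: qabs_qint_itv => // [|t tcd]; first exact: ang_int.
  by rewrite qabsM ler_pM ?qabs_ge0// ?qabs_cker// fM// sa sb.
have radB t : c <= t <= d -> qabs (radial f t a b) <= 2 * (e^-1 * M) * (b - a).
  move=> tcd; apply: qabs_qint_itv => // [|s /andP[sa sb]]; first exact: rad_int.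
  have s0 : 0 < s by exact: lt_le_trans sa.
  rewrite qabsZ ger0_norm ?invr_ge0 ?(ltW s0)//.
  rewrite ler_pM ?qabs_ge0 ?invr_ge0 ?(ltW s0)//.
    by rewrite lef_pV2 ?posrE// (le_trans ea).
  by rewrite fM// sa sb.
have I1 : qabs I = 1 by rewrite -(cis_pihalf I) qabs_cis.
have h1 := angB a; have h2 := angB b; have h3 := radB c; have h4 := radB d.
move: h1 h2 h3 h4; rewrite !lexx ab cd /= => /(_ isT) h1 /(_ isT) h2 /(_ isT) h3 /(_ isT) h4.
have k1 := qabsD (angular f b c d - angular f a c d)
  (I * (radial f d a b - radial f c a b)).
have k2 := qabsB (angular f b c d) (angular f a c d).
have k3 := qabsB (radial f d a b) (radial f c a b).
rewrite qabsM I1 mul1r in k1.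
rewrite -/(Om f a b c d) in k1.
have u1 : 0 <= V * M * (b - a) by rewrite !mulr_ge0 ?subr_ge0.
have u2 : 0 <= e^-1 * M * (d - c) by rewrite !mulr_ge0 ?invr_ge0 ?(ltW e0) ?subr_ge0.
apply: (le_trans k1).
apply: (le_trans (lerD (le_trans k2 (lerD h2 h1)) (le_trans k3 (lerD h4 h3)))).
rewrite -subr_ge0; set lhs := (X in _ - X); set rhs := (X in X - _).
have -> : rhs - lhs = 4 * (V * M * (b - a)) + 4 * (e^-1 * M * (d - c)).
  by rewrite /rhs /lhs; ring.
by rewrite addr_ge0// mulr_ge0.
Qed.

Variable f : quat R -> quat R.
Hypothesis hf : slice_regular f.

Let cf : ball_cvg f.
Proof. by move=> T F FF g q bq _; exact: slice_regular_continuous. Qed.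

Let pt_dist s t x y a b c d : 0 <= x <= 1 -> a <= x <= b -> a <= s <= b ->
  c <= y <= d -> c <= t <= d ->
  qabs (pt s t - pt x y) <= 2 * ((b - a) + (d - c)).
Proof.
move=> /andP[x0 x1] /andP[ax xb] /andP[sa sb] /andP[cy yd] /andP[ct td].
have -> : pt s t - pt x y = (s - x) *: ray t + x *: (rho *: (cis I t - cis I y)).
  have <- : ray t - ray y = rho *: (cis I t - cis I y).
    by rewrite /ray opprB addrA subrK -scalerBr.
  by rewrite /pt opprD addrACA subrr add0r scalerBl [x *: (_ - ray y)]scalerBr addrA subrK.
have h1 : qabs ((s - x) *: ray t) <= 2 * (b - a).
  rewrite qabsZ mulrC ler_pM ?qabs_ge0//.
  by rewrite ler_norml; apply/andP; split; lra.
have h2 : qabs (x *: (rho *: (cis I t - cis I y))) <= 2 * (d - c).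
  have h3 : qabs (cis I t - cis I y) <= 2 * (d - c).
    have [ty|yt] := leP t y.
      by rewrite qabs_distC; apply: le_trans (cis_lipschitz hI ty) _; lra.
    by apply: le_trans (cis_lipschitz hI (ltW yt)) _; lra.
  rewrite !qabsZ (ger0_norm x0) gtr0_norm//.
  apply: le_trans h3; apply: (@le_trans _ _ (1 * (1 * qabs (cis I t - cis I y)))).
    by rewrite ler_pM ?mulr_ge0 ?qabs_ge0 ?(ltW rho0)// ler_pM ?qabs_ge0 ?(ltW rho0)// ltW.
  by rewrite !mul1r.
by rewrite mulrDr; apply: le_trans (qabsD _ _) _; rewrite lerD.
Qed.

Let Om_f_eq0 e : 0 < e -> e <= 1 -> Om f e 1 0 (2 * pi) = 0.
Proof.
move=> e0 e1; apply: goursat_rectangle => //.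
- by rewrite mulr_ge0 ?pi_ge0.
- move=> a m b c d ea am mb b1 _ cd _; have a0 := lt_le_trans e0 ea.
  have radS t : radial f t a b = radial f t a m + radial f t m b.
    by apply: qint_cat => //; exact: rad_int.
  have h (p q u v : quat R) : p + q - (u + v) = (p - u) + (q - v).
    by rewrite opprD addrACA.
  rewrite /Om !radS h mulrDr [RHS]addrACA; congr (_ + _).
  by rewrite [RHS]addrC addrA subrK.
- move=> a b c m d ea ab b1 _ cm md _; have a0 := lt_le_trans e0 ea.
  have angS s : a <= s <= b -> angular f s c d = angular f s c m + angular f s m d.
    move=> /andP[sa sb]; apply: qint_cat => //; apply: ang_int => //.
    by rewrite (le_trans sb)// (le_trans (ltW a0)).
  rewrite /Om !angS ?lexx ?ab//.
  have h (p q u v : quat R) : p + q - (u + v) = (p - u) + (q - v).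
    by rewrite opprD addrACA.
  rewrite h [RHS]addrACA -mulrDr; congr (_ + I * _).
  by rewrite [RHS]addrC addrA subrK.
move=> x y /andP[ex x1] ycd e' e'0.
have x01 : 0 <= x <= 1 by rewrite x1 (le_trans _ ex)// ltW.
have [a0 exp] := slice_regular_expansion hI hf (pt_ball y x01) (pt_slice x y).
set V := (rho - qabs w)^-1.
have V0 : 0 <= V by rewrite invr_ge0 ltW.
(* On a rectangle of half-perimeter [L] the remainder is at most [e' / K * (2 * L)]; times the
   [4 * (V + e^-1) * L] of [Om_bound] this is [(K - 1) / K] times [e' * L ^+ 2]. *)
pose K := 8 * (V + e^-1) + 1.
have K0 : 0 < K by rewrite ltr_wpDl// mulr_ge0// addr_ge0// invr_ge0 ltW.
have [del del0 hdel] := exp (e' / K) (divr_gt0 e'0 K0).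
(* The points of such a rectangle are within twice its half-perimeter of [pt x y], hence within
   [del]. *)
exists (del / 4); first by rewrite divr_gt0.
move=> a b c d /andP[ea ax] /andP[xb b1] /andP[_ cy] /andP[yd _] ba dc.
have a_0 := lt_le_trans e0 ea.
have ab := le_trans ax xb; have cd := le_trans cy yd.
pose z0 := pt x y.
(* The tangent map of f at [z0], rewritten with base point w: the form that [Om_affine]
   annihilates. *)
pose aff z := f z0 + (w - z0) * a0 + (z - w) * a0.
pose r z := f z - aff z.
have affE z : aff z = f z0 + (z - z0) * a0.
  by rewrite /aff -addrA -mulrDl [w - z0 + _]addrC addrA subrK.
have caff : ball_cvg aff.
  move=> T F FF g q _ _ gq; apply: cvgD; first exact: cvg_cst.
  apply: quat_cvgM; last exact: cvg_cst.
  by apply: cvgB => //; exact: cvg_cst.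
have cr : ball_cvg r.
  by move=> T F FF g q bq sq gq; apply: cvgB; [exact: cf|exact: caff].
have -> : f = (fun z => aff z + r z).
  by apply/funext => z; rewrite /r addrC subrK.
rewrite OmD// Om_affine// add0r.
pose L := (b - a) + (d - c).
have L0 : 0 <= L by rewrite addr_ge0// subr_ge0.
have rM s t : a <= s <= b -> c <= t <= d -> qabs (r (pt s t)) <= e' / K * (2 * L).
  move=> sab tcd.
  have hd : qabs (pt s t - z0) <= 2 * L.
    by apply: (@pt_dist s t x y a b c d) => //; rewrite ?ax ?xb ?cy ?yd.
  have sl : on_slice I (pt s t - z0).
    exact: on_sliceB (pt_slice s t) (pt_slice x y).
  have := hdel _ sl; rewrite -/z0 [z0 + _]addrC subrK -affE => /(_ _)/le_trans; apply.
    by apply: (le_lt_trans hd); rewrite /L; lra.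
  by rewrite ler_pM2l// divr_gt0.
apply: (le_trans (Om_bound cr a_0 ab b1 cd rM (e := e) _)); first by rewrite e0.
rewrite -/V -/L.
have -> : 4 * (V + e^-1) * (e' / K * (2 * L)) * L = e' * L ^+ 2 * ((K - 1) / K).
  have SE : V + e^-1 = (K - 1) / 8 by rewrite /K; lra.
  rewrite SE; have := K0; move: (K) => k k0; field; exact: lt0r_neq0.
rewrite ler_piMr ?mulr_ge0 ?sqr_ge0 ?(ltW e'0)//.
by rewrite ler_pdivrMr// mul1r gerBl.
Qed.

(** Subtracting [f w] postpones the evaluation of the integral of the kernel. On the rectangle
    [s, 1] x [0, 2 pi] the radial sides coincide by periodicity, so the angular integral does not
    depend on s; for small s continuity of f at w makes it small. *)
Lemma cauchy_circle :
  qint leb `[0, 2 * pi] (fun t => rho *: cis I t *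
    qinv (rho *: cis I t - w) * (f (rho *: cis I t) - f w)) = 0.
Proof.
have V0 : 0 <= (rho - qabs w)^-1 by rewrite invr_ge0 ltW.
have pi20 : 0 <= 2 * pi :> R by rewrite mulr_ge0 ?pi_ge0.
have w_ball : qball w by exact: lt_trans w_rho rho1.
apply: (@qabs_small_eq0 _ _ (2 * (rho - qabs w)^-1 * (2 * pi))) => [|e e0].
  by rewrite !mulr_ge0 ?pi_ge0.
have /quat_cvg_qabs/(_ _ e0)/nbhs_ballP[del /= del0 hdel] : f z @[z --> w] --> f w.
  exact: (differentiable_continuous (hf.1 _ w_ball)).
(* As [ray t] has modulus at most 2, the points [pt s t] are then within [del] of w. *)
pose s : R := Num.min 1 (del / 4).
have s0 : 0 < s by rewrite lt_min ltr01 divr_gt0.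
have s1 : s <= 1 by rewrite ge_min lexx.
have sdel : s <= del / 4 by rewrite ge_min lexx orbT.
have s01 : 0 <= s <= 1 by rewrite s1 ltW.
have ang1 : angular f 1 0 (2 * pi) = angular f s 0 (2 * pi).
  have := Om_f_eq0 s0 s1; rewrite /Om.
  have -> : radial f (2 * pi) s 1 = radial f 0 s 1.
    by apply: eq_qint => u _; rewrite /pt /ray /circ cis_2pi cis0.
  by rewrite (subrr (radial f 0 s 1)) mulr0 addr0 => /subr0_eq.
have icst : qintegrable leb `[0, 2 * pi] (fun t => cker t * f w).
  by apply: qintegrable_continuous => t _; apply: quat_cvgM;
    [exact: cker_cvg|exact: cvg_cst].
have l01 : 0 <= (1 : R) <= 1 by rewrite ler01 lexx.
have is1 := @ang_int f 1 0 (2 * pi) (@cf) l01.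
have isB := @ang_int f s 0 (2 * pi) (@cf) s01.
have mI : measurable (`[0, 2 * pi]%classic : set (measurableTypeR R)).
  exact: measurable_itv.
have E1 : qint leb `[0, 2 * pi] (fun t => cker t * f (pt 1 t) - cker t * f w) =
    angular f 1 0 (2 * pi) - qint leb `[0, 2 * pi] (fun t => cker t * f w).
  exact: qintB mI is1 icst.
have E2 : qint leb `[0, 2 * pi] (fun t => cker t * f (pt s t) - cker t * f w) =
    angular f s 0 (2 * pi) - qint leb `[0, 2 * pi] (fun t => cker t * f w).
  exact: qintB mI isB icst.
have iB : qintegrable leb `[0, 2 * pi]
    (fun t => cker t * f (pt s t) - cker t * f w).
  exact: qintegrableB mI isB icst.
have pt1 t : pt 1 t = circ t by rewrite /pt scale1r addrC subrK.
have -> : qint leb `[0, 2 * pi] (fun t => rho *: cis I t *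
      qinv (rho *: cis I t - w) * (f (rho *: cis I t) - f w)) =
    qint leb `[0, 2 * pi] (fun t => cker t * f (pt s t) - cker t * f w).
  rewrite E2 -ang1 -E1; apply: eq_qint => t _; rewrite pt1.
  exact: (mulrBr (cker t)).
have -> : 2 * (rho - qabs w)^-1 * (2 * pi) * e =
  2 * ((rho - qabs w)^-1 * e) * (2 * pi - 0) by rewrite subr0; ring.
apply: (@qabs_qint_itv R _ 0 (2 * pi) ((rho - qabs w)^-1 * e) pi20 iB) => t _.
rewrite -(mulrBr (cker t)) (qabsM (cker t)) ler_pM ?qabs_ge0//.
apply/ltW/hdel; rewrite -ball_normE /ball_/= /pt opprD addrA subrr sub0r normrN.
apply: le_lt_trans (norm_le_qabs _) _; rewrite (qabsZ s (ray t)) gtr0_norm//.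
apply: (@le_lt_trans _ _ (del / 4 * 2)); last by lra.
by rewrite ler_pM ?qabs_ge0 ?(ltW s0).
Qed.

End CauchyFormula.

(** * Power series expansion on a slice *)

Section PowerSeries.
Variables (R : realType).
Notation leb := (@lebesgue_measure R).

(** The finite geometric expansion with remainder, valid in a noncommutative ring since no inverse
    of [1 - k] is formed. *)
Lemma geometric_unroll (A : nzRingType) (k v : A) (N : nat) :
  v = 1 + k * v -> v = \sum_(0 <= n < N) k ^+ n + k ^+ N * v.
Proof.
move=> e; elim: N => [|N IH]; first by rewrite big_geq// add0r expr0 mul1r.
by rewrite big_nat_recr//= [LHS]IH {1}e mulrDr mulr1 addrA mulrA -exprSr.
Qed.

Lemma cvg_geometric0 (C q : R) : 0 <= q < 1 ->
  (fun n => C * q ^+ n) @ \oo --> (0 : R).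
Proof.
by move=> /andP[q0 q1]; apply: (@cvg_geometric _ C q); rewrite ger0_norm.
Qed.

Variables (I : quat R) (rho : R) (f : quat R -> quat R).
Hypotheses (hI : qsphere I) (rho0 : 0 < rho) (rho1 : rho < 1).
Hypothesis hf : slice_regular f.

Let circ (t : R) : quat R := rho *: cis I t.
Let icirc (t : R) : quat R := rho^-1 *: cis I (- t).

(** Cauchy's coefficient: the mean of z^(-n) f(z) over the circle. The power stands left of f, so
    that the coefficient comes out on the right of q^n. *)
Definition slice_coef (n : nat) : quat R :=
  (2 * pi)^-1 *: qint leb `[0, 2 * pi]
    (fun t => (rho^-1 *: cis I (- t)) ^+ n * f (rho *: cis I t)).

Let pi20 : 0 < 2 * pi :> R. Proof. by rewrite mulr_gt0 ?pi_gt0. Qed.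

Let circ_cvg : continuous circ.
Proof. by move=> t; apply: cvgZ; [exact: cvg_cst|exact: continuous_cis]. Qed.

Let icirc_cvg : continuous icirc.
Proof.
move=> t; apply: cvgZ; first exact: cvg_cst.
have oc : (fun x : R => - x) @ t --> - t by apply: cvgN; exact: cvg_id.
by apply: (continuous_comp oc); exact: continuous_cis.
Qed.

Let icircX_cvg n : continuous (fun t => icirc t ^+ n).
Proof.
elim: n => [|n IH]; first by move=> t; exact: cvg_cst.
rewrite (_ : (fun t => icirc t ^+ n.+1) = fun t => icirc t * icirc t ^+ n).
  by move=> t; apply: quat_cvgM; [exact: icirc_cvg|exact: IH].
by apply/funext => t; rewrite exprS.
Qed.

Let icirc_circ t : icirc t * circ t = 1.
Proof.
rewrite /icirc /circ -scalerAl -scalerAr scalerA mulVf ?gt_eqF// scale1r.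
by rewrite -cisD// addNr cis0.
Qed.

Let qabs_icirc t : qabs (icirc t) = rho^-1.
Proof. by rewrite qabsZ qabs_cis// mulr1 ger0_norm// invr_ge0 ltW. Qed.

Let qabs_circ t : qabs (circ t) = rho.
Proof. by rewrite qabsZ qabs_cis// mulr1 gtr0_norm. Qed.

Let int_icircX n : qint leb `[0, 2 * pi] (fun t => icirc t ^+ n) =
  if n is 0 then (2 * pi)%:A else 0.
Proof.
case: n => [|n].
  by rewrite [LHS](@qint_cst R 1 0 (2 * pi)) ?subr0// ltW.
have n0 : - n.+1%:R != 0 :> R by rewrite oppr_eq0 pnatr_eq0.
have icis : qintegrable leb `[0, 2 * pi] (fun t => cis I (- n.+1%:R * t)).
  apply: qintegrable_continuous => x _.
  have mc : (fun x : R => - n.+1%:R * x) @ x --> - n.+1%:R * x.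
    by apply: cvgM; [exact: cvg_cst|exact: cvg_id].
  by apply: (continuous_comp mc); exact: continuous_cis.
transitivity (rho^-1 ^+ n.+1 *: qint leb `[0, 2 * pi]
    (fun t => cis I (- n.+1%:R * t))).
  rewrite -(qintZ _ _ icis)//; apply: eq_qint => t _.
  by rewrite /icirc exprZn cisMn// mulNr mulrN.
have := @qint_cis _ I (- n.+1%:R) 0 (2 * pi) hI (ltW pi20).
have -> : cis I (- n.+1%:R * (2 * pi)) = 1.
  by rewrite mulNr -mulrN -cisMn// cisN// cis_2pi qconj1 expr1n.
rewrite mulr0 cis0 subrr mulr0 => /eqP; rewrite scaler_eq0 (negbTE n0)/=.
by move=> /eqP ->; rewrite scaler0.
Qed.

Section Point.
Variable w : quat R.
Hypotheses (sw : on_slice I w) (w_rho : qabs w < rho).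

Let ray t : quat R := circ t - w.
Let cker t : quat R := circ t * qinv (ray t).
Let V := (rho - qabs w)^-1.

Let ray_ge t : rho - qabs w <= qabs (ray t).
Proof.
rewrite lerBlDr -(qabs_circ t) -{1}(subrK w (circ t)); exact: qabsD.
Qed.

Let ray_neq0 t : ray t != 0.
Proof.
have gap : 0 < rho - qabs w by rewrite subr_gt0.
apply: contraTneq (lt_le_trans gap (ray_ge t)) => ->.
by rewrite qabs0 ltxx.
Qed.

Let cker_cvg : continuous cker.
Proof.
move=> t; have rc : ray x @[x --> t] --> ray t.
  by apply: cvgB; [exact: circ_cvg|exact: cvg_cst].
apply: quat_cvgM; first exact: circ_cvg.
apply: cvgZ; last exact: quat_cvg_conj.
apply: cvgV; first by rewrite expf_neq0// qabs_neq0.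
by apply: cvgM; exact: qabs_cvg.
Qed.

Let qabs_cker t : qabs (cker t) <= V.
Proof.
have gap : 0 < rho - qabs w by rewrite subr_gt0.
rewrite qabsM qabs_circ qabsV -[leRHS]mul1r ler_pM// ?invr_ge0 ?qabs_ge0//.
- exact: ltW.
- exact: ltW.
- by rewrite lef_pV2 ?posrE ?ray_ge// (lt_le_trans gap (ray_ge t)).
Qed.

Let cker_fix t : cker t = 1 + w * icirc t * cker t.
Proof.
apply/eqP; rewrite -subr_eq0; apply/eqP.
set X := (X in X = 0).
have Xray : X * ray t = 0.
  rewrite /X mulrBl mulrDl mul1r -!mulrA [qinv _ * _]qmulVl// mulr1.
  by rewrite icirc_circ mulr1 /ray subrK subrr.
by rewrite -[X]mulr1 -(qmulV (ray_neq0 t)) mulrA Xray mul0r.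
Qed.

Let cker_expand t N : cker t =
  \sum_(0 <= n < N) w ^+ n * icirc t ^+ n + w ^+ N * (icirc t ^+ N * cker t).
Proof.
have ic : on_slice I (icirc t) by apply: on_sliceZ; exact: on_slice_cis.
rewrite {1}(geometric_unroll N (cker_fix t)).
have e n : (w * icirc t) ^+ n = w ^+ n * icirc t ^+ n.
  by rewrite exprMn_comm//; apply: on_sliceC ic.
by rewrite e mulrA; congr (_ + _); apply: eq_bigr => n _; rewrite e.
Qed.

(** Used with two choices of [G]: the constant [f w], which evaluates the integral of the kernel,
    and f on the circle, which produces the coefficients. *)
Let int_expand (G : R -> quat R) (M : R) (N : nat) : continuous G ->
  (forall t, 0 <= t <= 2 * pi -> qabs (G t) <= M) ->
  qabs (qint leb `[0, 2 * pi] (fun t => cker t * G t) -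
    \sum_(0 <= n < N) w ^+ n *
      qint leb `[0, 2 * pi] (fun t => icirc t ^+ n * G t)) <=
  2 * (V * M) * (2 * pi) * (qabs w / rho) ^+ N.
Proof.
move=> cG GM.
have iG n : qintegrable leb `[0, 2 * pi] (fun t => icirc t ^+ n * G t).
  apply: qintegrable_continuous => t _.
  by apply: quat_cvgM; [exact: icircX_cvg|exact: cG].
have iwG n : qintegrable leb `[0, 2 * pi] (fun t => w ^+ n * (icirc t ^+ n * G t)).
  exact: qintegrable_mull.
have ik : qintegrable leb `[0, 2 * pi] (fun t => cker t * G t).
  apply: qintegrable_continuous => t _.
  by apply: quat_cvgM; [exact: cker_cvg|exact: cG].
under eq_bigr do rewrite -(qint_mull _ _ (iG _))//.
rewrite -(@qint_sum _ _ _ leb N _ (fun n t => w ^+ n * (icirc t ^+ n * G t)))//.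
have isum : qintegrable leb `[0, 2 * pi]
    (fun t => \sum_(0 <= n < N) w ^+ n * (icirc t ^+ n * G t)).
  exact: qintegrable_sum.
rewrite -(qintB _ ik isum)//.
have -> : 2 * (V * M) * (2 * pi) * (qabs w / rho) ^+ N =
  2 * ((qabs w / rho) ^+ N * (V * M)) * (2 * pi - 0) by rewrite subr0; ring.
apply: qabs_qint_itv; [exact: ltW|exact: qintegrableB|].
move=> t t02; rewrite {1}(cker_expand t N) mulrDl mulr_suml.
under eq_bigr do rewrite -mulrA.
rewrite [X in X - _]addrC addrK -mulrA -mulrA.
rewrite (qabsM (w ^+ N)) (qabsM (icirc t ^+ N)) (qabsM (cker t)) !qabsX.
rewrite qabs_icirc expr_div_n exprVn mulrA ler_wpM2l//.
  by rewrite divr_ge0// exprn_ge0 ?qabs_ge0// ltW.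
by rewrite ler_pM ?qabs_ge0// GM.
Qed.

Lemma slice_series_cvg : series (fun n => w ^+ n * slice_coef n) @ \oo --> f w.
Proof.
have q01 : 0 <= qabs w / rho < 1.
  by rewrite divr_ge0 ?qabs_ge0 ?(ltW rho0)//= ltr_pdivrMr// mul1r.
have circ_ball t : qball (circ t) by rewrite /qball/= qabs_circ.
have cfc : continuous (fun t => f (circ t)).
  move=> t; apply: (slice_regular_continuous (g := circ)) => //; exact: circ_cvg.
have [M MP] : exists M, forall t, 0 <= t <= 2 * pi -> qabs (f (circ t)) <= M.
  have [] := @EVT_max R (fun t => qabs (f (circ t))) 0 (2 * pi) (ltW pi20).
    apply: continuous_in_subspaceT => t _; exact: qabs_cvg (cfc t).
  by move=> c _ h; exists (qabs (f (circ c))) => t tt; apply: h; rewrite in_itv.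
(* For a constant, only the term n = 0 of the expansion survives integration, and the error tends to
   0 with N; this replaces a residue computation. *)
have e1 : qint leb `[0, 2 * pi] (fun t => cker t * f w) = (2 * pi) *: f w.
  apply/eqP; rewrite -subr_eq0; apply/eqP/qabs_eq0/eqP.
  rewrite eq_le qabs_ge0 andbT.
  have lim0 := @cvg_geometric0 (2 * (V * qabs (f w)) * (2 * pi)) _ q01.
  apply: (cvgr_to_ge lim0); near=> N.
  have N0 : (0 < N)%N by near: N; exact: nbhs_infty_gt.
  have sumE : \sum_(0 <= n < N) w ^+ n *
      qint leb `[0, 2 * pi] (fun t => icirc t ^+ n * f w) = (2 * pi) *: f w.
    have tE n : qint leb `[0, 2 * pi] (fun t => icirc t ^+ n * f w) =
        (if n is 0 then (2 * pi)%:A else 0) * f w.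
      rewrite qint_mulr// ?int_icircX//.
      by apply: qintegrable_continuous => t _; exact: icircX_cvg.
    under eq_bigr do rewrite tE.
    rewrite -(prednK N0) big_nat_recl// big1 ?addr0.
      by rewrite expr0 mul1r -scalerAl mul1r.
    by move=> n _; rewrite mul0r mulr0.
  have := int_expand (G := fun=> f w) (M := qabs (f w)) N.
  by rewrite sumE; apply => // t; exact: cvg_cst.
have icst : qintegrable leb `[0, 2 * pi] (fun t => cker t * f w).
  by apply: qintegrable_continuous => t _; apply: quat_cvgM;
    [exact: cker_cvg|exact: cvg_cst].
have ifc : qintegrable leb `[0, 2 * pi] (fun t => cker t * f (circ t)).
  by apply: qintegrable_continuous => t _; apply: quat_cvgM;
    [exact: cker_cvg|exact: cfc].
have e2 : qint leb `[0, 2 * pi] (fun t => cker t * f (circ t)) = (2 * pi) *: f w.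
  rewrite -e1; apply/eqP; rewrite -subr_eq0 -(qintB _ ifc icst)//; apply/eqP.
  rewrite -[RHS](cauchy_circle hI sw w_rho rho1 hf).
  by apply: eq_qint => t _; rewrite -mulrBr.
pose C := (2 * pi)^-1 * (2 * (V * M) * (2 * pi)).
apply: (quat_squeeze (v := fun n => C * (qabs w / rho) ^+ n)); last first.
  exact: cvg_geometric0.
move=> N; have := int_expand N cfc MP; rewrite e2 => le.
have -> : series (fun n => w ^+ n * slice_coef n) N - f w = - (2 * pi)^-1 *:
    ((2 * pi) *: f w - \sum_(0 <= n < N) w ^+ n *
      qint leb `[0, 2 * pi] (fun t => icirc t ^+ n * f (circ t))).
  rewrite scalerBr scalerA mulNr mulVf ?gt_eqF// scaleNr scale1r scaleNr opprK.
  rewrite addrC; congr (_ + _); rewrite /series/= scaler_sumr.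
  by apply: eq_bigr => n _; rewrite scalerAr.
rewrite qabsZ normrN gtr0_norm ?invr_gt0// /C -mulrA ler_pM2l ?invr_gt0//.
Unshelve. all: by end_near.
Qed.

End Point.

(** Cauchy's estimate. The constant is not tracked: a bound is enough for geometric convergence on
    smaller radii. *)
Lemma slice_coef_bound : exists M, forall n, qabs (slice_coef n) * rho ^+ n <= M.
Proof.
have circ_ball t : qball (circ t) by rewrite /qball/= qabs_circ.
have cfc : continuous (fun t => f (circ t)).
  move=> t; apply: (slice_regular_continuous (g := circ)) => //; exact: circ_cvg.
have [M MP] : exists M, forall t, 0 <= t <= 2 * pi -> qabs (f (circ t)) <= M.
  have [] := @EVT_max R (fun t => qabs (f (circ t))) 0 (2 * pi) (ltW pi20).
    apply: continuous_in_subspaceT => t _; exact: qabs_cvg (cfc t).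
  by move=> c _ h; exists (qabs (f (circ c))) => t tt; apply: h; rewrite in_itv.
exists ((2 * pi)^-1 * (2 * M * (2 * pi))) => n.
have rn : 0 < rho ^+ n by rewrite exprn_gt0.
rewrite -ler_pdivlMr// qabsZ ger0_norm ?invr_ge0 ?(ltW pi20)// -[leRHS]mulrA.
rewrite ler_pM2l ?invr_gt0//.
have -> : 2 * M * (2 * pi) / rho ^+ n = 2 * ((rho ^+ n)^-1 * M) * (2 * pi - 0).
  by rewrite subr0; ring.
apply: qabs_qint_itv; first exact: ltW.
  by apply: qintegrable_continuous => t _; apply: quat_cvgM;
    [exact: icircX_cvg|exact: cfc].
move=> t t02; rewrite -/(icirc t) -/(circ t) qabsM qabsX qabs_icirc exprVn.
by rewrite ler_wpM2l ?invr_ge0 ?(ltW rn)// MP.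
Qed.

End PowerSeries.

(** * Independence of the coefficients from slice and radius *)

Section SeriesUniqueness.
Variable R : realType.

Lemma geometric_tail_le (q : R) (m N : nat) : 0 <= q <= 2^-1 ->
  \sum_(m <= k < N) q ^+ k <= 2 * q ^+ m.
Proof.
move=> /andP[q0 q2]; have [mN|Nm] := leqP m N; last first.
  by rewrite big_geq ?(ltnW Nm)// mulr_ge0// exprn_ge0.
rewrite -(subnKC mN); set j := (N - m)%N.
suff : \sum_(m <= k < m + j) q ^+ k <= 2 * (q ^+ m - q ^+ (m + j)).
  move=> /le_trans; apply; rewrite ler_pM2l// gerBl exprn_ge0//.
elim: j => [|j IH]; first by rewrite addn0 big_geq// subrr mulr0.
rewrite addnS big_nat_recr ?leq_addr//= exprS.
have h : q * q ^+ (m + j) <= 2^-1 * q ^+ (m + j).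
  by rewrite ler_wpM2r// exprn_ge0.
by apply: le_trans (lerD IH (lexx _)) _; lra.
Qed.

(** Once the earlier coefficients vanish, [x ^+ n *: b n] equals minus the tail, which is of order
    [x ^+ n.+1]; dividing by [x ^+ n] and letting x tend to 0 gives [b n = 0]. *)
Lemma power_series_coef0 (b : nat -> quat R) (rho M : R) : 0 < rho ->
  (forall n, qabs (b n) * rho ^+ n <= M) ->
  (forall x, 0 < x < rho -> series (fun n => x ^+ n *: b n) @ \oo --> 0) ->
  forall n, b n = 0.
Proof.
move=> rho0 bM b0; elim/ltn_ind => n IH.
have M0 : 0 <= M by apply: le_trans (bM 0%N); rewrite mulr_ge0 ?qabs_ge0.
have rn m : 0 < rho ^+ m by rewrite exprn_gt0.
apply: (@qabs_small_eq0 _ _ (2 * M / rho ^+ n.+1)) => [|e e0].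
  by rewrite divr_ge0 ?mulr_ge0// ltW.
(* [x <= rho / 2] makes the ratio at most 1/2, so the geometric tail is at most twice its first
   term. *)
pose x : R := Num.min e (rho / 2).
have x0 : 0 < x by rewrite lt_min e0 divr_gt0.
have xe : x <= e by rewrite ge_min lexx.
have xr : x <= rho / 2 by rewrite ge_min lexx orbT.
have xn m : 0 < x ^+ m by rewrite exprn_gt0.
have q2 : 0 <= x / rho <= 2^-1.
  rewrite divr_ge0 ?(ltW x0) ?(ltW rho0)//= ler_pdivrMr// mulrC//.
have tail N : (n < N)%N ->
    qabs (x ^+ n *: b n - series (fun n => x ^+ n *: b n) N) <=
    2 * M * (x / rho) ^+ n.+1.
  move=> nN; rewrite /series/= (big_cat_nat (n := n)) ?(ltnW nN)//= big_nat big1 ?add0r.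
    rewrite big_ltn// opprD addrA subrr add0r qabsN.
    apply: (@le_trans _ _ (\sum_(n.+1 <= k < N) M * (x / rho) ^+ k)).
      elim: N {nN} => [|N IHN]; first by rewrite !big_geq// qabs0.
      have [nN|Nn] := leqP n.+1 N; last by rewrite !big_geq// qabs0.
      rewrite !big_nat_recr//=; apply: le_trans (qabsD _ _) _; rewrite lerD//.
      rewrite qabsZ ger0_norm ?(ltW (xn _))// expr_div_n mulrA mulrC.
      by rewrite ler_pdivlMr// mulrAC ler_wpM2r ?(ltW (xn _)).
    rewrite -mulr_sumr [2 * M]mulrC -[leRHS]mulrA ler_wpM2l//.
    exact: geometric_tail_le.
  by move=> k /andP[_ kn]; rewrite IH// scaler0.
have lim : qabs (x ^+ n *: b n - 0) <= 2 * M * (x / rho) ^+ n.+1.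
  have xr2 : 0 < x < rho by rewrite x0/=; lra.
  have cv : (x ^+ n *: b n - series (fun n => x ^+ n *: b n) N) @[N --> \oo]
      --> x ^+ n *: b n - 0.
    by apply: cvgB; [exact: cvg_cst|exact: b0].
  apply: (cvgr_to_le (qabs_cvg cv)).
  by near=> N; apply: tail; near: N; exact: nbhs_infty_gt.
move: lim; rewrite subr0 qabsZ ger0_norm ?(ltW (xn _))// => lim.
apply: (@le_trans _ _ (2 * M / rho ^+ n.+1 * x)); last first.
  by rewrite ler_wpM2l// divr_ge0 ?mulr_ge0// ltW.
rewrite -(ler_pM2l (xn n)); apply: (le_trans lim).
by rewrite expr_div_n [x ^+ n.+1]exprS le_eqVlt; apply/orP; left; apply/eqP; ring.
Unshelve. all: by end_near.
Qed.

Variable f : quat R -> quat R.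
Hypothesis hf : slice_regular f.

(** Small real points belong to both slices and both discs. The two expansions converge there to the
    same value of f, so their difference is a vanishing power series in a real variable. *)
Lemma slice_coef_unique (I J : quat R) (r s : R) : qsphere I -> qsphere J ->
  0 < r < 1 -> 0 < s < 1 -> slice_coef I r f =1 slice_coef J s f.
Proof.
move=> hI hJ /andP[r0 r1] /andP[s0 s1].
have [M MP] := slice_coef_bound hI r0 r1 hf.
have [N NP] := slice_coef_bound hJ s0 s1 hf.
have h n : slice_coef I r f n - slice_coef J s f n = 0.
  move: n; pose m : R := Num.min r s.
  have m0 : 0 < m by rewrite lt_min r0.
  have mr : m <= r by rewrite ge_min lexx.
  have ms : m <= s by rewrite ge_min lexx orbT.
  apply: (@power_series_coef0 _ m (M + N)) => // [n|x /andP[x0 xm]].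
    apply: (@le_trans _ _ ((qabs (slice_coef I r f n) +
      qabs (slice_coef J s f n)) * m ^+ n)).
      by rewrite ler_wpM2r ?qabsB// exprn_ge0// ltW.
    rewrite mulrDl; apply: lerD.
      apply: le_trans (MP n); rewrite ler_wpM2l ?qabs_ge0//.
      by rewrite lerXn2r ?nnegrE ?(ltW m0) ?(ltW r0).
    apply: le_trans (NP n); rewrite ler_wpM2l ?qabs_ge0//.
    by rewrite lerXn2r ?nnegrE ?(ltW m0) ?(ltW s0).
  have ax : qabs (x%:A : quat R) = x by rewrite qabs_real gtr0_norm.
  have ar : qabs (x%:A : quat R) < r by rewrite ax (lt_le_trans xm).
  have as_ : qabs (x%:A : quat R) < s by rewrite ax (lt_le_trans xm).
  have cr := slice_series_cvg hI r0 r1 hf (on_slice_real I x) ar.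
  have cs := slice_series_cvg hJ s0 s1 hf (on_slice_real J x) as_.
  have := quat_cvgB cr cs; rewrite subrr => cv.
  suff -> : series (fun n => x ^+ n *: (slice_coef I r f n - slice_coef J s f n)) =
    fun n => series (fun n => x%:A ^+ n * slice_coef I r f n) n -
      series (fun n => x%:A ^+ n * slice_coef J s f n) n.
    exact: cv.
  apply/funext => n; rewrite /series/= -sumrB; apply: eq_bigr => k _.
  by rewrite -mulrBr exprZn expr1n -scalerAl mul1r.
by move=> n; apply/eqP; rewrite -subr_eq0 h.
Qed.

Lemma slice_regular_series : exists c : nat -> quat R,
  (forall r, 0 < r < 1 -> exists M, forall n, qabs (c n) * r ^+ n <= M) /\
  (forall q, qball q -> series (fun n => q ^+ n * c n) @ \oo --> f q).
Proof.
(* Decomposing 0 is merely a way to obtain an imaginary unit; the radius 1/2 below is just as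
   arbitrary. *)
have [I [_ [_ [hI _]]]] := quat_slice (0 : quat R).
have h01 : 0 < (2^-1 : R) < 1 by lra.
exists (slice_coef I 2^-1 f); split=> [r r01|q qb].
  have /andP[r0 r1] := r01.
  have [M MP] := slice_coef_bound hI r0 r1 hf.
  by exists M => n; rewrite (slice_coef_unique hI hI h01 r01).
have [J [x [y [hJ qE]]]] := quat_slice q.
(* Midway between the modulus of q and 1, so that q is inside the circle and the circle inside the
   ball. *)
pose r := (1 + qabs q) / 2.
have q0 := qabs_ge0 q; have q1 : qabs q < 1 := qb.
have r01 : 0 < r < 1 by rewrite /r; lra.
have qr : qabs q < r by rewrite /r; lra.
have /andP[r0 r1] := r01.
have -> : (fun n => q ^+ n * slice_coef I 2^-1 f n) =
    (fun n => q ^+ n * slice_coef J r f n).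
  by apply/funext => n; rewrite (slice_coef_unique hI hJ h01 r01).
by apply: slice_series_cvg => //; exists x, y.
Qed.

End SeriesUniqueness.

(** * Slice regularity of power series with summable coefficients *)

Section SeriesRegular.
Variable R : realType.
Implicit Types (p h q : quat R).

Lemma quat_series_cvg (u : nat -> quat R) (A : R) :
  (forall N, \sum_(0 <= k < N) qabs (u k) <= A) -> cvgn (series u).
Proof.
move=> uA.
have cu i : cvgn (series (fun k => u k 0 i)).
  apply: normed_cvg; apply: nondecreasing_is_cvgn.
    by apply/nondecreasing_seqP => n; rewrite /= /series/= big_nat_recr//= lerDl.
  exists A => _ [N _ <-]; apply: le_trans (uA N); apply: ler_sum => k _.
  exact: coord_le_qabs.
apply/cvg_ex; exists (\row_i limn (series (fun k => u k 0 i))).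
apply/quat_cvgP => i; rewrite mxE.
rewrite (_ : (fun n => series u n 0 i) = series (fun k => u k 0 i)).
  exact: cu.
by apply/funext => N; rewrite /series/= summxE.
Qed.

(** The differential of the k-th power at p, i.e. the sum of p^i h p^(k-1-i). It does not collapse
    to k h p^(k-1) unless h commutes with p, and slice regularity asks for differentiability in all
    four directions. *)
Fixpoint dpow p (k : nat) h : quat R :=
  if k is k'.+1 then dpow p k' h * p + p ^+ k' * h else 0.

Lemma dpowD p k h h' : dpow p k (h + h') = dpow p k h + dpow p k h'.
Proof.
by elim: k => [|k IH] /=; rewrite ?addr0// IH mulrDl mulrDr addrACA.
Qed.

Lemma dpowZ p k (a : R) h : dpow p k (a *: h) = a *: dpow p k h.
Proof.
by elim: k => [|k IH] /=; rewrite ?scaler0// IH -scalerAl -scalerAr scalerDr.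
Qed.

Lemma dpow_comm p k h : h * p = p * h -> dpow p k h = h * dpow p k 1.
Proof.
move=> hp; elim: k => [|k IH] /=; first by rewrite mulr0.
rewrite IH mulr1 mulrDr mulrA; congr (_ + _).
exact/esym/(commrX k (hp : GRing.comm h p)).
Qed.

Section PowerEstimates.
Variables (p : quat R) (del : R).
Hypotheses (del0 : 0 < del) (pdel : qabs p + del = 1).

Let p1 : qabs p <= 1.
Proof. by rewrite -pdel lerDl ltW. Qed.

Let pn k : qabs p ^+ k <= 1.
Proof. by rewrite exprn_ile1// qabs_ge0. Qed.

(** Since [qabs p + del = 1], multiplying the bound by [qabs p] and adding the contribution of h
    gives the bound back. The inductions on k below therefore close with constants independent of
    k. *)
Let split_h h (x : R) :
  x * (qabs h / del) * qabs p + x * qabs h = x * (qabs h / del).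
Proof.
have -> : x * qabs h = x * (qabs h / del) * del.
  by rewrite -!mulrA mulVf ?mulr1// gt_eqF.
by rewrite -mulrDr pdel mulr1.
Qed.

Lemma qabs_dpow k h : qabs (dpow p k h) <= qabs h / del.
Proof.
elim: k => [|k IH] /=; first by rewrite qabs0 divr_ge0 ?qabs_ge0// ltW.
apply: le_trans (qabsD _ _) _; rewrite -[leRHS]mul1r -split_h !mul1r.
apply: lerD; rewrite qabsM ?ler_wpM2r ?qabs_ge0//.
by rewrite qabsX -[leRHS]mul1r ler_wpM2r ?qabs_ge0.
Qed.

Lemma qabs_powB k h : qabs h <= del ->
  qabs ((p + h) ^+ k - p ^+ k) <= qabs h / del.
Proof.
move=> hd; elim: k => [|k IH].
  by rewrite !expr0 subrr qabs0 divr_ge0 ?qabs_ge0// ltW.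
have -> : (p + h) ^+ k.+1 - p ^+ k.+1 =
    ((p + h) ^+ k - p ^+ k) * p + (p + h) ^+ k * h.
  by rewrite !exprSr mulrBl mulrDr addrAC.
apply: le_trans (qabsD _ _) _; rewrite -[leRHS]mul1r -split_h !mul1r.
apply: lerD; rewrite qabsM ?ler_wpM2r ?qabs_ge0//.
rewrite qabsX -[leRHS]mul1r ler_wpM2r ?qabs_ge0// exprn_ile1 ?qabs_ge0//.
by rewrite -pdel; apply: le_trans (qabsD _ _) _; rewrite lerD2l.
Qed.

(* The radius 1 = |p| + del absorbs the factor k^2 that a direct estimate of
   the Taylor remainder would carry. *)
Lemma qabs_pow_taylor k h : qabs h <= del ->
  qabs ((p + h) ^+ k - p ^+ k - dpow p k h) <= (qabs h / del) ^+ 2.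
Proof.
move=> hd; elim: k => [|k IH].
  by rewrite !expr0 /= subrr subr0 qabs0 sqr_ge0.
have -> : (p + h) ^+ k.+1 - p ^+ k.+1 - dpow p k.+1 h =
    ((p + h) ^+ k - p ^+ k - dpow p k h) * p + ((p + h) ^+ k - p ^+ k) * h.
  rewrite !exprSr /= !mulrBl mulrDr; apply/rowP => i.
  by rewrite !(qadd_coord, qopp_coord); ring.
apply: le_trans (qabsD _ _) _; rewrite expr2 -split_h -expr2.
by apply: lerD; rewrite qabsM ler_wpM2r ?qabs_ge0// qabs_powB.
Qed.

End PowerEstimates.

Variables (a : nat -> quat R) (A : R) (f : quat R -> quat R).
Hypothesis aA : forall N, \sum_(0 <= k < N) qabs (a k) <= A.
Hypothesis fa : forall p, qball p ->
  series (fun k => p ^+ k * a k) @ \oo --> f p.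

Let A0 : 0 <= A.
Proof. by have := aA 0; rewrite big_geq. Qed.

Section AtPoint.
Variable p : quat R.
Hypothesis bp : qball p.

Let del : R := 1 - qabs p.
Let del0 : 0 < del. Proof. by rewrite subr_gt0. Qed.
Let pdel : qabs p + del = 1. Proof. by rewrite addrC subrK. Qed.

Let term_le (u : nat -> quat R) (B : R) : 0 <= B ->
  (forall k, qabs (u k) <= B) ->
  forall N, \sum_(0 <= k < N) qabs (u k * a k) <= B * A.
Proof.
move=> B0 uB N; apply: (@le_trans _ _ (\sum_(0 <= k < N) B * qabs (a k))).
  by apply: ler_sum => k _; rewrite qabsM ler_wpM2r ?qabs_ge0.
by rewrite -mulr_sumr ler_wpM2l.
Qed.

Let hd_ge0 h : 0 <= qabs h / del.
Proof. by rewrite divr_ge0 ?qabs_ge0// ltW. Qed.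

(** The termwise differential. Its terms are bounded by [qabs h / del] times the coefficients,
    uniformly in k, so summability of the coefficients alone makes it converge. *)
Let L h : quat R := limn (series (fun k => dpow p k h * a k)).

Let L_cvg h : series (fun k => dpow p k h * a k) @ \oo --> L h.
Proof.
apply: (@quat_series_cvg _ (qabs h / del * A)) => N.
by apply: term_le => // k; exact: qabs_dpow.
Qed.

Let L_bound h : qabs (L h) <= A / del * qabs h.
Proof.
apply: (qabs_lim_le (@L_cvg h)) => N.
apply: (le_trans (qabs_sum _ _)).
have -> : A / del * qabs h = qabs h / del * A by rewrite mulrAC -mulrA mulrC.
by apply: term_le => // k; exact: qabs_dpow.
Qed.

Let L_linear : linear L.
Proof.
move=> c h h'.
have c1 : (c *: series (fun k => dpow p k h * a k) n +
    series (fun k => dpow p k h' * a k) n) @[n --> \oo] --> c *: L h + L h'.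
  by apply: cvgD; [apply: cvgZ; [exact: cvg_cst|exact: L_cvg]|exact: L_cvg].
have c2 := @L_cvg (c *: h + h').
rewrite -(cvg_lim _ c1)// -(cvg_lim _ c2)//.
apply: (congr1 (fun g : nat -> quat R => lim (g @ \oo))); apply/funext => N; rewrite /series/= scaler_sumr -big_split.
by apply: eq_bigr => k _; rewrite /= dpowD dpowZ mulrDl scalerAl.
Qed.

Let Lf : {linear quat R -> quat R} :=
  HB.pack L (GRing.isLinear.Build R (quat R) (quat R) *:%R L L_linear).

Let L_continuous : continuous Lf.
Proof.
move=> h0; apply/(@cvgrPdist_lt _ _ _ _ (@nbhs_filter (quat R) h0)) => e e0.
pose K := A / del + 1.
have K0 : 0 < K by rewrite ltr_wpDl// divr_ge0// ltW.
have e1 : 0 < e / (2 * K) by rewrite divr_gt0// mulr_gt0.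
apply/nbhs_ballP; exists (e / (2 * K)) => //= h.
rewrite -ball_normE /ball_/= => hlt.
have -> : Lf h0 - Lf h = L (-1 *: h + h0) by rewrite L_linear scaleN1r addrC.
rewrite scaleN1r addrC; apply: le_lt_trans (norm_le_qabs _) _.
apply: le_lt_trans (L_bound _) _.
apply: (@le_lt_trans _ _ (K * (2 * `|h0 - h|))).
  by rewrite ler_pM ?qabs_ge0 ?qabs_le_norm ?lerDl// divr_ge0// ltW.
by rewrite mulrA [K * 2]mulrC -ltr_pdivlMl ?mulr_gt0// [_ * e]mulrC.
Qed.

Let expansion h : qabs h <= del -> qball (p + h) ->
  qabs (f (p + h) - f p - L h) <= (qabs h / del) ^+ 2 * A.
Proof.
move=> hd bph.
have cv : (series (fun k => (p + h) ^+ k * a k) N - series (fun k => p ^+ k * a k) N -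
    series (fun k => dpow p k h * a k) N) @[N --> \oo] --> f (p + h) - f p - L h.
  by apply: quat_cvgB; [apply: quat_cvgB; exact: fa|exact: L_cvg].
apply: (qabs_lim_le cv) => N.
rewrite /series/= -!sumrB; apply: le_trans (qabs_sum _ _) _.
under eq_bigr do rewrite -!mulrBl.
by apply: term_le => [|k]; rewrite ?sqr_ge0// qabs_pow_taylor.
Qed.

Let taylor : f \o shift p = cst (f p) + Lf +o_0 id.
Proof.
apply/eqaddoP => e e0.
(* The 4 is the square of the factor between modulus and sup norm; the [+ 1] keeps [K] positive when
   [A = 0]. *)
pose K := 4 * A / del ^+ 2 + 1.
have K0 : 0 < K by rewrite ltr_wpDl// divr_ge0 ?sqr_ge0// mulr_ge0.
pose r : R := Num.min (del / 2) (e / K).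
have r0 : 0 < r by rewrite lt_min !divr_gt0.
apply/nbhs_ballP; exists r => //= h; rewrite -ball_normE /ball_/= sub0r normrN.
rewrite lt_min => /andP[h1 /ltW he].
have hd : qabs h < del.
  by apply: le_lt_trans (qabs_le_norm _) _; rewrite mulrC -ltr_pdivlMr.
have bph : qball (p + h).
  by apply: le_lt_trans (qabsD _ _) _; rewrite -pdel ltrD2l.
rewrite /shift/= !fctE opprD addrA [h + p]addrC.
apply: le_trans (norm_le_qabs _) _; apply: le_trans (expansion (ltW hd) bph) _.
have h2 : qabs h ^+ 2 <= 4 * `|h| ^+ 2.
  rewrite (_ : 4 * _ = (2 * `|h|) ^+ 2); last by rewrite exprMn -natrX.
  by rewrite lerXn2r ?nnegrE ?qabs_ge0 ?mulr_ge0// qabs_le_norm.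
have d2 : 0 < del ^+ 2 by rewrite exprn_gt0.
apply: (@le_trans _ _ (K * `|h| ^+ 2)).
  apply: (@le_trans _ _ (4 * A / del ^+ 2 * `|h| ^+ 2)).
    have -> : 4 * A / del ^+ 2 * `|h| ^+ 2 = 4 * `|h| ^+ 2 * (A / del ^+ 2).
      by rewrite mulrAC [4 * A * _]mulrAC -mulrA.
    by rewrite expr_div_n -[leLHS]mulrA [X in _ * X <= _]mulrC ler_wpM2r// divr_ge0// ltW.
  by rewrite ler_wpM2r ?sqr_ge0// lerDl.
rewrite expr2 mulrA ler_wpM2r// mulrC -ler_pdivlMr//.
Qed.

Let diffE : 'd f p = Lf :> (quat R -> quat R).
Proof. exact: diff_unique L_continuous taylor. Qed.

Let series_differentiable_at : differentiable f p.
Proof.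
by apply/diff_locallyP; rewrite diffE; split; [exact: L_continuous|exact: taylor].
Qed.

Let L_comm h : h * p = p * h -> L h = h * L 1.
Proof.
move=> hp; have cv : h * series (fun k => dpow p k 1 * a k) N @[N --> \oo] --> h * L 1.
  by apply: quat_cvgM; [exact: cvg_cst|exact: L_cvg].
have c2 := @L_cvg h; rewrite -(cvg_lim _ cv)// -(cvg_lim _ c2)//.
apply: (congr1 (fun g : nat -> quat R => lim (g @ \oo))); apply/funext => N; rewrite /series/= mulr_sumr.
by apply: eq_bigr => k _; rewrite dpow_comm// mulrA.
Qed.

Lemma series_diff : differentiable f p /\
  forall h, h * p = p * h -> 'd f p h = h * 'd f p 1.
Proof. by split => // h hp; rewrite diffE; exact: L_comm. Qed.

End AtPoint.

(** On the slice of [I], [I] commutes with the base point and can be pulled out of the differential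
    on the left; the Cauchy-Riemann sum becomes [1 + I * I] times a derivative. *)
Lemma series_slice_regular : slice_regular f.
Proof.
split=> [q bq|I hI x y bz]; first by have [] := series_diff bq.
have [df dL] := series_diff bz.
rewrite derive1_slice_re// derive1_slice_im// (dL I).
  by rewrite mulrA -expr2 (hI : I ^+ 2 = -1) mulN1r subrr scaler0.
by have := slice_ptC 0 1 x y hI; rewrite {1 4}/slice_pt scale0r add0r scale1r.
Qed.

End SeriesRegular.

(** * Linear changes of variables on the line and in the plane *)

Section LebesgueChange.
Variable R : realType.
Notation leb := (@lebesgue_measure R).
Local Open Scope ereal_scope.

Let Rm := measurableTypeR R.

(** The image of Lebesgue measure under the map is Lebesgue measure on half-open intervals, hence
    everywhere by uniqueness. The scaling lemma below rests on the same argument, up to the factor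
    c. *)
Lemma ge0_integral_shift (c : R) (f : measurableTypeR R -> \bar R) :
  measurable_fun setT f -> (forall x, 0 <= f x) ->
  \int[leb]_x f (x + c)%R = \int[leb]_x f x.
Proof.
move=> mf f0.
have mphi : measurable_fun setT ((fun x : R => x + c)%R : Rm -> Rm).
  by apply: (@measurable_funD _ Rm R setT id (cst c)).
have := ge0_integral_pushforward mphi leb measurableT mf (fun x _ => f0 x).
rewrite preimage_setT => <-.
apply: eq_measure_integral => A mA _; apply/esym/lebesgue_measure_unique => //=.
move=> _ [[a b]] _ <-; rewrite /pushforward.
have -> : (fun x : R => x + c)%R @^-1` `]a, b]%classic = `](a - c)%R, (b - c)%R]%classic.
  by apply/seteqP; split => x /=; rewrite !in_itv/= ltrBlDr lerBrDr.
rewrite !lebesgue_measure_itv/= !lte_fin ltrD2r; case: ifP => // _.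
by rewrite -!EFinB; congr EFin; ring.
Qed.

Lemma ge0_integral_scale (c : R) (f : measurableTypeR R -> \bar R) : (0 < c)%R ->
  measurable_fun setT f -> (forall x, 0 <= f x) ->
  c%:E * \int[leb]_x f (c * x)%R = \int[leb]_x f x.
Proof.
move=> c0 mf f0.
have mphi : measurable_fun setT ((fun x : R => c * x)%R : Rm -> Rm).
  by apply: (@measurable_funM _ Rm R setT (cst c) id).
have := ge0_integral_pushforward mphi leb measurableT mf (fun x _ => f0 x).
rewrite preimage_setT => <-.
have cnng : (0 <= c)%R by exact: ltW.
rewrite -[c]/((NngNum cnng)%:num)%R -ge0_integral_mscale//.
apply: eq_measure_integral => A mA _; apply/esym/lebesgue_measure_unique => //=.
move=> _ [[a b]] _ <-; rewrite /mscale/= /pushforward.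
have -> : (fun x : R => c * x)%R @^-1` `]a, b]%classic = `](a / c)%R, (b / c)%R]%classic.
  apply/seteqP; split => x /=; rewrite !in_itv/= ltr_pdivrMr// ler_pdivlMr//;
  by rewrite mulrC.
rewrite !lebesgue_measure_itv/= !lte_fin ltr_pM2r ?invr_gt0//.
case: ifP => [_|_]; last by rewrite mule0.
rewrite -!EFinB -EFinM; congr EFin; field.
by rewrite gt_eqF.
Qed.

Local Notation plane := (measurableTypeR R * measurableTypeR R)%type.
Local Notation area := (@area R).

Lemma area_tonelli1 (f : plane -> \bar R) : measurable_fun setT f ->
  (forall z, 0 <= f z) ->
  \int[area]_z f z = \int[leb]_x \int[leb]_y f (x, y).
Proof. by move=> mf f0; rewrite /area fubini_tonelli1. Qed.

Lemma area_tonelli2 (f : plane -> \bar R) : measurable_fun setT f ->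
  (forall z, 0 <= f z) ->
  \int[area]_z f z = \int[leb]_y \int[leb]_x f (x, y).
Proof. by move=> mf f0; rewrite /area fubini_tonelli2. Qed.

Definition plane_map (a b c d : R) (z : plane) : plane :=
  (a * z.1 + b * z.2, c * z.1 + d * z.2)%R.

Lemma measurable_plane_map (a b c d : R) :
  measurable_fun setT (plane_map a b c d).
Proof.
apply: measurable_fun_pair; apply: measurable_funD;
  by apply: measurable_funM => //; exact: measurable_cst.
Qed.

Lemma area_shear1 (t : R) (f : plane -> \bar R) : measurable_fun setT f ->
  (forall z, 0 <= f z) ->
  \int[area]_z f (plane_map 1 t 0 1 z) = \int[area]_z f z.
Proof.
move=> mf f0; rewrite !area_tonelli2//; last first.
  by apply: measurableT_comp => //; exact: measurable_plane_map.
apply: eq_integral => y _.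
rewrite -(ge0_integral_shift (t * y) (f := fun x => f (x, y)))//; last first.
  exact: measurable_fun_pair1.
by apply: eq_integral => x _; rewrite /plane_map/= !mul1r mul0r add0r.
Qed.

Lemma area_shear2 (t : R) (f : plane -> \bar R) : measurable_fun setT f ->
  (forall z, 0 <= f z) ->
  \int[area]_z f (plane_map 1 0 t 1 z) = \int[area]_z f z.
Proof.
move=> mf f0; rewrite !area_tonelli1//; last first.
  by apply: measurableT_comp => //; exact: measurable_plane_map.
apply: eq_integral => x _.
rewrite -(ge0_integral_shift (t * x) (f := fun y => f (x, y)))//; last first.
  exact: measurable_fun_pair2.
apply: eq_integral => y _; rewrite /plane_map/= !mul1r mul0r addr0.
by rewrite [(t * x + y)%R]addrC.
Qed.

Definition area_preserving (T : plane -> plane) := forall f : plane -> \bar R,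
  measurable_fun setT f -> (forall z, 0 <= f z) ->
  \int[area]_z f (T z) = \int[area]_z f z.

(* A rotation is a product of three shears. *)
Lemma area_preserving_rotation (a b : R) :
  (a ^+ 2 + b ^+ 2 = 1)%R -> b != 0%R ->
  area_preserving (plane_map a (- b)%R b a).
Proof.
(* For the angle with cosine a and sine b this is minus the tangent of the half-angle; the shears of
   parameters t, b, t then compose to the rotation. *)
move=> ab b0 f mf f0; pose t : R := ((a - 1) / b)%R.
pose S := plane_map 1 t 0 1; pose S' := plane_map 1 0 b 1.
have mS : measurable_fun setT S by exact: measurable_plane_map.
have mS' : measurable_fun setT S' by exact: measurable_plane_map.
have mfS : measurable_fun setT (f \o S) by exact: measurableT_comp.
have mfS' : measurable_fun setT (f \o S \o S') by exact: measurableT_comp.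
rewrite -(area_shear1 t mf)// -(area_shear2 b mfS)//; last by move=> z; exact: f0.
rewrite -(area_shear1 t mfS')//; last by move=> z; exact: f0.
apply: eq_integral => z _ /=; congr f.
have tb : (t * b = a - 1)%R by rewrite /t divfK.
have a2 : (t * (1 + a) = - b)%R.
  apply: (mulIf b0); rewrite mulrAC tb mulNr -expr2.
  have -> : (b ^+ 2 = 1 - a ^+ 2)%R by rewrite -ab addrC addKr.
  by ring.
have e1 : (a = t * b + 1)%R by rewrite tb subrK.
rewrite /S /S' /plane_map/=; congr pair.
  by rewrite -a2 e1; ring.
by rewrite e1; ring.
Qed.

Lemma area_scale (c : R) (f : plane -> \bar R) : (0 < c)%R ->
  measurable_fun setT f -> (forall z, 0 <= f z) ->
  (c ^+ 2)%:E * \int[area]_z f (c * z.1, c * z.2)%R = \int[area]_z f z.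
Proof.
move=> c0 mf f0.
have mfc : measurable_fun setT (fun z : plane => f (c * z.1, c * z.2)%R).
  have := measurableT_comp mf (measurable_plane_map c 0 0 c).
  by apply: eq_measurable_fun => z _ /=; rewrite /plane_map !mul0r addr0 add0r.
rewrite !area_tonelli1//.
have mg : measurable_fun setT (fun x => \int[leb]_y f (x, y)).
  exact: measurable_fun_fubini_tonelli_F.
have mg0 x : 0 <= \int[leb]_y f (x, y) by exact: integral_ge0.
rewrite -(ge0_integral_scale c0 mg mg0) expr2 EFinM -muleA; congr (_ * _).
rewrite -ge0_integralZl//; last 3 first.
- exact: (measurable_fun_fubini_tonelli_F _ mfc (fun z => f0 _)).
- by move=> x _; exact: integral_ge0.
- by rewrite lee_fin ltW.
apply: eq_integral => x _.
rewrite -[RHS](ge0_integral_scale c0 (f := fun y => f (c * x, y)%R))//.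
exact: measurable_fun_pair2.
Qed.

(** The integral is the difference of those of the positive and negative parts, each of them
    invariant. Extending F by 0 outside D turns the invariance of D into that of a function on the
    whole plane. *)
Lemma area_invariant (T : plane -> plane) (D : set plane) (F : plane -> R) :
  measurable_fun setT T ->
  area_preserving T ->
  measurable D -> (forall z, D (T z) <-> D z) -> measurable_fun D F ->
  \int[area]_(z in D) (F (T z))%:E = \int[area]_(z in D) (F z)%:E.
Proof.
move=> mT inv mD DT mF.
rewrite !(integral_mkcond D).
pose G := (fun z => (F z)%:E) \_ D.
have mG : measurable_fun setT G.
  by apply/(measurable_restrictT _ mD); exact/measurable_EFinP.
have -> : (fun z => (F (T z))%:E) \_ D = G \o T.
  apply/funext => z; rewrite /G /= !patchE.
  have -> : (T z \in D) = (z \in D) by apply/idP/idP; rewrite !inE => /DT.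
  by [].
rewrite -/G integralE [RHS]integralE; congr (_ - _).
  rewrite -(inv G^\+); [|exact: (measurable_funepos mG)|by []].
  by apply: eq_integral => z _; rewrite !funeposE.
rewrite -(inv G^\-); [|exact: (measurable_funeneg mG)|by []].
by apply: eq_integral => z _; rewrite !funenegE.
Qed.

End LebesgueChange.

(** * Integrals of radial functions *)

Section PolarCoordinates.
Variable R : realType.
Notation leb := (@lebesgue_measure R).
Local Notation plane := (measurableTypeR R * measurableTypeR R)%type.
Local Notation area := (@area R).
Local Open Scope ereal_scope.

(** The squared radius rather than the radius: it is the variable of the weight, and the image of
    the area under it has constant density on the half-line. *)
Definition sqnorm (z : plane) : measurableTypeR R := (z.1 ^+ 2 + z.2 ^+ 2)%R.

Lemma measurable_sqnorm : measurable_fun setT sqnorm.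
Proof.
by apply: measurable_funD; apply: measurable_funX; [exact: measurable_fst|exact: measurable_snd].
Qed.

Lemma sqnorm_ge0 z : (0 <= sqnorm z)%R.
Proof. by rewrite addr_ge0// sqr_ge0. Qed.

Lemma area_setX (A B : set (measurableTypeR R)) : measurable A -> measurable B ->
  area (A `*` B) = leb A * leb B.
Proof. by move=> mA mB; exact: product_measure1E. Qed.

Let disc (t : R) : set plane := [set z | (sqnorm z <= t)%R].

Let measurable_disc t : measurable (disc t).
Proof.
have -> : disc t = setT `&` sqnorm @^-1` `]-oo, t]%classic.
  by rewrite setTI; apply/seteqP; split => z /=; rewrite in_itv.
by apply: measurable_sqnorm => //; exact: measurable_itv.
Qed.

Let area_discZ t : (0 < t)%R -> area (disc t) = t%:E * area (disc 1).
Proof.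
move=> t0; have s0 : (0 < Num.sqrt t)%R by rewrite sqrtr_gt0.
have m1 : measurable_fun setT (fun z : plane => (\1_(disc t) z)%:E : \bar R).
  exact/measurable_EFinP/measurable_indic.
have indE A : measurable A -> \int[area]_z (\1_A z : R)%:E = area A.
  by move=> mA; rewrite integral_indic// setIT.
have ind0 z : 0 <= (\1_(disc t) z : R)%:E by rewrite lee_fin.
rewrite -(indE (disc t))// -(area_scale s0 m1 ind0) sqr_sqrtr ?(ltW t0)//.
congr (_ * _); rewrite -indE//; apply: eq_integral => z _; congr EFin.
rewrite !indicE; congr ((nat_of_bool _)%:R).
have h (x y : R) : (t * x + t * y <= t)%R = (x + y <= 1)%R.
  by rewrite -mulrDr -[X in (_ <= X)%R]mulr1 ler_pM2l.
by apply/idP/idP; rewrite !inE /disc /= /sqnorm /= !exprMn sqr_sqrtr ?(ltW t0)// h.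
Qed.

Let area_disc_fin : area (disc 1) < +oo.
Proof.
have sub : disc 1 `<=` `[(-1)%R, 1%R]%classic `*` `[(-1)%R, 1%R]%classic.
  move=> z; rewrite /disc /= /sqnorm => h; rewrite !in_itv/= -!ler_norml.
  have h1 := sqr_ge0 z.1; have h2 := sqr_ge0 z.2.
  have n1 (x : R) : (x ^+ 2 <= 1)%R -> (`|x| <= 1)%R.
    by move=> x1; rewrite -(ler_sqr (y := 1%R)) ?nnegrE// real_normK ?num_real// expr1n.
  by split; apply: n1; move: h h1 h2; lra.
apply: (@le_lt_trans _ _ (area (`[(-1)%R, 1%R]%classic `*` `[(-1)%R, 1%R]%classic))).
  apply: le_measure => //; rewrite inE//.
  by apply: measurableX; exact: measurable_itv.
rewrite area_setX; [|exact: measurable_itv|exact: measurable_itv].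
by rewrite !lebesgue_measure_itv/= lte_fin; case: ifP => _; rewrite -?EFinB -?EFinM ?ltry// mul0e.
Qed.

Let area_disc0 : area (disc 0) = 0.
Proof.
apply/eqP; rewrite eq_le measure_ge0 andbT.
have sub : disc 0 `<=` [set 0%R] `*` [set 0%R].
  move=> z; rewrite /disc /= /sqnorm => h.
  have h1 := sqr_ge0 z.1; have h2 := sqr_ge0 z.2.
  by split; apply/eqP; rewrite -sqrf_eq0; apply/eqP; move: h h1 h2; lra.
apply: (@le_trans _ _ (area ([set 0%R] `*` [set 0%R]))).
  apply: le_measure => //; rewrite inE//.
  by apply: measurableX; exact: measurable_set1.
rewrite area_setX; [|exact: measurable_set1|exact: measurable_set1].
by rewrite lebesgue_measure_set1 mul0e.
Qed.

(** The area of the unit disc, left unevaluated until the Gaussian integral identifies it with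
    pi. *)
Let c0 : R := fine (area (disc 1)).

Let c0_ge0 : (0 <= c0)%R. Proof. by rewrite fine_ge0. Qed.

Let area_disc1 : area (disc 1) = c0%:E.
Proof. by rewrite fineK// ge0_fin_numE. Qed.

Let area_disc t : (0 <= t)%R -> area (disc t) = (t * c0)%:E.
Proof.
rewrite le_eqVlt => /predU1P[<-|t0]; first by rewrite area_disc0 mul0r.
by rewrite area_discZ// area_disc1 EFinM.
Qed.

Let halfline : set (measurableTypeR R) := `[0%R, +oo[%classic.

Let mhalfline : measurable halfline.
Proof. exact: measurable_itv. Qed.

Let nnc0 : {nonneg R} := NngNum c0_ge0.

(** The preimage of an interval is a difference of discs, whose areas are proportional to the
    squared radii by scaling. Negative ends give empty discs, whence the restriction to the
    half-line. *)
Let pushforward_sqnorm (A : set (measurableTypeR R)) : measurable A ->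
  pushforward area sqnorm A = mscale nnc0 (mrestr leb mhalfline) A.
Proof.
(* Half-open intervals of finite mass exhausting the line, as uniqueness of the measure requires. *)
pose g (k : nat) : set (measurableTypeR R) := `](- k.+1%:R)%R, k.+1%:R]%classic.
have preE a b : (a < b)%R -> sqnorm @^-1` `]a, b]%classic = disc b `\` disc a.
  move=> ab; apply/seteqP; split => z /=; rewrite in_itv/= /disc/=.
    by move=> /andP[h1 h2]; split => //; apply/negP; rewrite -ltNge.
  by move=> [h1 /negP]; rewrite -ltNge => h2; rewrite h2.
have subd a b : (a <= b)%R -> disc a `<=` disc b.
  by move=> ab z /= /le_trans; apply.
have disc_neg t : (t < 0)%R -> disc t = set0.
  move=> t0; apply/seteqP; split => z //= h.
  by have := le_lt_trans (le_trans (sqnorm_ge0 z) h) t0; rewrite ltxx.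
have key a b : (a < b)%R -> area (sqnorm @^-1` `]a, b]%classic) =
    c0%:E * leb (`]a, b]%classic `&` halfline).
  move=> ab; rewrite preE//.
  have [b0|b0] := ltP b 0%R.
    rewrite disc_neg// set0D measure0 (_ : _ `&` _ = set0) ?measure0 ?mule0//.
    apply/seteqP; split => x //=; rewrite /halfline /= !in_itv/= andbT.
    by move=> [/andP[_ xb] x0]; have := le_lt_trans (le_trans x0 xb) b0; rewrite ltxx.
  rewrite measureD//; last by rewrite /= area_disc// ltry.
  rewrite setIidr; last exact/subd/ltW.
  have [a0|a0] := ltP a 0%R.
    rewrite (disc_neg a)// measure0 sube0; apply: (etrans (area_disc b0)).
    rewrite (_ : _ `&` _ = `[0%R, b]%classic).
      rewrite lebesgue_measure_itv/= lte_fin.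
      have [_|b0'] := ltP 0%R b; first by rewrite -EFinB -EFinM subr0 mulrC.
      by rewrite -(le_anti (introT andP (conj b0 b0'))) mul0r mule0.
    apply/seteqP; split => x /=; rewrite /halfline /= !in_itv/= andbT.
      by move=> [/andP[_ ->] ->].
    by move=> /andP[x0 ->]; split => //; rewrite andbT (lt_le_trans a0).
  transitivity ((b * c0)%:E - (a * c0)%:E).
    by congr (_ - _); exact: area_disc.
  rewrite (_ : _ `&` _ = `]a, b]%classic).
    rewrite lebesgue_measure_itv/= lte_fin ab -!EFinB -EFinM; congr EFin.
    by rewrite mulrBr; congr (_ - _)%R; rewrite mulrC.
  apply/seteqP; split => x /=; rewrite /halfline /= !in_itv/= andbT.
    by move=> [].
  by move=> /andP[ax xb]; rewrite ax xb; split => //; exact: le_trans (ltW ax).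
have key' (X : set (measurableTypeR R)) : ocitv X ->
    pushforward area sqnorm X = mscale nnc0 (mrestr leb mhalfline) X.
  move=> /ocitvP[->|[[a b] /= ab ->]]; last by rewrite /pushforward key.
  by rewrite /pushforward preimage_set0 /mscale /= /mrestr set0I !measure0 mule0.
move=> mA.
pose m1 : {measure set (measurableTypeR R) -> \bar R} :=
  measure_function_pushforward__canonical__measure_function_Measure area
    measurable_sqnorm.
pose m2 : {measure set (measurableTypeR R) -> \bar R} :=
  mscale nnc0 (mrestr leb mhalfline).
have gE : \bigcup_k g k = setT.
  apply/seteqP; split => // x _.
  have := archi_boundP (normr_ge0 x); set N := Num.Def.archi_bound _ => h.
  exists N => //; rewrite /g /= in_itv/=.
  have h1 : (`|x| < N.+1%:R)%R by apply: (lt_trans h); rewrite ltr_nat.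
  by move: h1; rewrite ltr_norml => /andP[-> /ltW ->].
have og k : ocitv (g k).
  by apply/ocitvP; right; exists (- k.+1%:R, k.+1%:R)%R => //=; rewrite gtrN.
have fin k : m1 (g k) < +oo.
  have -> : m1 (g k) = m2 (g k) by exact: key'.
  rewrite /m2 /= /mscale /= /mrestr.
  apply: (@le_lt_trans _ _ (c0%:E * leb (g k))).
    apply: lee_wpmul2l; first by rewrite lee_fin.
    apply: le_measure; rewrite ?inE//; try exact: measurable_itv.
    by apply: measurableI => //; exact: measurable_itv.
  rewrite lebesgue_measure_itv/= lte_fin gtrN// -EFinB -EFinM ltry//.
exact: (@measure_unique _ R (measurableTypeR R) (@ocitv R) g erefl (@ocitvI R)
  og gE m1 m2 key' fin A mA).
Qed.

Lemma area_polar_const : exists2 c : R, (0 <= c)%R &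
  forall f : measurableTypeR R -> \bar R, measurable_fun halfline f ->
    (forall t, halfline t -> 0 <= f t) ->
    \int[area]_z f (sqnorm z) = c%:E * \int[leb]_(t in halfline) f t.
Proof.
exists c0 => // f mf f0.
have f0' : {in halfline, forall y, 0 <= f y} by move=> y /set_mem; exact: f0.
have := ge0_integral_pushforward measurable_sqnorm area mhalfline mf f0'.
have -> : sqnorm @^-1` halfline = setT.
  apply/seteqP; split => // z _; rewrite /halfline /= in_itv/= andbT.
  exact: sqnorm_ge0.
move=> <-.
rewrite -[c0]/(nnc0%:num)%R -ge0_integral_mscale//.
apply: eq_measure_integral => [|mS A mA AD]; first exact: measurable_sqnorm.
have := pushforward_sqnorm mA; rewrite /mscale /= /mrestr setIidl//.
Qed.

Lemma integral_expRN :
  \int[leb]_(t in `[0%R, +oo[) (expR (- t))%:E = 1.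
Proof.
rewrite -(@integral_exponential_pdf R 1%R)// integral_mkcond.
apply: eq_integral => x _; rewrite /exponential_pdf !patchE; case: ifP => // _.
by rewrite mul1r mulN1r.
Qed.

(** The constant is found by testing on exp(-t): the plane integral is the square of the Gaussian
    integral, i.e. pi, and the half-line integral is 1. *)
Lemma ge0_area_polar (f : measurableTypeR R -> \bar R) :
  measurable_fun (`[0%R, +oo[%classic : set (measurableTypeR R)) f ->
  (forall t, (0 <= t)%R -> 0 <= f t) ->
  \int[area]_z f (sqnorm z) = pi%:E * \int[leb]_(t in `[0%R, +oo[) f t.
Proof.
have [c c_0 cP] := area_polar_const.
move=> mf f0; rewrite cP//; last first.
  by move=> t; rewrite /halfline /= in_itv/= andbT; exact: f0.
congr (_%:E * _).
have me : measurable_fun setT (fun t : measurableTypeR R => (expR (- t))%:E : \bar R).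
  apply/measurable_EFinP; apply: (measurableT_comp (@measurable_expR R)).
  exact: (@measurable_funN _ (measurableTypeR R) R setT id).
have e0 (t : measurableTypeR R) : 0 <= (expR (- t))%:E by rewrite lee_fin expR_ge0.
have := cP _ (measurable_funS measurableT (@subsetT _ halfline) me) (fun t _ => e0 t).
rewrite integral_expRN mule1 => h; apply/EFin_inj; rewrite -h.
rewrite area_tonelli1//; last exact: (measurableT_comp me measurable_sqnorm).
have mg : measurable_fun setT (fun t : measurableTypeR R => (gauss_fun t)%:E : \bar R).
  by apply/measurable_EFinP; exact: measurable_gauss_fun.
have g0 (t : measurableTypeR R) : 0 <= (gauss_fun t)%:E.
  by rewrite lee_fin gauss_fun_ge0.
under eq_integral => x _.
  rewrite (_ : (fun y => _) = fun y => (gauss_fun x)%:E * (gauss_fun y)%:E); last first.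
    by apply/funext => y; rewrite -EFinM /gauss_fun -expRD /sqnorm opprD.
  rewrite ge0_integralZl_EFin//; last exact: gauss_fun_ge0.
  rewrite integralT_gauss; over.
rewrite (ge0_integralZr _ _ mg (fun t _ => g0 t))//.
by rewrite integralT_gauss -EFinM -expr2 sqr_sqrtr// pi_ge0.
Qed.

End PolarCoordinates.

(** * The relation between Gamma and Beta integrals *)

Section GammaBeta.
Variable R : realType.
Notation leb := (@lebesgue_measure R).
Local Notation Rm := (measurableTypeR R).
Local Notation plane := (measurableTypeR R * measurableTypeR R)%type.
Local Open Scope ereal_scope.

(** Extended-real values allow Tonelli before finiteness is known; [Gamma] is the finite part. *)
Definition eGamma (x : R) : \bar R :=
  \int[leb]_(t in `]0%R, +oo[) (t `^ (x - 1) * expR (- t))%:E.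

Definition eBeta (a b : R) : \bar R :=
  \int[leb]_(t in `]0%R, 1%R[) (omega a b t)%:E.

Lemma measurable_powRl (p : R) (D : set Rm) :
  measurable_fun D (fun t : Rm => (t `^ p)%R : R).
Proof. exact: (measurable_funS measurableT (@subsetT _ D) (measurable_powR p)). Qed.

Lemma measurable_expRN (D : set Rm) :
  measurable_fun D (fun t : Rm => expR (- t) : R).
Proof.
apply: (measurableT_comp (@measurable_expR R)).
exact: (@measurable_funN _ Rm R D id).
Qed.

Lemma measurable_omega (a b : R) (D : set Rm) :
  measurable_fun D (fun t : Rm => omega a b t : R).
Proof.
apply: measurable_funM; first exact: measurable_powRl.
apply: (measurableT_comp (measurable_powR (b - 1))).
exact: (@measurable_funB _ Rm R D (cst 1%R) id).
Qed.

Lemma omega_ge0 (a b t : R) : (0 <= omega a b t)%R.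
Proof. by rewrite mulr_ge0// powR_ge0. Qed.

(** Extension by 0 lets the convolution run over the whole line, its support being handled by
    vanishing. *)
Let u (a : R) : Rm -> \bar R :=
  (fun t => (t `^ (a - 1) * expR (- t))%:E) \_ `]0%R, +oo[%classic.

Let mu_ (a : R) : measurable_fun setT (u a).
Proof.
apply/(measurable_restrictT _ (measurable_itv _)); apply/measurable_EFinP.
by apply: measurable_funM; [exact: measurable_powRl|exact: measurable_expRN].
Qed.

Let u_ge0 a t : 0 <= u a t.
Proof.
rewrite /u patchE; case: ifP => // _.
by rewrite lee_fin mulr_ge0 ?powR_ge0 ?expR_ge0.
Qed.

Let u_pos a (t : R) : (0 < t)%R -> u a t = (t `^ (a - 1) * expR (- t))%:E.
Proof. by move=> t0; rewrite /u patchE mem_set//= in_itv/= t0. Qed.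

Let u_neg a (t : R) : (t <= 0)%R -> u a t = 0.
Proof.
by move=> t0; rewrite /u patchE memNset//= in_itv/= andbT; apply/negP; rewrite -leNgt.
Qed.

Let m_scale (c : R) : measurable_fun setT (fun x : Rm => (c * x)%R : R).
Proof. by apply: measurable_funM. Qed.

Let m_rev (c d : R) : measurable_fun setT (fun x : Rm => (c - d * x)%R : R).
Proof. by apply: measurable_funB => //; exact: m_scale. Qed.

Let eGammaE a : eGamma a = \int[leb]_t u a t.
Proof. by rewrite /eGamma integral_mkcond. Qed.

Lemma eGamma_ge0 a : 0 <= eGamma a.
Proof. by rewrite eGammaE integral_ge0. Qed.

Lemma eBeta_ge0 a b : 0 <= eBeta a b.
Proof. by apply: integral_ge0 => t _; rewrite lee_fin omega_ge0. Qed.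

(* Convolving the two Gamma integrands: the substitution [s = t x] in the
   inner integral separates the variables. *)
Let convolution a b (t : R) :
  \int[leb]_s (u a s * u b (t - s)%R) = u (a + b)%R t * eBeta a b.
Proof.
have mconv : measurable_fun setT (fun s : Rm => u a s * u b (t - s)%R).
  apply: emeasurable_funM => //; apply: (measurableT_comp (mu_ b)).
  exact: (@measurable_funB _ Rm R setT (cst t) id).
have conv0 (s : Rm) : 0 <= u a s * u b (t - s)%R by exact: mule_ge0.
have [t0|t0] := leP t 0%R.
  rewrite u_neg// mul0e integral0_eq// => s _.
  have [s0|s0] := leP s 0%R; first by rewrite u_neg// mul0e.
  by rewrite (u_neg b) ?mule0// subr_le0 (le_trans t0)// ltW.
rewrite -(ge0_integral_scale t0 mconv conv0) (u_pos _ t0).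
rewrite /eBeta [X in _ = _ * X]integral_mkcond -ge0_integralZl//; last 2 first.
- apply: emeasurable_funM; first exact: (measurableT_comp (mu_ a) (m_scale t)).
  exact: (measurableT_comp (mu_ b) (m_rev t t)).
- by rewrite lee_fin ltW.
rewrite -ge0_integralZl//; last 3 first.
- apply/(measurable_restrictT _ (measurable_itv _)); apply/measurable_EFinP.
  exact: measurable_omega.
- by move=> s _; rewrite patchE; case: ifP => // _; rewrite lee_fin omega_ge0.
- by rewrite lee_fin mulr_ge0 ?powR_ge0 ?expR_ge0.
apply: eq_integral => x _; rewrite patchE.
have [x0|x0] := leP x 0%R.
  rewrite u_neg ?mul0e ?mule0; last by rewrite pmulr_rle0.
  rewrite memNset ?mule0//= in_itv/=.
  by apply/negP; rewrite (le_gtF x0).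
have [x1|x1] := leP 1%R x.
  rewrite (u_neg b) ?mule0; last by rewrite subr_le0 ler_pMr.
  rewrite memNset ?mule0//= in_itv/=.
  by apply/negP; rewrite (le_gtF x1) andbF.
rewrite mem_set/=; last by rewrite in_itv/= x0.
have tx0 : (0 < t * x)%R by rewrite mulr_gt0.
have tx1 : (0 < t - t * x)%R by rewrite subr_gt0 gtr_pMr.
rewrite (u_pos _ tx0) (u_pos _ tx1) -!EFinM; congr EFin.
have -> : (t - t * x = t * (1 - x))%R by rewrite mulrBr mulr1.
rewrite !powRM ?subr_ge0 ?ltW// /omega.
have -> : (t `^ (a + b - 1) = t * t `^ (a - 1) * t `^ (b - 1))%R.
  rewrite -mulrA -[X in (_ = X * _)%R](powRr1 (ltW t0)) -!powRD ?(gt_eqF t0) ?implybT//.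
  by congr powR; ring.
have -> : (expR (- t) = expR (- (t * x)) * expR (- (t * (1 - x))))%R.
  by rewrite -expRD; congr expR; ring.
by ring.
Qed.

(** Integrate the convolution over the line in both orders: one order separates the two Gamma
    integrals after a translation, the other leaves the Beta factor. *)
Lemma eGamma_eBeta a b : eGamma a * eGamma b = eGamma (a + b)%R * eBeta a b.
Proof.
have mF : measurable_fun setT (fun z : plane => u a z.1 * u b (z.2 - z.1)%R).
  apply: emeasurable_funM; first exact: (measurableT_comp (mu_ a)).
  apply: (measurableT_comp (mu_ b)).
  by apply: measurable_funB; [exact: measurable_snd|exact: measurable_fst].
have F0 (z : plane) : 0 <= u a z.1 * u b (z.2 - z.1)%R by exact: mule_ge0.
transitivity (\int[leb]_s \int[leb]_t (u a s * u b (t - s)%R)).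
  rewrite !eGammaE -ge0_integralZr//; last exact: integral_ge0.
  apply: eq_integral => s _; rewrite ge0_integralZl//; last first.
    apply: (measurableT_comp (mu_ b)).
    exact: (@measurable_funB _ Rm R setT id (cst s)).
  by rewrite (ge0_integral_shift (- s)).
transitivity (\int[leb]_t \int[leb]_s (u a s * u b (t - s)%R)).
  exact: (@fubini_tonelli _ _ _ _ _ leb leb _ mF F0).
under eq_integral do rewrite convolution.
by rewrite ge0_integralZr//; [rewrite -eGammaE|exact: eBeta_ge0].
Qed.

End GammaBeta.

(** * Functional equation, finiteness and positivity of Gamma *)

Section GammaValues.
Variable R : realType.
Notation leb := (@lebesgue_measure R).
Local Notation Rm := (measurableTypeR R).
Implicit Types (a b x : R).

Lemma integral_powR_itv a x : 0 < a -> 0 < x < 1 ->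
  (\int[leb]_(t in `[x, 1%R]) (t `^ (a - 1))%:E = ((1 - x `^ a) / a)%:E)%E.
Proof.
move=> a0 /andP[x0 x1].
have dF (t : R) : 0 < t -> is_derive t (1 : R) (fun s => s `^ a / a) (t `^ (a - 1)).
  move=> t0; have := is_derive1_powR a t0 => h.
  apply: is_derive_eq; rewrite /GRing.scale/=; field.
  by rewrite gt_eqF.
have cF (p t : R) : 0 < t -> {for t, continuous (fun s : R => s `^ p)}.
  move=> t0; have := is_derive1_powR p t0 => h.
  by apply: differentiable_continuous; apply/derivable1_diffP.
rewrite (continuous_FTC2 (F := fun s => s `^ a / a))//.
- by rewrite powR1 -EFinB -mulrBl.
- apply: continuous_in_subspaceT => t /set_mem/=; rewrite in_itv/= => /andP[xt _].
  by apply: cF; exact: lt_le_trans xt.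
- have cG (t : R) : 0 < t -> {for t, continuous (fun s : R => s `^ a / a)}.
    by move=> t0; have := dF _ t0 => h; apply: differentiable_continuous;
      apply/derivable1_diffP.
  split.
  + move=> t; rewrite in_itv/= => /andP[xt _].
    by have := dF _ (lt_trans x0 xt) => h; exact: ex_derive.
  + by apply: cvg_at_right_filter; exact: cG.
  + by apply: cvg_at_left_filter; exact: cG.
move=> t; rewrite in_itv/= => /andP[xt _].
by rewrite derive1E; have := dF _ (lt_trans x0 xt) => h; exact: derive_val.
Qed.

Lemma eBeta_1 a : 0 < a -> eBeta a 1 = (a^-1)%:E.
Proof.
move=> a0.
(* [n.+2] keeps the left end strictly between 0 and 1, where the primitive of the power is
   available. *)
pose F (n : nat) : set Rm := `[n.+2%:R^-1, 1%R]%classic.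
have -> : eBeta a 1 = (\int[leb]_(t in `]0%R, 1%R]) (t `^ (a - 1))%:E)%E.
  rewrite -integral_itv_bndo_bndc; last first.
    by apply/measurable_EFinP; exact: measurable_powRl.
  by apply: eq_integral => t _; rewrite /omega subrr powRr0 mulr1.
have <- : \bigcup_n F n = (`]0%R, 1%R]%classic : set Rm).
  apply/seteqP; split => t /=.
    move=> [n _]; rewrite /F /= !in_itv/= => /andP[nt ->].
    by rewrite andbT (lt_le_trans _ nt).
  rewrite in_itv/= => /andP[t0 t1].
  have ti : 0 <= t^-1 by rewrite invr_ge0 ltW.
  have := archi_boundP ti.
  set N := Num.Def.archi_bound _ => h.
  exists N => //; rewrite /F /= in_itv/= t1 andbT.
  rewrite -[leRHS]invrK lef_pV2 ?posrE ?invr_gt0//.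
  by apply: ltW; apply: (lt_le_trans h); rewrite ler_nat ltnW.
have mF n : measurable (F n) by exact: measurable_itv.
have ndF : nondecreasing_seq F.
  apply/nondecreasing_seqP => n; apply/subsetPset => t; rewrite /F /= !in_itv/=.
  move=> /andP[h ->]; rewrite andbT; apply: le_trans h.
  by rewrite lef_pV2 ?posrE// ler_nat.
have mf n : measurable_fun (F n) (fun t : Rm => (t `^ (a - 1))%:E : \bar R).
  by apply/measurable_EFinP; exact: measurable_powRl.
have f0 n (t : Rm) : F n t -> (0 <= (t `^ (a - 1))%:E :> \bar R)%E.
  by rewrite lee_fin powR_ge0.
have c1 := ge0_nondecreasing_set_cvg_integral (mu := leb) ndF mF mf f0.
rewrite -(cvg_lim _ c1)//; apply/cvg_lim => //.
have -> : (fun n => \int[leb]_(t in F n) (t `^ (a - 1))%:E)%E =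
    (fun n => ((1 - (n.+2%:R^-1) `^ a) / a)%:E).
  apply/funext => n; rewrite integral_powR_itv// invr_gt0 ltr0n/=.
  by rewrite invf_lt1// ltr1n.
apply: cvg_EFin; first exact: nearW.
suff h : (n.+2%:R^-1 : R) `^ a @[n --> \oo] --> 0.
  have lim : (1 - (n.+2%:R^-1 : R) `^ a) / a @[n --> \oo] --> (1 - 0) / a.
    by apply: cvgM; [apply: cvgB => //; exact: cvg_cst|exact: cvg_cst].
  by move: lim; rewrite subr0 mul1r.
have /cvg_at_rightP := powR_cvg0 a0.
apply; split => [n|]; first by rewrite invr_gt0.
have := @cvg_harmonic R; rewrite /harmonic/= => h.
by move: h; rewrite -cvg_shiftS.
Qed.

Lemma eGamma_1 : eGamma (1 : R) = 1%E.
Proof.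
rewrite -(@integral_expRN R) -integral_itv_obnd_cbnd; last first.
  by apply/measurable_EFinP; exact: measurable_expRN.
by apply: eq_integral => t _; rewrite subrr powRr0 mul1r.
Qed.

(** The case b = 1 of the Beta relation, with B(a, 1) = 1 / a; it takes the place of an integration
    by parts. *)
Lemma eGammaS a : 0 < a -> eGamma (a + 1) = (a%:E * eGamma a)%E.
Proof.
move=> a0; have := eGamma_eBeta a 1; rewrite eGamma_1 mule1 eBeta_1// => ->.
by rewrite muleCA -EFinM divff ?mule1// gt_eqF.
Qed.

Let eGamma_nat n : (eGamma (n.+1%:R : R) < +oo)%E.
Proof.
elim: n => [|n IH]; first by rewrite eGamma_1 ltry.
rewrite -[n.+2]addn1 natrD eGammaS ?ltr0n//.
by rewrite lte_mul_pinfty// lee_fin ler0n.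
Qed.

(** For t at most 1 the power is at most 1, beyond it is at most [t ^ n]; so the integral is
    dominated by [eGamma 1] plus the value at [n.+1], finite by the functional equation. *)
Let eGamma_ge1_fin x : 1 <= x -> (eGamma x < +oo)%E.
Proof.
move=> x1; have [n xn] : exists n : nat, x < n%:R.
  by exists (Num.Def.archi_bound x); exact: (archi_boundP (le_trans ler01 x1)).
apply: (@le_lt_trans _ _ (eGamma (1 : R) + eGamma (n.+1%:R : R))%E); last first.
  apply: lte_add_pinfty; last exact: eGamma_nat.
  by rewrite eGamma_1 ltry.
have m (y : R) : measurable_fun (`]0%R, +oo[%classic : set Rm)
    (fun t : Rm => (t `^ (y - 1) * expR (- t))%:E : \bar R).
  by apply/measurable_EFinP; apply: measurable_funM;
    [exact: measurable_powRl|exact: measurable_expRN].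
have p (y t : R) : (0 <= (t `^ (y - 1) * expR (- t))%:E :> \bar R)%E.
  by rewrite lee_fin mulr_ge0 ?powR_ge0 ?expR_ge0.
rewrite /eGamma -ge0_integralD//; try exact: measurable_itv; try by move=> *; exact: p.
apply: ge0_le_integral => //; first by apply: emeasurable_funD; exact: m.
move=> t /=; rewrite in_itv/= andbT => t0; rewrite -EFinD lee_fin -mulrDl.
rewrite ler_wpM2r ?expR_ge0// subrr powRr0.
have [t1|t1] := leP t 1.
  have : t `^ (x - 1) <= t `^ 0 by apply: ger_powR; rewrite ?t0// subr_ge0.
  by rewrite powRr0 => /le_trans; apply; rewrite lerDl powR_ge0.
apply: (@le_trans _ _ (t `^ (n.+1%:R - 1))); last by rewrite lerDr.
apply: ler_powR; first exact: ltW.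
by rewrite lerD2r (le_trans (ltW xn))// ler_nat.
Qed.

Lemma eGamma_fin x : 0 < x -> (eGamma x < +oo)%E.
Proof.
move=> x0; have [x1|x1] := leP 1 x; first exact: eGamma_ge1_fin.
(* Below 1 the functional equation carries finiteness back from [x + 1]. *)
have h : (x%:E * eGamma x < +oo)%E.
  by rewrite -eGammaS//; apply: eGamma_ge1_fin; rewrite lerDr ltW.
rewrite ltNge; apply/negP => oo.
have e : eGamma x = +oo%E by apply/eqP; rewrite -leye_eq.
by move: h; rewrite e gt0_muley ?lte_fin// ltxx.
Qed.

Lemma eGamma_gt0 x : 0 < x -> (0 < eGamma x)%E.
Proof.
(* A lower bound of the integrand on [1, 2], whatever the sign of the exponent [x - 1]. *)
move=> x0; pose c : R := 2 `^ (- `|x - 1|) * expR (- 2).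
have c0 : 0 < c by rewrite mulr_gt0 ?powR_gt0 ?expR_gt0.
have D : (`[1%R, 2%R]%classic : set Rm) `<=` `]0%R, +oo[.
  by move=> t /=; rewrite !in_itv/= andbT => /andP[t1 _]; apply: lt_le_trans t1.
apply: (@lt_le_trans _ _ (\int[leb]_(t in `[1%R, 2%R]) c%:E)%E).
  rewrite integral_cst//=.
  rewrite lebesgue_measure_itv/= lte_fin.
  by rewrite ltr1n/= -EFinB -EFinM lte_fin mulr_gt0// subr_gt0 ltr1n.
have m (A : set Rm) : measurable_fun A
    (fun t : Rm => (t `^ (x - 1) * expR (- t))%:E : \bar R).
  by apply/measurable_EFinP; apply: measurable_funM;
    [exact: measurable_powRl|exact: measurable_expRN].
apply: (@le_trans _ _ (\int[leb]_(t in `[1%R, 2%R])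
    (t `^ (x - 1) * expR (- t))%:E)%E); last first.
  apply: ge0_subset_integral => //.
  by move=> t _; rewrite lee_fin mulr_ge0 ?powR_ge0 ?expR_ge0.
apply: ge0_le_integral => //; first by move=> t _; rewrite lee_fin ltW.
move=> t /=; rewrite in_itv/= => /andP[t1 t2]; rewrite lee_fin.
apply: ler_pM; rewrite ?powR_ge0 ?expR_ge0// ?ler_expR ?lerN2//.
apply: (@le_trans _ _ (t `^ (- `|x - 1|))).
  rewrite !powRN lef_pV2 ?posrE ?powR_gt0// ?(lt_le_trans _ t1)//.
  by apply: ge0_ler_powR => //; rewrite nnegrE ?ler0n//; exact: le_trans ler01 t1.
by apply: ler_powR => //; rewrite lerNl -normrN ler_norm.
Qed.

Lemma EFin_Gamma x : 0 < x -> (Gamma x)%:E = eGamma x.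
Proof.
by move=> x0; rewrite [Gamma x]/(fine (eGamma x)) fineK// ge0_fin_numE
  ?eGamma_fin ?eGamma_ge0.
Qed.

Lemma Gamma_gt0 x : 0 < x -> 0 < Gamma x.
Proof. by move=> x0; rewrite -lte_fin EFin_Gamma// eGamma_gt0. Qed.

Lemma pochhammerS a k : pochhammer a k.+1 = pochhammer a k * (a + k%:R).
Proof. by rewrite /pochhammer big_ord_recr. Qed.

Lemma pochhammer_gt0 a k : 0 < a -> 0 < pochhammer a k.
Proof. by move=> a0; apply: prodr_gt0 => i _; rewrite ltr_wpDr. Qed.

Lemma pochhammer1 k : pochhammer (1 : R) k = k`!%:R.
Proof.
elim: k => [|k IH]; first by rewrite /pochhammer big_ord0.
by rewrite pochhammerS IH factS natrM mulrC -natr1 addrC.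
Qed.

Lemma GammaDn x k : 0 < x -> Gamma (x + k%:R) = pochhammer x k * Gamma x.
Proof.
move=> x0; elim: k => [|k IH].
  by rewrite /pochhammer big_ord0 mul1r addr0.
have xk : 0 < x + k%:R by rewrite ltr_wpDr.
have xk1 : 0 < x + k%:R + 1 by rewrite addr_gt0.
have := eGammaS xk; rewrite -(EFin_Gamma xk) -(EFin_Gamma xk1) -EFinM => -[e].
by rewrite -natr1 addrA e IH pochhammerS mulrCA mulrA.
Qed.

Lemma eBeta_Gamma a b : 0 < a -> 0 < b ->
  eBeta a b = (Gamma a * Gamma b / Gamma (a + b))%:E.
Proof.
move=> a0 b0; have ab0 : 0 < a + b by rewrite addr_gt0.
have := eGamma_eBeta a b; rewrite -!EFin_Gamma// => h.
rewrite EFinM EFinM h muleC muleA -EFinM mulVf ?mul1e//.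
by rewrite gt_eqF// Gamma_gt0.
Qed.

End GammaValues.

(** * Measurability of quaternion-valued maps *)

Section QuaternionMeasurable.
Context d (T : measurableType d) (R : realType).
Implicit Types (D : set T) (F G : T -> quat R) (w : T -> R).

Definition qmeasurable D F := forall i, measurable_fun D (fun z => F z 0 i).

Lemma qmeasurable_cst D (q : quat R) : qmeasurable D (fun=> q).
Proof. by move=> i; exact: measurable_cst. Qed.

Lemma qmeasurableM D F G : qmeasurable D F -> qmeasurable D G ->
  qmeasurable D (fun z => F z * G z).
Proof.
move=> mF mG.
have h i j : measurable_fun D (fun z => F z 0 i * G z 0 j).
  exact: measurable_funM (mF i) (mG j).
apply: ord4P; under eq_fun do rewrite qcoordE.
- exact: measurable_funB (measurable_funB (measurable_funB (h 0 0) (h 1 1)) (h 2 2)) (h 3 3).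
- exact: measurable_funB (measurable_funD (measurable_funD (h 0 1) (h 1 0)) (h 2 3)) (h 3 2).
- exact: measurable_funD (measurable_funD (measurable_funB (h 0 2) (h 1 3)) (h 2 0)) (h 3 1).
- exact: measurable_funD (measurable_funB (measurable_funD (h 0 3) (h 1 2)) (h 2 1)) (h 3 0).
Qed.

Lemma qmeasurable_conj D F : qmeasurable D F -> qmeasurable D (fun z => qconj (F z)).
Proof.
move=> mF; apply: ord4P; under eq_fun do rewrite qconj_coord; first exact: mF.
all: exact: measurable_funN (mF _).
Qed.

Lemma qmeasurableZ D w F : measurable_fun D w -> qmeasurable D F ->
  qmeasurable D (fun z => w z *: F z).
Proof.
move=> mw mF i; under eq_fun do rewrite qscale_coord.
exact: measurable_funM mw (mF i).
Qed.

Lemma qmeasurableX D F n : qmeasurable D F -> qmeasurable D (fun z => F z ^+ n).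
Proof.
move=> mF; elim: n => [|n IH]; first by move=> i; exact: measurable_cst.
have -> : (fun z => F z ^+ n.+1) = (fun z => F z * F z ^+ n).
  by apply/funext => z; rewrite exprS.
exact: qmeasurableM.
Qed.

Lemma qmeasurable_sum D (F : nat -> T -> quat R) n :
  (forall k, qmeasurable D (F k)) ->
  qmeasurable D (fun z => \sum_(0 <= k < n) F k z).
Proof.
move=> mF i; under eq_fun do rewrite summxE.
by apply: measurable_sum => k; exact: mF.
Qed.

Lemma qmeasurable_cvg D (F : nat -> T -> quat R) G :
  (forall n, qmeasurable D (F n)) ->
  (forall z, D z -> F n z @[n --> \oo] --> G z) -> qmeasurable D G.
Proof.
move=> mF FG i; apply: (measurable_fun_cvg (fun n => mF n i)) => z Dz.
by have /quat_cvgP := FG z Dz; exact.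
Qed.

Lemma measurable_sqr_qabs D F : qmeasurable D F ->
  measurable_fun D (fun z => qabs (F z) ^+ 2).
Proof.
move=> mF; under eq_fun do rewrite sqr_qabs.
by do 3![apply: measurable_funD; last exact: measurable_funX];
  exact: measurable_funX.
Qed.

End QuaternionMeasurable.

Lemma qint_invariant (R : realType)
    (T : measurableTypeR R * measurableTypeR R -> measurableTypeR R * measurableTypeR R)
    (D : set (measurableTypeR R * measurableTypeR R))
    (F : measurableTypeR R * measurableTypeR R -> quat R) :
  measurable_fun setT T -> area_preserving T -> measurable D ->
  (forall z, D (T z) <-> D z) -> qmeasurable D F ->
  qint (@area R) D (fun z => F (T z)) = qint (@area R) D F.
Proof.
move=> mT aT mD DT mF; apply/rowP => i; rewrite !qint_coord /Rintegral.
by rewrite (area_invariant mT aT mD DT (mF i)).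
Qed.

(** * Moments of the radial weight *)

Section Moments.
Variables (R : realType) (beta eta : R).
Hypotheses (beta0 : 0 < beta) (eta0 : 0 < eta).
Notation leb := (@lebesgue_measure R).
Local Notation Rm := (measurableTypeR R).
Local Notation plane := (measurableTypeR R * measurableTypeR R)%type.
Local Notation area := (@area R).
Local Notation W := (slice_weight beta eta).

(** [r] bounds the squared modulus: the radius is its square root. *)
Definition disc (r : R) : set plane := [set z | sqnorm z < r].

Lemma measurable_disc r : measurable (disc r).
Proof.
have -> : disc r = setT `&` (@sqnorm R) @^-1` `]-oo, r[%classic.
  by rewrite setTI; apply/seteqP; split => z /=; rewrite in_itv.
by apply: measurable_sqnorm => //; exact: measurable_itv.
Qed.

Lemma slice_ball_disc (I : quat R) : qsphere I -> slice_ball I = disc 1.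
Proof.
by move=> hI; apply/seteqP; split => z; rewrite /slice_ball /disc /= qball_slice.
Qed.

Lemma weight_ge0 (z : plane) : 0 <= W z.
Proof. exact: omega_ge0. Qed.

Lemma measurable_weight (D : set plane) : measurable_fun D (W : plane -> R).
Proof.
apply: (measurable_funS measurableT) => //.
exact: (measurableT_comp (@measurable_omega R beta eta setT) (@measurable_sqnorm R)).
Qed.

Lemma integral_moment (k : nat) :
  (\int[area]_(z in disc 1) (sqnorm z ^+ k * W z)%:E =
  (pi * (Gamma (beta + k%:R) * Gamma eta / Gamma (beta + k%:R + eta)))%:E)%E.
Proof.
have bk : 0 < beta + k%:R by rewrite ltr_wpDr.
rewrite EFinM -eBeta_Gamma// integral_mkcond.
pose f : Rm -> \bar R :=
  (fun t => (t ^+ k * omega beta eta t)%:E) \_ (`[0, 1[%classic : set Rm).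
transitivity (\int[area]_z f (sqnorm z))%E.
  apply: eq_integral => z _; rewrite /f !patchE.
  have -> : (z \in disc 1) = (sqnorm z \in (`[0, 1[%classic : set Rm)).
    apply/idP/idP; rewrite !inE /disc /= in_itv/= sqnorm_ge0//.
  by [].
have mo (D : set Rm) : measurable_fun D
    (fun t : Rm => (t ^+ k * omega beta eta t)%:E : \bar R).
  apply/measurable_EFinP; apply: measurable_funM; last exact: measurable_omega.
  by apply: measurable_funX; exact: measurable_id.
have mf : measurable_fun setT f.
  by apply/(measurable_restrictT _ (measurable_itv _)); exact: mo.
have f0 (t : R) : 0 <= t -> (0 <= f t)%E.
  move=> t0; rewrite /f patchE; case: ifP => // _.
  by rewrite lee_fin mulr_ge0 ?omega_ge0// exprn_ge0.
rewrite (ge0_area_polar (measurable_funS measurableT (@subsetT _ _) mf) f0).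
congr (_ * _)%E.
rewrite -integral_mkcondr /=.
have -> : `[0%R, +oo[%classic `&` `[0%R, 1%R[%classic = (`[0%R, 1%R[%classic : set Rm).
  by apply: setIidr => t /=; rewrite !in_itv/= andbT => /andP[].
(* Drops the null endpoint 0: the powers of t are merged for t > 0, and [eBeta] is taken over the
   open interval. *)
rewrite -integral_itv_obnd_cbnd; last exact: mo.
apply: eq_integral => t; rewrite inE/= in_itv/= => /andP[t0 _]; congr EFin.
rewrite /omega mulrA; congr (_ * _).
by rewrite -powR_mulrn ?ltW// -powRD ?(gt_eqF t0) ?implybT//; congr powR; ring.
Qed.

Lemma integrable_moment (k : nat) :
  area.-integrable (disc 1) (fun z => (sqnorm z ^+ k * W z)%:E).
Proof.
apply/integrableP; split.
  apply/measurable_EFinP; apply: measurable_funM; last exact: measurable_weight.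
  apply: measurable_funX.
  exact: (measurable_funS measurableT (@subsetT _ _) (@measurable_sqnorm R)).
under eq_integral => z _.
  rewrite gee0_abs; last first.
    by rewrite lee_fin mulr_ge0 ?weight_ge0// exprn_ge0// sqnorm_ge0.
  over.
by rewrite integral_moment ltry.
Qed.

Lemma integrable_weight : area.-integrable (disc 1) (fun z => (W z)%:E).
Proof.
apply: eq_integrable (integrable_moment 0); first exact: measurable_disc.
by move=> z _; rewrite expr0 mul1r.
Qed.

End Moments.

(** * Orthogonality of the monomials on discs *)

Section Orthogonality.
Variables (R : realType) (beta eta : R) (I : quat R).
Hypotheses (beta0 : 0 < beta) (eta0 : 0 < eta) (hI : qsphere I).
Local Notation plane := (measurableTypeR R * measurableTypeR R)%type.
Local Notation area := (@area R).
Local Notation W := (slice_weight beta eta).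
Local Notation zq := (fun z : plane => slice_pt I z.1 z.2).

Lemma qmeasurable_slice (D : set plane) : qmeasurable D zq.
Proof.
move=> i; apply: (measurable_funS measurableT) => //.
rewrite /slice_pt; under eq_fun do rewrite qadd_coord !qscale_coord.
by apply: measurable_funD; apply: measurable_funM => //; exact: measurable_cst.
Qed.

Lemma sqr_qabs_zq (z : plane) : qabs (zq z) ^+ 2 = sqnorm z.
Proof. exact: sqr_qabs_slice. Qed.

Lemma qabs_zq_lt1 (z : plane) : disc 1 z -> qabs (zq z) < 1.
Proof. by rewrite /disc /= -sqr_qabs_zq expr_lt1// qabs_ge0. Qed.

Let mD (r : R) : measurable (disc r). Proof. exact: measurable_disc. Qed.

Lemma disc_sub (r : R) : r <= 1 -> disc r `<=` disc 1.
Proof. by move=> r1 z /lt_le_trans; apply. Qed.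

Lemma qintegrable_weight (D : set plane) (F : plane -> quat R) (B : R) :
  measurable D -> D `<=` disc 1 -> qmeasurable D F ->
  (forall z, D z -> qabs (F z) <= B) ->
  qintegrable area D (fun z => W z *: F z).
Proof.
move=> mD' D1 mF FB.
apply: (qintegrable_le (g := fun z => B * W z)) => //.
- by apply: qmeasurableZ => //; exact: measurable_weight.
- apply: integrableS D1 _ => //.
  have := integrableZl (mD 1) B (integrable_weight beta0 eta0).
  by apply: eq_integrable => // z _; rewrite -EFinM.
- move=> z Dz; rewrite qabsZ ger0_norm ?weight_ge0// mulrC.
  by rewrite ler_wpM2r ?weight_ge0// FB.
Qed.

Let mono k n (z : plane) : quat R := qconj (zq z ^+ k) * zq z ^+ n.

Let mono_measurable D k n : qmeasurable D (mono k n).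
Proof.
apply: qmeasurableM; last by apply: qmeasurableX; exact: qmeasurable_slice.
by apply/qmeasurable_conj/qmeasurableX; exact: qmeasurable_slice.
Qed.

Let mono_le1 k n z : disc 1 z -> qabs (mono k n z) <= 1.
Proof.
move=> /qabs_zq_lt1/ltW z1; rewrite qabsM qabs_conj !qabsX -[leRHS]mulr1.
by rewrite ler_pM ?exprn_ge0 ?qabs_ge0// exprn_ile1 ?qabs_ge0.
Qed.

Let mono_int r k n : r <= 1 -> qintegrable area (disc r) (fun z => W z *: mono k n z).
Proof.
move=> r1; apply: (qintegrable_weight (B := 1)) => //; first exact: disc_sub.
by move=> z /(disc_sub r1); exact: mono_le1.
Qed.

Let zq_rotation (t : R) z :
  zq (plane_map (cos t) (- sin t) (sin t) (cos t) z) = cis I t * zq z.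
Proof.
rewrite /cis slice_ptM// /plane_map/=; congr (slice_pt I _ _).
  by rewrite mulNr.
by rewrite addrC.
Qed.

Let sqnorm_rotation (t : R) z :
  sqnorm (plane_map (cos t) (- sin t) (sin t) (cos t) z) = sqnorm z.
Proof. by rewrite -!sqr_qabs_zq zq_rotation qabsM qabs_cis// mul1r. Qed.

Let disc_rotation r (t : R) z :
  disc r (plane_map (cos t) (- sin t) (sin t) (cos t) z) <-> disc r z.
Proof. by rewrite /disc /= sqnorm_rotation. Qed.

Let weighted_mono_measurable r k n :
  qmeasurable (disc r) (fun z : plane => W z *: mono k n z).
Proof.
exact: (qmeasurableZ (measurable_weight beta eta (D := disc r)) (@mono_measurable (disc r) k n)).
Qed.

(* Rotating by pi / (2 (n - k)) multiplies the integrand by I. *)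
Let ortho_lt r k n : r <= 1 -> (k < n)%N ->
  qint area (disc r) (fun z => W z *: mono k n z) = 0.
Proof.
move=> r1 kn; pose m : R := (n - k)%:R.
have m1 : 1 <= m by rewrite ler1n subn_gt0.
have m0 : 0 < m by exact: lt_le_trans m1.
pose t := pi / (2 * m); pose T := plane_map (cos t) (- sin t) (sin t) (cos t).
have t0 : 0 < t by rewrite divr_gt0 ?pi_gt0 ?mulr_gt0.
(* With t strictly between 0 and pi the sine is nonzero, as the decomposition into shears
   demands. *)
have tpi : t < pi.
  by rewrite ltr_pdivrMr ?mulr_gt0// ltr_pMr ?pi_gt0//; lra.
have sint : sin t != 0 by rewrite gt_eqF// sin_gt0_pi// t0 tpi.
have eI : cis I t ^+ (n - k) = I.
  rewrite cisMn// -/m -[RHS](cis_pihalf I); congr (cis I _).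
  by rewrite /t; field; exact: lt0r_neq0.
have monoT z : W (T z) *: mono k n (T z) = I * (W z *: mono k n z).
  have -> : W (T z) = W z.
    rewrite /slice_weight; congr omega; exact: sqnorm_rotation.
  rewrite -scalerAr; congr (_ *: _); rewrite /mono zq_rotation.
  have sz : on_slice I (zq z) by exists z.1, z.2.
  have cz j : (cis I t * zq z) ^+ j = cis I t ^+ j * zq z ^+ j.
    by apply: exprMn_comm; exact: on_sliceC (on_slice_cis I t) sz.
  have zI : qconj (zq z ^+ k) * I = I * qconj (zq z ^+ k).
    have : GRing.comm I (qconj (zq z)).
      have sI : on_slice I I by exists 0, 1; rewrite /slice_pt scale0r add0r scale1r.
      exact: on_sliceC sI (on_slice_conj hI sz).
    by rewrite qconjX => /(commrX k).
  rewrite !cz qconjM -{1}(subnKC (ltnW kn)) exprD !mulrA -zI.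
  congr (_ * _); rewrite -!mulrA; congr (_ * _).
  by rewrite mulrA qconjMl qabsX qabs_cis// !expr1n scale1r mul1r.
have E : qint area (disc r) (fun z => W z *: mono k n z) =
    I * qint area (disc r) (fun z => W z *: mono k n z).
  rewrite -[RHS]qint_mull//; last exact: mono_int.
  have rot := area_preserving_rotation (cos2Dsin2 t) sint.
  have mT : measurable_fun setT T by exact: measurable_plane_map.
  have dT z : disc r (T z) <-> disc r z by exact: disc_rotation.
  rewrite -(@qint_invariant R T (disc r) (fun z => W z *: mono k n z) mT rot
    (mD r) dT (@weighted_mono_measurable r k n)).
  by apply: eq_qint => z _; rewrite monoT.
(* The integral equals [I] times itself, and [1 - I] is nonzero because 1 is not a square root of
   -1. *)
apply: (@quat_mulf_eq0 _ (1 - I)); first by rewrite mulrBl mul1r -E subrr.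
rewrite subr_eq0; apply/eqP => I1; have := hI.
rewrite /qsphere/= -I1 expr1n => /eqP; rewrite -addr_eq0 -mulr2n -scaler_nat.
by rewrite scaler_eq0 oner_eq0 pnatr_eq0.
Qed.

Lemma qint_monomials r k n : r <= 1 -> k != n ->
  qint area (disc r) (fun z => W z *: (qconj (zq z ^+ k) * zq z ^+ n)) = 0.
Proof.
move=> r1; rewrite neq_ltn => /orP[kn|nk]; first exact: ortho_lt.
rewrite -[LHS]qconjK -qint_conj//; last exact: mono_int.
rewrite -[RHS]qconj0; congr qconj; rewrite -[RHS](ortho_lt r1 nk).
by apply: eq_qint => z _; rewrite qconjZ qconjM qconjK.
Qed.

Lemma qint_monomial r k :
  qint area (disc r) (fun z => W z *: (qconj (zq z ^+ k) * zq z ^+ k)) =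
  qint area (disc r) (fun z => (sqnorm z ^+ k * W z)%:A).
Proof.
apply: eq_qint => z _.
by rewrite qconjMl qabsX exprAC sqr_qabs_zq scalerA mulrC.
Qed.

End Orthogonality.

(** * Geometric majorants of series *)

Section SeriesTail.
Variable R : realType.

Lemma geometric_tail (q : R) (m N : nat) : 0 <= q < 1 ->
  \sum_(m <= k < N) q ^+ k <= q ^+ m / (1 - q).
Proof.
move=> /andP[q0 q1]; have q10 : 0 < 1 - q by rewrite subr_gt0.
rewrite ler_pdivlMr//; have [mN|Nm] := leqP m N; last first.
  by rewrite big_geq ?(ltnW Nm)// mul0r exprn_ge0.
rewrite -(subnKC mN); set j := (N - m)%N.
suff -> : (\sum_(m <= k < m + j) q ^+ k) * (1 - q) = q ^+ m - q ^+ (m + j).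
  by rewrite gerBl exprn_ge0.
elim: j => [|j IH]; first by rewrite addn0 big_geq// mul0r subrr.
by rewrite addnS big_nat_recr ?leq_addr//= mulrDl IH exprS; ring.
Qed.

Lemma series_tail (u : nat -> quat R) (l : quat R) (C q : R) (N : nat) :
  0 <= q < 1 -> (forall n, qabs (u n) <= C * q ^+ n) ->
  series u @ \oo --> l -> qabs (l - series u N) <= C / (1 - q) * q ^+ N.
Proof.
move=> q01 uq ul; have /andP[q0 q1] := q01.
have C0 : 0 <= C by have := uq 0; rewrite expr0 mulr1; apply: le_trans; exact: qabs_ge0.
have cv : (series u n - series u N) @[n --> \oo] --> l - series u N.
  by apply: quat_cvgB => //; exact: cvg_cst.
apply: (cvgr_to_le (qabs_cvg cv)); near=> n.
have Nn : (N <= n)%N by near: n; exact: nbhs_infty_ge.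
have -> : series u n - series u N = \sum_(N <= k < n) u k.
  rewrite /series/= (@big_cat_nat _ _ _ N 0 n)//=.
  by rewrite addrAC subrr add0r.
apply: (@le_trans _ _ (\sum_(N <= k < n) C * q ^+ k)).
  apply: (big_ind2 (fun x y => qabs x <= y)) => //; first by rewrite qabs0.
  by move=> x1 x2 y1 y2 h1 h2; apply: le_trans (qabsD _ _) _; exact: lerD.
rewrite -mulr_sumr -mulrA ler_wpM2l// mulrC.
exact: geometric_tail.
Unshelve. all: by end_near.
Qed.

(** The ratio test in explicit form: induction on K shifts the sequence past its irregular
    beginning, which only enlarges the constant. *)
Lemma ratio_geometric (u : nat -> R) (lam : R) (K : nat) : 0 < lam ->
  (forall k, 0 <= u k) -> (forall k, (K <= k)%N -> u k.+1 <= lam * u k) ->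
  exists C, forall k, u k <= C * lam ^+ k.
Proof.
move=> l0; elim: K u => [|K IH] u u0 uK.
  exists (u 0) => k; elim: k => [|k IHk]; first by rewrite expr0 mulr1.
  apply: le_trans (uK k isT) _; rewrite exprS mulrCA ler_wpM2l//.
  exact: ltW.
have [C CP] := IH (fun k => u k.+1) (fun k => u0 k.+1) (fun k h => uK k.+1 h).
exists (u 0 + C / lam) => -[|k].
  rewrite expr0 mulr1 lerDl divr_ge0 ?(ltW l0)//.
  by have := CP 0; rewrite expr0 mulr1; apply: le_trans.
apply: le_trans (CP k) _; rewrite exprS mulrDl -lerBlDr.
have -> : C * lam ^+ k - C / lam * (lam * lam ^+ k) = 0.
  by field; rewrite gt_eqF.
by rewrite !mulr_ge0 ?exprn_ge0 ?(ltW l0).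
Qed.

End SeriesTail.

(** * Integrability of bounded maps against a Bergman function *)

Section BergmanFunction.
Variables (R : realType) (beta eta : R) (I : quat R).
Hypotheses (beta0 : 0 < beta) (eta0 : 0 < eta) (hI : qsphere I).
Local Notation plane := (measurableTypeR R * measurableTypeR R)%type.
Local Notation area := (@area R).
Local Notation W := (slice_weight beta eta).
Local Notation zq := (fun z : plane => slice_pt I z.1 z.2).

Let mD (r : R) : measurable (disc r). Proof. exact: measurable_disc. Qed.

Variable f : quat R -> quat R.
Hypothesis hf : A2slice I beta eta f.

Let fz (z : plane) : quat R := f (zq z).

Lemma A2slice_measurable : qmeasurable (disc 1) fz.
Proof. by case: hf => _ [mf _]; rewrite -(slice_ball_disc hI). Qed.

(** Since x <= 1 + x^2, this integrable function dominates the weight times the modulus of f; it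
    plays the part of Cauchy-Schwarz. *)
Definition A2slice_majorant (z : plane) : R := W z * (1 + qabs (fz z) ^+ 2).

Lemma integrable_majorant :
  area.-integrable (disc 1) (fun z => (A2slice_majorant z)%:E).
Proof.
have iW := integrable_weight beta0 eta0.
have m2 : measurable_fun (disc 1) (fun z => qabs (fz z) ^+ 2 * W z).
  exact: measurable_funM (measurable_sqr_qabs A2slice_measurable)
    (measurable_weight beta eta (D := disc 1)).
have i2 : area.-integrable (disc 1) (fun z => (qabs (fz z) ^+ 2 * W z)%:E).
  apply/integrableP; split; first exact/measurable_EFinP.
  under eq_integral => z _.
    rewrite gee0_abs; last by rewrite lee_fin mulr_ge0 ?weight_ge0 ?sqr_ge0.
    over.
  by case: hf => _ [_]; rewrite (slice_ball_disc hI).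
have := integrableD (mD 1) iW i2.
apply: eq_integrable => //.
move=> z _ /=; rewrite -EFinD; congr EFin.
by rewrite /A2slice_majorant mulrDr mulr1 [W z * _]mulrC.
Qed.

Lemma majorant_ge z : W z * qabs (fz z) <= A2slice_majorant z.
Proof.
rewrite ler_wpM2l ?weight_ge0//.
have [h|h] := leP (qabs (fz z)) 1.
  by apply: (le_trans h); rewrite lerDl sqr_ge0.
apply: (@le_trans _ _ (qabs (fz z) ^+ 2)); last by rewrite lerDr.
by rewrite expr2 ler_peMr ?qabs_ge0// ltW.
Qed.

Let pair_le (h : plane -> quat R) (B : R) z : qabs (h z) <= B ->
  qabs (W z *: (h z * fz z)) <= B * A2slice_majorant z.
Proof.
move=> hB; rewrite qabsZ ger0_norm ?weight_ge0// qabsM mulrCA.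
apply: (@le_trans _ _ (B * (W z * qabs (fz z)))).
  by rewrite ler_wpM2r// mulr_ge0 ?weight_ge0 ?qabs_ge0.
by rewrite ler_wpM2l ?majorant_ge// (le_trans (qabs_ge0 _) hB).
Qed.

Let majorantZ (B : R) :
  area.-integrable (disc 1) (EFin \o (fun z => B * A2slice_majorant z)).
Proof.
exact: eq_integrable (integrableZl (mD 1) B integrable_majorant).
Qed.

Lemma qintegrable_pair (h : plane -> quat R) (B : R) :
  qmeasurable (disc 1) h -> (forall z, disc 1 z -> qabs (h z) <= B) ->
  qintegrable area (disc 1) (fun z => W z *: (h z * fz z)).
Proof.
move=> mh hB; apply: (qintegrable_le (mD 1) _ (majorantZ B)).
  apply: (qmeasurableZ (measurable_weight beta eta (D := disc 1))).
  exact: qmeasurableM mh A2slice_measurable.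
by move=> z Dz; apply: pair_le; exact: hB.
Qed.

Lemma qabs_qint_pair (h : plane -> quat R) (B : R) :
  qmeasurable (disc 1) h -> (forall z, disc 1 z -> qabs (h z) <= B) ->
  qabs (qint area (disc 1) (fun z => W z *: (h z * fz z))) <=
  2 * (B * \int[area]_(z in disc 1) A2slice_majorant z).
Proof.
move=> mh hB; rewrite -RintegralZl//; last exact: integrable_majorant.
apply: (qabs_qint (mD 1) (qintegrable_pair mh hB) (majorantZ B)).
by move=> z Dz; apply: pair_le; exact: hB.
Qed.

End BergmanFunction.

(** * Passage from smaller discs to the unit disc *)

Section DiscLimit.
Variable R : realType.
Local Notation plane := (measurableTypeR R * measurableTypeR R)%type.
Local Notation area := (@area R).

Lemma integral_disc_lim (g : plane -> R) :
  area.-integrable (disc 1) (fun z => (g z)%:E) ->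
  (forall r, 0 < r < 1 -> \int[area]_(z in disc r) g z = 0) ->
  \int[area]_(z in disc 1) g z = 0.
Proof.
move=> ig g0.
have mD (r : R) : measurable (disc r) by exact: measurable_disc.
(* Halving the harmonic term keeps [rn 0] positive. *)
pose rn (n : nat) : R := 1 - n.+1%:R^-1 / 2.
have rn01 n : 0 < rn n < 1.
  have h1 : 0 < n.+1%:R^-1 :> R by rewrite invr_gt0.
  have h2 : n.+1%:R^-1 <= 1 :> R by rewrite invf_le1 ?ler1n.
  by rewrite /rn; move: (n.+1%:R^-1) h1 h2 => x h1 h2; apply/andP; split; lra.
pose G (z : plane) : \bar R := (g z)%:E.
pose f_ (n : nat) : plane -> \bar R := G \_ (disc (rn n)).
have If n : (\int[area]_(z in disc 1) f_ n z = 0)%E.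
  rewrite /f_ -integral_mkcondr setIidr; last first.
    by apply: disc_sub; apply/ltW; case/andP: (rn01 n).
  have fin : (\int[area]_(z in disc (rn n)) G z)%E \is a fin_num.
    apply: integrable_fin_num => //.
    apply: (integrableS (mD 1)) ig => //.
    by apply: disc_sub; apply/ltW; case/andP: (rn01 n).
  by rewrite -(fineK fin); congr EFin; exact: g0.
have mG : measurable_fun (disc 1) G by exact: measurable_int ig.
have mf n : measurable_fun (disc 1) (f_ n).
  apply/(measurable_restrict G (mD (rn n)) (mD 1)).
  by apply: (measurable_funS (mD 1)) => //; apply: subIsetl.
have cvf : {ae area, forall z, disc 1 z -> f_ ^~ z @ \oo --> G z}.
  apply: aeW => z Dz; apply: cvg_near_cst.
  have e0 : 0 < 1 - sqnorm z by rewrite subr_gt0.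
  near=> n; rewrite /f_ patchE ifT// inE /disc/= /rn.
  have : n.+1%:R^-1 < 1 - sqnorm z.
    by near: n; exact: (near_infty_natSinv_lt (PosNum e0)).
  have : 0 < n.+1%:R^-1 :> R by rewrite invr_gt0.
  by move: (n.+1%:R^-1) => x h1 h2; lra.
have ign : area.-integrable (disc 1) (fun z => `|G z|%E).
  exact: integrable_abse ig.
have bnd : {ae area, forall z n, disc 1 z -> (`|f_ n z| <= `|G z|)%E}.
  apply: aeW => z n Dz; rewrite /f_ patchE; case: ifP => // _.
  by rewrite abse0 abse_ge0.
have [_ _ lim] := dominated_convergence (mD 1) mf mG cvf ign bnd.
rewrite /Rintegral.
suff -> : (\int[area]_(z in disc 1) (g z)%:E = 0)%E by [].
have := cvg_lim _ lim; move=> <- //.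
by under eq_fun do rewrite If; rewrite lim_cst.
Unshelve. all: by end_near.
Qed.

Lemma qint_disc_lim (F : plane -> quat R) : qintegrable area (disc 1) F ->
  (forall r, 0 < r < 1 -> qint area (disc r) F = 0) -> qint area (disc 1) F = 0.
Proof.
move=> iF F0; apply/rowP => i; rewrite qint_coord mxE.
apply: integral_disc_lim (iF i) _ => r r01.
by rewrite -qint_coord F0// mxE.
Qed.

End DiscLimit.

(** * Coefficients as pairings with monomials *)

Section Coefficients.
Variables (R : realType) (beta eta : R) (I : quat R).
Hypotheses (beta0 : 0 < beta) (eta0 : 0 < eta) (hI : qsphere I).
Local Notation plane := (measurableTypeR R * measurableTypeR R)%type.
Local Notation area := (@area R).
Local Notation W := (slice_weight beta eta).
Local Notation zq := (fun z : plane => slice_pt I z.1 z.2).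

(** This is pi gamma_k, the squared norm of z^k. *)
Definition slice_moment (k : nat) : R :=
  pi * (Gamma (beta + k%:R) * Gamma eta / Gamma (beta + k%:R + eta)).

Let mD (r : R) : measurable (disc r). Proof. exact: measurable_disc. Qed.

Lemma qint_real (D : set plane) (g : plane -> R) : measurable D ->
  area.-integrable D (EFin \o g) ->
  qint area D (fun z => (g z)%:A) = (\int[area]_(z in D) g z)%:A.
Proof.
move=> mD' ig; apply/rowP => i; rewrite qscale_coord qint_coord.
rewrite -RintegralZr//.
by apply: eq_Rintegral => z _; rewrite qscale_coord.
Qed.

Lemma conj_power_measurable (D : set plane) k :
  qmeasurable D (fun z => qconj (zq z ^+ k)).
Proof. exact: qmeasurable_conj (qmeasurableX k (qmeasurable_slice I (D := D))). Qed.

Lemma conj_power_le1 k z : disc 1 z -> qabs (qconj (zq z ^+ k)) <= 1.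
Proof.
move=> Dz; rewrite qabs_conj qabsX exprn_ile1 ?qabs_ge0//.
exact/ltW/(qabs_zq_lt1 hI).
Qed.

Lemma qint_monomial_coef (k : nat) (a : quat R) :
  qint area (disc 1) (fun z => W z *: (qconj (zq z ^+ k) * zq z ^+ k) * a) =
  slice_moment k *: a.
Proof.
rewrite qint_mulr//; last first.
  apply: (qintegrable_weight beta0 eta0 (B := 1)) => //.
    exact: qmeasurableM (conj_power_measurable (D := disc 1) k)
      (qmeasurableX k (qmeasurable_slice I (D := disc 1))).
  move=> z Dz; rewrite qabsM -[leRHS]mulr1.
  by rewrite ler_pM ?qabs_ge0// -?[qabs (zq z ^+ k)]qabs_conj conj_power_le1.
rewrite (qint_monomial beta eta hI) qint_real//; last first.
  exact: (integrable_moment beta0 eta0 k).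
by rewrite /Rintegral integral_moment//= -scalerAl mul1r.
Qed.

Variables (f : quat R -> quat R) (c : nat -> quat R).
Hypothesis hf : A2slice I beta eta f.
Hypothesis cM : forall r, 0 < r < 1 -> exists M, forall n, qabs (c n) * r ^+ n <= M.
Hypothesis cf : forall q, qball q -> series (fun n => q ^+ n * c n) @ \oo --> f q.

(** The coefficients of f minus its term of degree k. All its terms are orthogonal to z^k, so the
    claim reduces to the vanishing of one integral. *)
Let c' k n := if n == k then 0 else c n.

Let c'_series k (q : quat R) : qball q ->
  series (fun n => q ^+ n * c' k n) @ \oo --> f q - q ^+ k * c k.
Proof.
move=> qb; have E n : series (fun n => q ^+ n * c' k n) n =
    series (fun n => q ^+ n * c n) n - (if (k < n)%N then q ^+ k * c k else 0).
  elim: n => [|n]; first by rewrite /series/= !big_geq// subr0.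
  rewrite /series/= => IH; rewrite !big_nat_recr//= IH /c' ltnS [(k <= n)%N]leq_eqVlt [n == k]eq_sym.
  have [->|nk] := eqVneq k n.
    by rewrite ltnn mulr0 addr0 subr0 addrK.
  by rewrite addrAC.
have -> : series (fun n => q ^+ n * c' k n) =
    (fun n => series (fun n => q ^+ n * c n) n - (if (k < n)%N then q ^+ k * c k else 0)).
  exact/funext.
apply: quat_cvgB; first exact: cf.
apply: cvg_near_cst; near=> n; rewrite ifT//.
by near: n; exact: nbhs_infty_gt.
Unshelve. all: by end_near.
Qed.

Let c'_bound k (r : R) : 0 < r < 1 -> exists C q, 0 <= q < 1 /\
  forall z, disc r z -> forall n, qabs (zq z ^+ n * c' k n) <= C * q ^+ n.
Proof.
(* [s] is the actual radius of [disc r]; the coefficients are bounded at the midpoint of [s] and 1,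
   which leaves a geometric ratio below 1. *)
move=> /andP[r0 r1]; pose s := Num.sqrt r.
have s0 : 0 < s by rewrite sqrtr_gt0.
have s1 : s < 1 by rewrite -sqrtr1 ltr_sqrt.
have [M hM] : exists M, forall n, qabs (c n) * ((s + 1) / 2) ^+ n <= M.
  by apply: cM; apply/andP; split; lra.
pose rho := (s + 1) / 2; have rho0 : 0 < rho by rewrite /rho; lra.
have srho : s < rho by rewrite /rho; lra.
exists M, (s / rho); split.
  by rewrite divr_ge0 ?ltW//= ltr_pdivrMr ?mul1r.
move=> z Dz n; have zs : qabs (zq z) <= s.
  rewrite -(@ler_pXn2r _ 2)// ?nnegrE ?qabs_ge0 ?(ltW s0)//.
  by rewrite (sqr_qabs_zq hI) sqr_sqrtr ?(ltW r0)// ltW.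
have c'n : qabs (c' k n) <= qabs (c n).
  by rewrite /c'; case: eqP => // _; rewrite qabs0 qabs_ge0.
rewrite qabsM qabsX expr_div_n mulrCA.
apply: (@le_trans _ _ (s ^+ n * qabs (c n))).
  by rewrite ler_pM ?exprn_ge0 ?qabs_ge0// lerXn2r ?nnegrE ?qabs_ge0// ltW.
rewrite ler_wpM2l ?exprn_ge0 ?(ltW s0)// ler_pdivlMr ?exprn_gt0//.
Qed.

Let F k z := W z *: (qconj (zq z ^+ k) * (f (zq z) - zq z ^+ k * c k)).

Let pair_int k : qintegrable area (disc 1)
  (fun z => W z *: (qconj (zq z ^+ k) * f (zq z))).
Proof.
apply: (qintegrable_pair beta0 eta0 hI hf (B := 1)).
  exact: conj_power_measurable.
exact: conj_power_le1.
Qed.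

Let monomial_int k n (r : R) : r <= 1 -> qintegrable area (disc r)
  (fun z => W z *: (qconj (zq z ^+ k) * zq z ^+ n)).
Proof.
move=> r1.
apply: (qintegrable_weight beta0 eta0 (B := 1)) => //; first exact: disc_sub.
  exact: qmeasurableM (conj_power_measurable (D := disc r) k)
      (qmeasurableX n (qmeasurable_slice I (D := disc r))).
move=> z /(disc_sub r1) Dz; rewrite qabsM -[leRHS]mulr1.
by rewrite ler_pM ?qabs_ge0// -?[qabs (zq z ^+ n)]qabs_conj conj_power_le1.
Qed.

Let monomial_intr k n (r : R) (a : quat R) : r <= 1 -> qintegrable area (disc r)
  (fun z => W z *: (qconj (zq z ^+ k) * zq z ^+ n) * a).
Proof. by move=> r1; apply: qintegrable_mulr => //; exact: monomial_int. Qed.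

Let F_eq k z : F k z = W z *: (qconj (zq z ^+ k) * f (zq z)) -
  W z *: (qconj (zq z ^+ k) * zq z ^+ k) * c k.
Proof. by rewrite /F mulrBr scalerBr mulrA -scalerAl. Qed.

Let F_int k : qintegrable area (disc 1) (F k).
Proof.
apply: (eq_qintegrable (mD 1) (F := fun z => _)); last first.
  exact: (qintegrableB (mD 1) (pair_int k) (monomial_intr k k (c k) (lexx 1))).
by move=> z _; rewrite F_eq.
Qed.

Let partial_eq0 k r N : r <= 1 -> qint area (disc r)
  (fun z => \sum_(0 <= n < N) W z *: (qconj (zq z ^+ k) * zq z ^+ n) * c' k n) = 0.
Proof.
move=> r1; rewrite qint_sum//; last by move=> n; exact: monomial_intr.
rewrite big1// => n _; rewrite qint_mulr//; last exact: monomial_int.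
rewrite /c'; have [->|nk] := eqVneq n k; first by rewrite mulr0.
by rewrite (qint_monomials beta0 eta0 hI r1) 1?eq_sym// mul0r.
Qed.

Let F_eq0 k r : 0 < r < 1 -> qint area (disc r) (F k) = 0.
Proof.
move=> r01; have r1 : r <= 1 by case/andP: r01 => _ /ltW.
have [C [q [q01 Cq]]] := c'_bound k r01.
have iF : qintegrable area (disc r) (F k).
  by move=> i; apply: (integrableS (mD 1)) (F_int k i) => //; exact: disc_sub.
have iW : area.-integrable (disc r) (EFin \o W).
  apply: (integrableS (mD 1)) (integrable_weight beta0 eta0) => //.
  exact: disc_sub.
pose V := \int[area]_(z in disc r) W z.
have V0 : 0 <= V by apply: Rintegral_ge0 => z _; exact: weight_ge0.
(* The majorant comes without a sign for [C], hence the absolute value. *)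
pose A := `|C| / (1 - q).
have A0 : 0 <= A.
  by case/andP: q01 => q0 q1; rewrite divr_ge0// subr_ge0 ltW.
have bound N : qabs (qint area (disc r) (F k)) <= 2 * (A * q ^+ N * V).
  pose S z := \sum_(0 <= n < N) W z *: (qconj (zq z ^+ k) * zq z ^+ n) * c' k n.
  have iS : qintegrable area (disc r) S.
    by apply: qintegrable_sum => // n; exact: monomial_intr.
  rewrite -[qint _ _ _]subr0 -(partial_eq0 k N r1) -qintB//.
  rewrite -RintegralZl//.
  apply: qabs_qint => //.
  - exact: qintegrableB.
  - exact: eq_integrable (integrableZl (mD r) (A * q ^+ N) iW).
  - move=> z Dz; have Dz1 := disc_sub r1 Dz.
    have -> : F k z - S z = W z *: (qconj (zq z ^+ k) *
        ((f (zq z) - zq z ^+ k * c k) - series (fun n => zq z ^+ n * c' k n) N)).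
      rewrite mulrBr scalerBr; congr (_ - _).
      rewrite /S /series/= mulr_sumr scaler_sumr; apply: eq_bigr => n _.
      by rewrite -scalerAl mulrA.
    rewrite qabsZ ger0_norm ?weight_ge0// mulrC ler_wpM2r ?weight_ge0//.
    rewrite qabsM -[leRHS]mul1r ler_pM ?qabs_ge0//; first exact: conj_power_le1.
    apply: series_tail => //.
    - move=> n; apply: le_trans (Cq _ Dz n) _.
      apply: ler_wpM2r; last exact: ler_norm.
      by rewrite exprn_ge0//; case/andP: q01.
    - by apply: c'_series; exact: (qabs_zq_lt1 hI).
apply: (@qabs_small_eq0 _ _ (2 * (A * V))); first exact: mulr_ge0 _ (mulr_ge0 A0 V0).
move=> e e0.
have lim0 := @cvg_geometric0 _ 1 _ q01.
have /cvgr0Pnorm_lt /(_ e e0) [N _ hN] := lim0.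
apply: (le_trans (bound N)); rewrite -[_ * _ * e]mulrA; apply: ler_wpM2l => //.
rewrite [A * V * e]mulrAC; apply: ler_wpM2r => //; apply: ler_wpM2l => //.
have := hN N (leqnn N); rewrite /= mul1r => /ltW.
by apply: le_trans; exact: ler_norm.
Qed.

Lemma coefficient_integral k :
  qint area (disc 1) (fun z => W z *: (qconj (zq z ^+ k) * f (zq z))) =
  slice_moment k *: c k.
Proof.
have := qint_disc_lim (F_int k) (@F_eq0 k).
have -> : F k = (fun z => W z *: (qconj (zq z ^+ k) * f (zq z)) -
    W z *: (qconj (zq z ^+ k) * zq z ^+ k) * c k) by exact/funext/F_eq.
rewrite qintB//; last exact: monomial_intr.
by rewrite qint_monomial_coef => /eqP; rewrite subr_eq0 => /eqP.
Qed.

End Coefficients.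

(** * Coefficients and convergence of the kernel *)

Section KernelCoefficients.
Variables (R : realType) (beta eta : R).
Hypotheses (beta0 : 0 < beta) (eta0 : 0 < eta).

Definition kernel_coef (k : nat) : R :=
  Gamma (beta + eta) / (pi * Gamma eta * Gamma beta) *
  (pochhammer 1 k * pochhammer (eta + beta) k / (pochhammer beta k * k`!%:R)).

Let be0 : 0 < beta + eta. Proof. exact: addr_gt0. Qed.
Let G1 := Gamma_gt0 beta0.
Let G2 := Gamma_gt0 eta0.
Let G3 := Gamma_gt0 be0.
Let P1 k := pochhammer_gt0 k beta0.
Let P2 k := pochhammer_gt0 k be0.
Let F0 k : 0 < k`!%:R :> R. Proof. by rewrite ltr0n fact_gt0. Qed.

Lemma kernel_coefE k : kernel_coef k =
  Gamma (beta + eta) / (pi * Gamma eta * Gamma beta) *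
  (pochhammer (beta + eta) k / pochhammer beta k).
Proof.
rewrite /kernel_coef pochhammer1 [eta + beta]addrC; congr (_ * _).
by field; rewrite !lt0r_neq0.
Qed.

Let kernel_cst_gt0 : 0 < Gamma (beta + eta) / (pi * Gamma eta * Gamma beta).
Proof.
exact: divr_gt0 G3 (mulr_gt0 (mulr_gt0 (pi_gt0 R) G2) G1).
Qed.

Lemma kernel_coef_gt0 k : 0 < kernel_coef k.
Proof.
rewrite kernel_coefE; exact: mulr_gt0 kernel_cst_gt0 (divr_gt0 (P2 k) (P1 k)).
Qed.

(** The rising factorials are quotients of Gamma values, so those of the moment and of the
    hypergeometric coefficient cancel; the factor [pochhammer 1 k] has already absorbed the
    factorial. *)
Lemma kernel_coef_moment k : kernel_coef k * slice_moment beta eta k = 1.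
Proof.
rewrite kernel_coefE /slice_moment.
have -> : beta + k%:R + eta = beta + eta + k%:R by rewrite addrAC.
rewrite !GammaDn//.
have := P1 k; have := P2 k; have := G1; have := G2; have := G3; have := @pi_gt0 R.
move: (pochhammer _ _) (pochhammer _ _) (Gamma _) (Gamma _) (Gamma _) (pi : R).
move=> a b c d e p p0 e0 d0 c0 b0 a0.
by field; rewrite !lt0r_neq0.
Qed.

Lemma kernel_coefS k :
  kernel_coef k.+1 = (beta + eta + k%:R) / (beta + k%:R) * kernel_coef k.
Proof.
have bk : 0 < beta + k%:R by rewrite ltr_wpDr.
rewrite !kernel_coefE !pochhammerS.
have := P1 k; have := G1; have := G2; have := @pi_gt0 R.
move: bk; move: (_ / (pi * _ * _)) => g.
move: (beta + k%:R) (beta + eta + k%:R) (pochhammer _ _) (pochhammer _ _).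
move=> x y a b x0 _ _ _ b0.
by field; rewrite !lt0r_neq0.
Qed.

Lemma kernel_coef_geometric (r : R) : 0 <= r < 1 ->
  exists C lam, 0 <= lam < 1 /\ forall k, kernel_coef k * r ^+ k <= C * lam ^+ k.
Proof.
move=> /andP[r0 r1]; pose lam := (1 + r) / 2.
have lam0 : 0 < lam by rewrite /lam; lra.
have lam1 : lam < 1 by rewrite /lam; lra.
(* The ratio of consecutive coefficients is 1 + eta / (beta + k). Once k exceeds 2 eta / (1 - r),
   its product with r is at most the midpoint [lam] of r and 1. *)
pose K := (Num.truncn (2 * eta / (1 - r))).+1.
have uK k : (K <= k)%N ->
    kernel_coef k.+1 * r ^+ k.+1 <= lam * (kernel_coef k * r ^+ k).
  move=> Kk; rewrite kernel_coefS exprS.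
  have bk : 0 < beta + k%:R by rewrite ltr_wpDr.
  have -> : (beta + eta + k%:R) / (beta + k%:R) * kernel_coef k * (r * r ^+ k) =
    (beta + eta + k%:R) / (beta + k%:R) * r * (kernel_coef k * r ^+ k) by ring.
  apply: ler_wpM2r.
    exact: mulr_ge0 (ltW (kernel_coef_gt0 k)) (exprn_ge0 k r0).
  rewrite mulrAC ler_pdivrMr//.
  have : 2 * eta / (1 - r) < K%:R by exact: truncnS_gt.
  have : K%:R <= k%:R :> R by rewrite ler_nat.
  move=> h1 h2; have := lt_le_trans h2 h1.
  rewrite ltr_pdivrMr ?subr_gt0//; move: (k%:R : R) => x h.
  rewrite /lam.
  have r10 : 0 < 1 - r by rewrite subr_gt0.
  have e1 : eta * r <= eta by rewrite ler_piMr// ltW.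
  have e2 : 0 <= beta * (1 - r) by rewrite mulr_ge0// ltW.
  nra.
have u0 k : 0 <= kernel_coef k * r ^+ k.
  exact: mulr_ge0 (ltW (kernel_coef_gt0 k)) (exprn_ge0 k r0).
have [C hC] := ratio_geometric lam0 u0 uK.
by exists C, lam; rewrite (ltW lam0) lam1.
Qed.

Definition kernel_term (q : quat R) (k : nat) : quat R :=
  kernel_coef k *: qconj q ^+ k.

Lemma kernel_term_geometric q : qball q ->
  exists C lam, 0 <= lam < 1 /\ forall k, qabs (kernel_term q k) <= C * lam ^+ k.
Proof.
move=> bq; have q01 : 0 <= qabs q < 1 by rewrite qabs_ge0.
have [C [lam [h1 h2]]] := kernel_coef_geometric q01.
exists C, lam; split=> // k.
rewrite /kernel_term qabsZ ger0_norm ?(ltW (kernel_coef_gt0 k))//.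
by rewrite qabsX qabs_conj.
Qed.

Lemma kernel_term_summable q : qball q -> exists A, forall N,
  \sum_(0 <= k < N) qabs (kernel_term q k) <= A.
Proof.
move=> /kernel_term_geometric[C [lam [l01 hC]]].
have C0 : 0 <= C.
  by have := hC 0; rewrite expr0 mulr1; apply: le_trans; exact: qabs_ge0.
exists (C * (1 / (1 - lam))) => N.
apply: (@le_trans _ _ (\sum_(0 <= k < N) C * lam ^+ k)).
  by apply: ler_sum => k _; exact: hC.
rewrite -mulr_sumr ler_wpM2l//; apply: le_trans (geometric_tail 0 N l01) _.
by rewrite expr0.
Qed.

Lemma kernel_term_pow (p q : quat R) k : qabs p <= 1 ->
  qabs (p ^+ k * kernel_term q k) <= qabs (kernel_term q k).
Proof.
move=> p1; rewrite qabsM qabsX -[leRHS]mul1r ler_wpM2r ?qabs_ge0//.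
by rewrite exprn_ile1 ?qabs_ge0.
Qed.

Lemma kernel_series p q : qabs p <= 1 -> qball q ->
  series (fun k => p ^+ k * kernel_term q k) @ \oo --> bergman_kernel beta eta p q.
Proof.
move=> p1 bq; have [A hA] := kernel_term_summable bq.
have cu : cvgn (series (fun k => p ^+ k * kernel_term q k)).
  apply: (@quat_series_cvg _ _ A) => N; apply: le_trans (hA N).
  by apply: ler_sum => k _; exact: kernel_term_pow.
suff -> : bergman_kernel beta eta p q =
  limn (series (fun k => p ^+ k * kernel_term q k)) by [].
rewrite /bergman_kernel /hyp2F1_star.
set g := Gamma (beta + eta) / _.
have g0 : g != 0 := lt0r_neq0 kernel_cst_gt0.
set v := (X in series X).
(* The normalising constant is divided out as multiplication by a real quaternion, so that the limit
   of a product applies. *)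
have uv : series v = (fun n => (g^-1)%:A * series (fun k => p ^+ k * kernel_term q k) n).
  apply/funext => n; rewrite /series/= mulr_sumr; apply: eq_bigr => k _.
  rewrite mulr_algl /v /kernel_term /kernel_coef -/g -scalerAr !scalerA.
  by congr (_ *: _); rewrite mulKf.
have cv : series v @ \oo -->
    (g^-1)%:A * limn (series (fun k => p ^+ k * kernel_term q k)).
  rewrite uv; apply: quat_cvgM; [exact: cvg_cst|exact: cu].
rewrite (cvg_lim _ cv)//.
by rewrite mulr_algl scalerA mulfV// scale1r.
Qed.

End KernelCoefficients.

(** * Membership, reproduction and symmetry of the kernel *)

Section Reproducing.
Variables (R : realType) (beta eta : R) (I : quat R).
Hypotheses (beta0 : 0 < beta) (eta0 : 0 < eta) (hI : qsphere I).
Local Notation plane := (measurableTypeR R * measurableTypeR R)%type.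
Local Notation area := (@area R).
Local Notation W := (slice_weight beta eta).
Local Notation zq := (fun z : plane => slice_pt I z.1 z.2).
Local Notation K := (bergman_kernel beta eta).
Local Notation t := (kernel_term beta eta).

Let mD (r : R) : measurable (disc r). Proof. exact: measurable_disc. Qed.

Let zq1 z : disc 1 z -> qabs (zq z) <= 1.
Proof. by move=> /(qabs_zq_lt1 hI) /ltW. Qed.

Lemma bergman_kernel_bounded q : qball q ->
  exists A, forall p, qabs p <= 1 -> qabs (K p q) <= A.
Proof.
move=> bq; have [A hA] := kernel_term_summable beta0 eta0 bq.
exists A => p p1; apply: (qabs_lim_le (kernel_series beta0 eta0 p1 bq)) => n.
apply: le_trans (qabs_sum _ _) _; apply: le_trans (hA n).
by apply: ler_sum => k _; exact: kernel_term_pow.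
Qed.

Let partial q N z : quat R := \sum_(0 <= k < N) zq z ^+ k * t q k.

Let partial_measurable q N : qmeasurable (disc 1) (partial q N).
Proof.
apply: qmeasurable_sum => k; apply: qmeasurableM; last exact: qmeasurable_cst.
exact: qmeasurableX (qmeasurable_slice I (D := disc 1)).
Qed.

Lemma bergman_kernel_measurable q : qball q -> qmeasurable (disc 1) (fun z => K (zq z) q).
Proof.
move=> bq; apply: (qmeasurable_cvg (partial_measurable q)) => z Dz.
exact: (kernel_series beta0 eta0 (zq1 Dz) bq).
Qed.

Lemma bergman_kernel_A2slice q : qball q -> A2slice I beta eta (K ^~ q).
Proof.
move=> bq; have [A hA] := kernel_term_summable beta0 eta0 bq.
have [B hB] := bergman_kernel_bounded bq.
split.
  apply: (series_slice_regular hA) => p bp.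
  by apply: kernel_series => //; exact: ltW.
split; rewrite (slice_ball_disc hI); first exact: bergman_kernel_measurable.
have iB : area.-integrable (disc 1) (fun z => (B ^+ 2 * W z)%:E).
  exact: eq_integrable (integrableZl (mD 1) (B ^+ 2) (integrable_weight beta0 eta0)).
have iK : area.-integrable (disc 1) (fun z => (qabs (K (zq z) q) ^+ 2 * W z)%:E).
  apply: (le_integrable (mD 1) _ _ iB).
    apply/measurable_EFinP.
    exact: measurable_funM (measurable_sqr_qabs (bergman_kernel_measurable bq))
      (measurable_weight beta eta (D := disc 1)).
  move=> z Dz; rewrite lee_fin; have W0 := weight_ge0 beta eta z.
  have Kz := hB _ (zq1 Dz); have B0 := le_trans (qabs_ge0 _) Kz.
  rewrite (ger0_norm (mulr_ge0 (sqr_ge0 (qabs (K (zq z) q))) W0)).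
  rewrite (ger0_norm (mulr_ge0 (sqr_ge0 B) W0)); apply: ler_wpM2r => //.
  by rewrite ler_sqr ?nnegrE ?qabs_ge0.
exact: (integrable_lty _ iK).
Qed.

Lemma bergman_kernel_reproducing q f : qball q -> A2slice I beta eta f ->
  f q = slice_inner I beta eta (K ^~ q) f.
Proof.
move=> bq hf; have [c [cM cf]] := slice_regular_series hf.1.
have -> : slice_inner I beta eta (K ^~ q) f =
    qint area (disc 1) (fun z => W z *: (qconj (K (zq z) q) * f (zq z))).
  by rewrite /slice_inner -(slice_ball_disc hI).
set Q := qint _ _ _.
have [C [lam [l01 hC]]] := kernel_term_geometric beta0 eta0 bq.
have [B hB] := bergman_kernel_bounded bq.
pose V := \int[area]_(z in disc 1) A2slice_majorant beta eta I f z.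
pose del N := C / (1 - lam) * lam ^+ N.
have hdel N z : disc 1 z -> qabs (K (zq z) q - partial q N z) <= del N.
  move=> Dz; apply: series_tail l01 _ (kernel_series beta0 eta0 (zq1 Dz) bq) => n.
  exact: le_trans (kernel_term_pow _ _ _ _ (zq1 Dz)) (hC n).
have mK := qmeasurable_conj (bergman_kernel_measurable bq).
have iK : qintegrable area (disc 1)
    (fun z => W z *: (qconj (K (zq z) q) * f (zq z))).
  apply: (qintegrable_pair beta0 eta0 hI hf (B := B)) => // z Dz.
  by rewrite qabs_conj hB// zq1.
have it k : qintegrable area (disc 1)
    (fun z => (kernel_coef beta eta k *: q ^+ k) *
      (W z *: (qconj (zq z ^+ k) * f (zq z)))).
  apply: qintegrable_mull => //.
  apply: (qintegrable_pair beta0 eta0 hI hf (B := 1)).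
    exact: conj_power_measurable.
  exact: conj_power_le1.
(* Conjugation reverses the product and turns the powers of [qconj q] into powers of q on the far
   left. They leave the integral there, and the coefficient of f stays on their right. *)
have partialE N z : W z *: (qconj (partial q N z) * f (zq z)) =
    \sum_(0 <= k < N) (kernel_coef beta eta k *: q ^+ k) *
      (W z *: (qconj (zq z ^+ k) * f (zq z))).
  rewrite qconj_sum mulr_suml scaler_sumr; apply: eq_bigr => k _.
  by rewrite qconjM /kernel_term qconjZ qconjX qconjK -scalerAr mulrA.
have iP N : qintegrable area (disc 1)
    (fun z => W z *: (qconj (partial q N z) * f (zq z))).
  apply: (eq_qintegrable (mD 1) _ (qintegrable_sum N (mD 1) it)) => z _.
  by rewrite partialE.
have QP N : qint area (disc 1) (fun z => W z *: (qconj (partial q N z) * f (zq z))) =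
    series (fun k => q ^+ k * c k) N.
  rewrite (eq_qint _ (fun z _ => partialE N z)) qint_sum//.
  rewrite /series/=; apply: eq_bigr => k _.
  rewrite qint_mull//; last first.
    apply: (qintegrable_pair beta0 eta0 hI hf (B := 1)).
      exact: conj_power_measurable.
    exact: conj_power_le1.
  rewrite (coefficient_integral beta0 eta0 hI hf cM cf).
  by rewrite -scalerAl -scalerAr scalerA kernel_coef_moment// scale1r.
have sQ : series (fun k => q ^+ k * c k) @ \oo --> Q.
  apply: (quat_squeeze (v := fun N => 2 * (V * (C / (1 - lam))) * lam ^+ N)).
    move=> N; rewrite -QP qabs_distC /Q -qintB//.
    have -> : 2 * (V * (C / (1 - lam))) * lam ^+ N = 2 * (del N * V).
      by rewrite /del; ring.
    have mB : qmeasurable (disc 1) (fun z => qconj (K (zq z) q - partial q N z)).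
      apply: qmeasurable_conj => i.
      under eq_fun do rewrite qadd_coord qopp_coord.
      exact: measurable_funB (bergman_kernel_measurable bq i) (partial_measurable q N i).
    have bB z : disc 1 z -> qabs (qconj (K (zq z) q - partial q N z)) <= del N.
      by move=> Dz; rewrite qabs_conj hdel.
    apply: le_trans (qabs_qint_pair beta0 eta0 hI hf mB bB).
    rewrite le_eqVlt; apply/orP; left; apply/eqP; congr qabs.
    apply: eq_qint => z _; rewrite -scalerBr -mulrBl; congr (_ *: (_ * _)).
    by rewrite /qconj; apply: quatP; rewrite !mxE /=; split; ring.
  exact: cvg_geometric0.
have cq := cf q bq; by rewrite -(cvg_lim _ cq)// -(cvg_lim _ sQ).
Qed.

(** The coefficients are real, and conjugating p^k times a power of a conjugate exchanges the two
    variables. *)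
Lemma qconj_bergman_kernel p q : qball p -> qball q -> qconj (K q p) = K p q.
Proof.
move=> bp bq.
have c1 : (fun n => qconj (series (fun k => q ^+ k * t p k) n)) @ \oo --> qconj (K q p).
  by apply: quat_cvg_conj; exact: (kernel_series beta0 eta0 (ltW bq) bp).
have c2 := kernel_series beta0 eta0 (ltW bp) bq.
rewrite -(cvg_lim _ c1)// -(cvg_lim _ c2)//.
apply: (congr1 (fun g : nat -> quat R => lim (g @ \oo))); apply/funext => n.
rewrite /series/= qconj_sum; apply: eq_bigr => k _.
by rewrite /kernel_term qconjM qconjZ !qconjX qconjK -scalerAl -scalerAr.
Qed.

(** Hermitian symmetry against a kernel function, whose boundedness makes the integrand
    integrable. *)
Lemma slice_inner_conj q f : qball q -> A2slice I beta eta f ->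
  slice_inner I beta eta f (K ^~ q) = qconj (slice_inner I beta eta (K ^~ q) f).
Proof.
move=> bq hf; have [B hB] := bergman_kernel_bounded bq.
rewrite /slice_inner (slice_ball_disc hI) -[RHS]qint_conj//.
  apply: eq_qint => z _.
  by rewrite qconjZ qconjM qconjK.
apply: (qintegrable_pair beta0 eta0 hI hf (B := B)) => [|z Dz].
  exact: qmeasurable_conj (bergman_kernel_measurable bq).
by rewrite qabs_conj hB// zq1.
Qed.

End Reproducing.

Theorem proposition2p1 (R : realType) (I : quat R) (beta eta : R)
    (hI : qsphere I) (hbeta : 0 < beta) (heta : 0 < eta) :
  reproducing_kernel I beta eta (bergman_kernel beta eta) /\
  (forall K : quat R -> quat R -> quat R,
     reproducing_kernel I beta eta K ->
     forall p q : quat R, qball p -> qball q ->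
       K p q = bergman_kernel beta eta p q).
Proof.
split=> [q bq|K hK p q bp bq].
  split=> [|f hf]; first exact: bergman_kernel_A2slice.
  exact: bergman_kernel_reproducing.
have [KA Krep] := hK q bq.
(* With B the explicit kernel: K(p,q) = <B(.,p), K(.,q)>, the conjugate of <K(.,q), B(.,p)> =
   B(q,p), and the conjugate of B(q,p) is B(p,q). *)
rewrite (bergman_kernel_reproducing hbeta heta hI bp KA).
rewrite -[LHS]qconjK -(slice_inner_conj hbeta heta hI bp KA).
rewrite -(Krep _ (bergman_kernel_A2slice hbeta heta hI bp)).
exact: qconj_bergman_kernel.
Qed.
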